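(* For every convex body $K\subset\mathbb R^2$ there is a zonoid $K^0\subset K$ such that for every $\varepsilon>0$ $$\lim_{n\to\infty}\frac{\operatorname{card}\{P\in\mathcal F(K,n):\operatorname{dist}(P,K^0)>\varepsilon\}}{\operatorname{card}\mathcal F(K,n)}=0.$$
   Context: A convex body is a compact convex set with non-empty interior. For a positive integer $n$, $\mathcal F(K,n)$ is the finite collection of all $\frac1n\mathbb Z^2$-lattice zonotopes contained in $K$, i.e. of all zonotopes (translates of finite Minkowski sums of segments) $P\subset K$ all of whose vertices lie in $\frac1n\mathbb Z^2$. A zonoid is a limit, in the Hausdorff metric, of zonotopes; in the plane zonoids are the same as centrally symmetric compact convex sets. $\operatorname{dist}$ is the Hausdorff distance. *)

(* Defs.v *)
From mathcomp Require Import all_boot all_order all_algebra finmap.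
From mathcomp Require Import all_classical all_reals all_analysis.
Import Order.TTheory GRing.Theory Num.Theory.
Import numFieldNormedType.Exports.

Set Implicit Arguments.
Unset Strict Implicit.
Unset Printing Implicit Defensive.

Local Open Scope classical_set_scope.
Local Open Scope ring_scope.

Section PlaneConvexity.
Variable R : realType.
Local Notation plane := 'rV[R]_2.
Implicit Types (A B K P : set plane) (v x y : plane) (n : nat).

(* The library norm on row vectors is the sup norm. *)
Definition enorm x : R := Num.sqrt (\sum_i x 0 i ^+ 2).

(* Valued in \bar R: the value is +oo when A is unbounded and B is compact and
   nonempty, or when exactly one of A and B is empty. *)
Definition hausdorff_dist A B : \bar R :=
  maxe (ereal_sup [set ereal_inf [set (enorm (a - b))%:E | b in B] | a in A])
       (ereal_sup [set ereal_inf [set (enorm (a - b))%:E | a in A] | b in B]).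

Definition convex_body K :=
  [/\ compact K, convex_set K & K° !=set0].

Definition segment x y : set plane :=
  [set (1 - t) *: x + t *: y | t in `[0, 1]].

Definition minkowski_sum A B : set plane := [set a + b | a in A & b in B].

Definition zonotope P :=
  exists (c : plane) (s : seq (plane * plane)),
    P = [set c + z | z in
          \big[minkowski_sum/[set 0]]_(e <- s) segment e.1 e.2].

(* Vertices of a polytope, as its extreme points. *)
Definition vertex P v :=
  P v /\ forall x y (t : R), P x -> P y -> 0 < t < 1 ->
    v = (1 - t) *: x + t *: y -> x = v /\ y = v.

Definition scaled_lattice n : set plane :=
  [set n%:R^-1 *: map_mx intr z | z in [set: 'rV[int]_2]].

Definition lattice_zonotopes K n : set (set plane) :=
  [set P | [/\ zonotope P, P `<=` K & vertex P `<=` scaled_lattice n]].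

(* Hausdorff limits are taken among compact sets; without compactness the limit
   is determined only up to closure. *)
Definition zonoid A :=
  compact A /\
  exists2 Z : nat -> set plane, (forall k, zonotope (Z k)) &
    hausdorff_dist (Z k) A @[k --> \oo] --> 0%E.

End PlaneConvexity.

(* [fset_set] is the empty finite set on infinite sets; it is only applied here
   to subsets of [lattice_zonotopes K n] with K bounded and n > 0, which are
   finite (the term n = 0 does not affect a limit). *)
Definition ncard (T : choiceType) (A : set T) : nat := #|` fset_set A |.

(* Main.v *)
(** Write a lattice zonotope in [K] as a translate of
    [n^-1 * \sum_v m_v [0, v]], where [v] runs through the primitive vectors of a
    half-plane and [m] is a finitely supported family of multiplicities; the
    pair (centre, [m]) determines the zonotope, and there are polynomially many
    centres.  For a norm [psi] give [m] the weight [exp (- e * \sum_v m_v psi v)]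
    with [e = n^(-1/3)].  The total weight is [exp (e^-2 (Ent psi + o(1)))], and
    zonotopes in [K] have [e^3 \sum_v m_v psi v <= Lam psi], the largest
    [psi]-length of a zonotope in [K]; hence there are at most
    [exp (e^-2 (Lam psi + Ent psi + o(1)))] of them.  Let [psi] minimise
    [Lam + Ent] over all norms.  Under the weights of [psi] every
    [e^3 \sum_v m_v phi v] concentrates exponentially around the derivative
    [Dlim psi phi] of [- Ent], and the first order condition reads
    [Dlim psi phi <= Lam phi], with equality for [phi = psi].  By convex duality
    this inequality says that a translate [K0] of the zonoid of width
    [u |-> Dlim psi |<u, .>|] lies in [K].  So typical [m] give, after a slight
    shrinking, zonotopes in [K] close to [K0], their number attains the upper
    bound to exponential order, and the atypical ones are exponentially fewer. *)
Require Import Defs.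
From mathcomp Require Import all_boot all_order all_algebra finmap.
From mathcomp Require Import all_classical all_reals all_analysis.
From mathcomp Require Import ring lra zify.
Import Order.TTheory GRing.Theory Num.Theory.
Import numFieldNormedType.Exports.

Set Implicit Arguments.
Unset Strict Implicit.
Unset Printing Implicit Defensive.

Local Open Scope classical_set_scope.
Local Open Scope ring_scope.

(** The exponent -1/3 balances two scales: under the weights [m_v] has mean about [(e psi v)^-1] as
    long as [psi v] is at most of order [e^-1], so the total length is of order [e^-3], and this
    must match [n] for the zonotope to have size of order one. The number of competing zonotopes is
    then exponential in [e^-2 = n^(2/3)], which makes the number of centres, constant factors and
    the truncation of multiplicities harmless. Arbitrary norms are treated without an integral
    formula: [Ent] and [Dlim] are only shown to exist as limits, starting from the existence of a
    density of primitive points in dilates of a norm ball. Derivatives come from the convexity of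
    the log partition function, with an explicit second-order error uniform in the scale. The lower
    count needs room for rounding the centre to the lattice. It is bought by replacing [psi] with
    [l psi] for some [l > 1] close to 1: typical widths shrink by [l^-3], while the exponent only
    loses a factor [l^-2]. *)

(** * Sums over a square box and their grouping by gcd *)

Section DoubleSums.
Variable R : realType.
Implicit Types (F G : nat -> nat -> R) (B k : nat).

Lemma ler_bool (b1 b2 : bool) : (b1 -> b2) -> b1%:R <= b2%:R :> R.
Proof. by case: b1; case: b2 => //= h; have := h isT. Qed.

Definition sum2 F B : R := \sum_(0 <= a < B) \sum_(0 <= b < B) F a b.

Lemma sum2_le F G B : (forall a b, (a < B)%N -> (b < B)%N -> F a b <= G a b) ->
  sum2 F B <= sum2 G B.
Proof.
move=> h; rewrite /sum2 !big_nat; apply: ler_sum => a /andP[_ ha].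
by rewrite !big_nat; apply: ler_sum => b /andP[_ hb]; exact: h.
Qed.

Lemma sum2_ge0 F B : (forall a b, 0 <= F a b) -> 0 <= sum2 F B.
Proof. by move=> h; apply: sumr_ge0 => a _; apply: sumr_ge0. Qed.

Lemma sum2_widen F B B' : (B <= B')%N ->
  (forall a b, (a < B')%N -> (b < B')%N -> (B <= a)%N || (B <= b)%N ->
    F a b = 0) -> sum2 F B' = sum2 F B.
Proof.
move=> le h; rewrite /sum2 (@big_cat_nat _ _ _ B) //= [X in _ + X]big1_seq ?addr0.
  rewrite !big_nat; apply: eq_bigr => a /andP[_ ha].
  rewrite (@big_cat_nat _ _ _ B) //= [X in _ + X]big1_seq ?addr0 // => b.
  rewrite mem_index_iota => /andP[_ /andP[hb hb']].
  by rewrite h ?hb ?orbT //; exact: leq_trans le.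
move=> a; rewrite mem_index_iota => /andP[_ /andP[ha ha']].
by rewrite big_nat big1 // => b /andP[_ hb]; rewrite h // ha.
Qed.

Lemma sum2_split F B k : sum2 F (B * k) =
  sum2 (fun a b => sum2 (fun i j => F (a * k + i)%N (b * k + j)%N) k) B.
Proof.
rewrite /sum2 big_nat_mul; apply: eq_bigr => a _.
rewrite -[X in \sum_(X <= _ < _) _]addn0 mulSn addnC big_addn addnK.
rewrite [RHS]exchange_big /=; apply: eq_bigr => i _.
rewrite big_nat_mul; apply: eq_bigr => b _.
rewrite -[X in \sum_(X <= _ < _) _]addn0 mulSn addnC big_addn addnK.
by apply: eq_bigr => j _; rewrite ![(_ + _ * k)%N]addnC.
Qed.

Lemma sum2_const (x : R) B : sum2 (fun _ _ => x) B = B%:R ^+ 2 * x.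
Proof.
rewrite /sum2 !sumr_const_nat subn0 -mulrnA -[LHS]mulr_natl natrM; ring.
Qed.

Lemma sum2Zl (x : R) F B : sum2 (fun a b => x * F a b) B = x * sum2 F B.
Proof.
by rewrite /sum2 big_distrr; apply: eq_bigr => a _; rewrite big_distrr.
Qed.

Lemma sum2_exchange F B : sum2 (fun a b => F b a) B = sum2 F B.
Proof. by rewrite /sum2 exchange_big. Qed.

Lemma sum2_eq F G B : (forall a b, (a < B)%N -> (b < B)%N -> F a b = G a b) ->
  sum2 F B = sum2 G B.
Proof.
by move=> h; apply/eqP; rewrite eq_le !sum2_le // => a b ha hb; rewrite h.
Qed.

Lemma sum2_single F B : (0 < B)%N ->
  (forall a b, (a < B)%N -> (b < B)%N -> (0 < a)%N || (0 < b)%N -> F a b = 0) ->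
  sum2 F B = F 0%N 0%N.
Proof. by move=> B0 h; rewrite (@sum2_widen _ 1) // /sum2 !big_nat1. Qed.

Lemma sum2_sum (m n : nat) (F : nat -> nat -> nat -> R) B :
  \sum_(m <= k < n) sum2 (F k) B = sum2 (fun a b => \sum_(m <= k < n) F k a b) B.
Proof.
by rewrite /sum2 exchange_big; apply: eq_bigr => a _; rewrite exchange_big.
Qed.

(** A pair with gcd [k] is [k] times a coprime pair, and [0 < a] excludes [k = 0]. For fixed [k] the
    box is enlarged to side [B * k] and cut into [k] by [k] cells; both coordinates are multiples of
    [k] only in the corner of a cell. *)
Lemma sum2_gcd F B :
  (forall a b, (B <= a)%N || (B <= b)%N -> F a b = 0) ->
  sum2 (fun a b => (0 < a)%:R * F a b) B =
  \sum_(1 <= k < B) sum2 (fun a b => ((0 < a)%N && coprime a b)%:R *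
                                     F (k * a)%N (k * b)%N) B.
Proof.
move=> hF.
transitivity (\sum_(1 <= k < B)
    sum2 (fun a b => ((0 < a)%N && (gcdn a b == k))%:R * F a b) B); last first.
  rewrite !big_nat; apply: eq_bigr => k /andP[k0 kB].
  rewrite -(@sum2_widen _ B (B * k)); last 2 first.
  - by rewrite leq_pmulr.
  - by move=> a b _ _ h; rewrite hF ?mulr0.
  rewrite sum2_split; apply: sum2_eq => a b _ _.
  rewrite sum2_single //.
    rewrite !addn0 ![(_ * k)%N]mulnC muln_gt0 k0 /= -muln_gcdr.
    by rewrite -{2}[k]muln1 eqn_pmul2l.
  move=> i j hi hj hij; case: (boolP ((0 < a * k + i)%N && _)); last by rewrite mul0r.
  move=> /andP[_ /eqP h].
  have da : (k %| a * k + i)%N by rewrite -{1}h dvdn_gcdl.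
  have db : (k %| b * k + j)%N by rewrite -{1}h dvdn_gcdr.
  rewrite !dvdn_addr ?dvdn_mull // in da db.
  move: da db; rewrite /dvdn !modn_small; lia.
rewrite sum2_sum; apply: sum2_eq => a b ha hb.
case: (posnP a) => [->|a0]; first by rewrite mul0r big1 // => k _; rewrite mul0r.
have g0 : (0 < gcdn a b)%N by rewrite gcdn_gt0 a0.
have gB : (gcdn a b < B)%N by apply: leq_ltn_trans ha; apply: dvdn_leq => //; exact: dvdn_gcdl.
rewrite (bigD1_seq (gcdn a b)) ?mem_index_iota ?g0 ?gB ?iota_uniq //= eqxx big1 ?addr0 //.
by move=> k; rewrite eq_sym => /negPf ->; rewrite mul0r.
Qed.

(** Telescoping, from [k^-2 <= 1/(k-1) - 1/k]. *)
Lemma sum_inv_sqr (m N : nat) : (2 <= m)%N ->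
  \sum_(m <= k < N) (k%:R ^- 2 : R) <= (m.-1)%:R^-1.
Proof.
move=> hm; case: (leqP m N) => [le|lt]; last by rewrite big_geq ?invr_ge0 ?ler0n // ltnW.
have -> : (m.-1)%:R^-1 = (m.-1%:R^-1 - N.-1%:R^-1) + N.-1%:R^-1 :> R by lra.
rewrite -[leLHS]addr0 lerD ?invr_ge0 ?ler0n //.
rewrite -[leRHS]opprK opprB -(@telescope_sumr _ _ _ (fun k => k.-1%:R^-1 : R)) // -sumrN !big_nat.
apply: ler_sum => k /andP[hk _]; rewrite opprB /=.
have k2 : (2 <= k)%N by exact: leq_trans hk.
case: k hk k2 => // k _ k1 /=.
have k0 : 0 < (k%:R : R) by rewrite ltr0n.
rewrite -subr_ge0.
have -> : k%:R^-1 - k.+1%:R^-1 - k.+1%:R ^- 2 = (k%:R * k.+1%:R ^+ 2)^-1 :> R.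
  rewrite -natr1; field; rewrite natr1 pnatr_eq0 /=.
  by rewrite lt0r_neq0 // andbT.
by rewrite invr_ge0 mulr_ge0 ?sqr_ge0 // ltW.
Qed.

(** Splitting off the term [1/4] brings the bound strictly below 1, where the telescoped bound at
    [m = 2] only gives 1. The contraction in [r_osc_step] rests on this gap. *)
Lemma sum_inv_sqr2 (N : nat) : \sum_(2 <= k < N) (k%:R ^- 2 : R) <= 3/4.
Proof.
case: (leqP N 2) => h; first by rewrite big_geq //; lra.
rewrite big_ltn //; have := @sum_inv_sqr 3 N isT; rewrite /=.
by move: (\sum_(_ <= _ < _) _) => X; lra.
Qed.

End DoubleSums.

(** * Density of the primitive points of a quadrant below a homogeneous function *)

Section QuadrantCount.
Variables (R : realType) (q : nat -> nat -> R) (eta C : R).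
Hypothesis eta_gt0 : 0 < eta.
Hypothesis C_ge0 : 0 <= C.
Hypothesis q_homo : forall k a b, q (k * a) (k * b) = k%:R * q a b.
Hypothesis q_lip : forall a b i j, q a b <= q (a + i) (b + j) + C * (i + j)%:R.
Hypothesis q_low : forall a b, eta * (a + b)%:R <= q a b.

Definition qbound (T : R) : nat := (Num.truncn (T / eta)).+1.

Lemma qbound_gt T a b : q a b <= T -> (a + b < qbound T)%N.
Proof.
move=> h; rewrite ltnNge; apply/negP => hh.
have : T / eta < (a + b)%:R.
  by apply: lt_le_trans (truncnS_gt _) _; rewrite ler_nat.
rewrite ltr_pdivrMr // mulrC => h2; have := q_low a b.
by move=> h3; have := le_lt_trans (le_trans h3 h) h2; rewrite ltxx.
Qed.

(** The box holds every point with [q <= T], so this counts over the whole quadrant; [qcountE]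
    allows any larger box. *)
Definition qcount (P : nat -> nat -> bool) (T : R) : R :=
  sum2 (fun a b => (P a b && (q a b <= T))%:R) (qbound T).

Lemma qcountE P T B : (qbound T <= B)%N ->
  qcount P T = sum2 (fun a b => (P a b && (q a b <= T))%:R) B.
Proof.
move=> le; rewrite /qcount -(sum2_widen le) // => a b _ _ h.
case: (boolP (q a b <= T)) => hq; last by rewrite andbF.
by have /= := qbound_gt hq; move: h; clear; lia.
Qed.

Lemma qcount_le (P P' : nat -> nat -> bool) T T' : (forall a b, P a b -> P' a b) -> T <= T' ->
  qcount P T <= qcount P' T'.
Proof.
move=> hP hT.
have hB : (qbound T <= qbound T')%N.
  by rewrite ltnS le_truncn // ler_pM2r ?invr_gt0.
rewrite (qcountE _ hB) (qcountE _ (leqnn (qbound T'))).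
apply: sum2_le => a b _ _; apply: ler_bool.
by move=> /andP[/hP -> h] /=; exact: le_trans hT.
Qed.

Lemma qcount_ge0 P T : 0 <= qcount P T.
Proof. by apply: sum2_ge0 => a b; rewrite ler0n. Qed.

Lemma qbound_le T : 0 <= T -> (qbound T)%:R <= T / eta + 1.
Proof.
by move=> h; rewrite /qbound -natr1 lerD2r truncn_le divr_ge0 // ltW.
Qed.

Lemma qcount_le_sqr P T : 0 <= T -> qcount P T <= (T / eta + 1) ^+ 2.
Proof.
move=> h; apply: (@le_trans _ _ (sum2 (fun _ _ => 1) (qbound T))).
  by apply: sum2_le => a b _ _; rewrite lern1 leq_b1.
rewrite sum2_const mulr1 ler_sqr ?nnegrE ?ler0n ?qbound_le //.
by rewrite addr_ge0 // divr_ge0 // ltW.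
Qed.

Local Notation Q := (qcount (fun _ _ => true)).

(** Cut the quadrant into [k] by [k] cells. If a cell contains a point with [q <= k T], then by
    [q_lip] its corner [(k a, k b)] has [q <= k T + 2 k C], that is [q a b <= T + 2 C], and the cell
    contributes at most [k^2] points. *)
Lemma qcount_scale k T : (0 < k)%N -> Q (k%:R * T) <= k%:R ^+ 2 * Q (T + 2 * C).
Proof.
move=> k0; set B := maxn (qbound (k%:R * T)) (qbound (T + 2 * C)).
have kR : 0 < (k%:R : R) by rewrite ltr0n.
have h1 : (qbound (k%:R * T) <= B * k)%N.
  by apply: (leq_trans (leq_maxl _ (qbound (T + 2 * C)))); rewrite leq_pmulr.
rewrite (qcountE _ h1) (qcountE _ (leq_maxr (qbound (k%:R * T)) _)) -/B.
rewrite sum2_split -sum2Zl; apply: sum2_le => a b _ _.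
rewrite -sum2_const; apply: sum2_le => i j hi hj.
apply: ler_bool => /= h.
rewrite -(ler_pM2l kR) -q_homo mulnC [(k * b)%N]mulnC.
apply: le_trans (q_lip _ _ i j) _.
rewrite mulrDr lerD //.
have -> : k%:R * (2 * C) = C * (2 * k)%:R by rewrite natrM; ring.
by rewrite ler_wpM2l // ler_nat; lia.
Qed.

Lemma inv_cvg0_pinfty : (T : R)^-1 @[T --> +oo] --> (0 : R).
Proof. by apply/gtr0_cvgV0; [exact: nbhs_pinfty_gt|exact: cvg_id]. Qed.

(* Fekete-type argument: [Q (k T) <= k^2 Q (T + 2 C)] is a quasi-subadditivity of [Q T / T^2]. *)
Lemma qcount_cvg : exists b : R, Q T / T ^+ 2 @[T --> +oo] --> b.
Proof.
pose A := [set Q (T + 2 * C) / T ^+ 2 | T in [set T : R | 0 < T]].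
have A0 : lbound A 0 by move=> _ [T hT <-]; rewrite divr_ge0 ?qcount_ge0 ?sqr_ge0.
have hA : has_inf A.
  by split; [exists (Q (1 + 2 * C) / 1 ^+ 2); exists 1 => //=|exists 0].
exists (inf A); apply/cvgrPdist_le => /= e e0.
have [_ [T0 /= T00 <-] hT0] := inf_adherent e0 hA.
have up : \forall T \near +oo, (T0^-1 + T^-1) * (T0^-1 + T^-1) * Q (T0 + 2 * C) < inf A + e.
  apply: (@cvgr_lt _ _ _ _ _ (Q (T0 + 2 * C) / T0 ^+ 2)) => //.
  have -> : Q (T0 + 2 * C) / T0 ^+ 2 = (T0^-1 + 0) * (T0^-1 + 0) * Q (T0 + 2 * C).
    by field; rewrite gt_eqF.
  apply: cvgM; last exact: cvg_cst.
  by apply: cvgM; apply: cvgD; by [exact: cvg_cst|exact: inv_cvg0_pinfty].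
have dn : \forall T \near +oo, inf A - e < inf A * ((1 - 2 * C * T^-1) * (1 - 2 * C * T^-1)).
  apply: (@cvgr_gt _ _ _ _ _ (inf A)); last lra.
  rewrite -[X in _ --> X]mulr1; apply: cvgM; first exact: cvg_cst.
  have h : 1 - 2 * C * T^-1 @[T --> +oo] --> (1 : R).
    rewrite -[X in _ --> X]subr0; apply: cvgB; first exact: cvg_cst.
    rewrite -[X in _ --> X](mulr0 (2 * C)).
    by apply: cvgM; [exact: cvg_cst|exact: inv_cvg0_pinfty].
  by rewrite -[X in _ --> X]mulr1; exact: cvgM.
near=> T.
have Tp : 0 < T by near: T; exact: nbhs_pinfty_gt.
have Tc : 2 * C < T by near: T; apply: nbhs_pinfty_gt; rewrite num_real.
have uT : (T0^-1 + T^-1) * (T0^-1 + T^-1) * Q (T0 + 2 * C) < inf A + e.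
  by near: T; exact: up.
have dT : inf A - e < inf A * ((1 - 2 * C * T^-1) * (1 - 2 * C * T^-1)).
  by near: T; exact: dn.
rewrite distrC ler_norml; apply/andP; split; last first.
  rewrite lerBlDl; apply: le_trans (ltW uT).
  pose k := (Num.truncn (T / T0)).+1.
  have kT : T <= k%:R * T0 by rewrite -ler_pdivrMr //; exact/ltW/truncnS_gt.
  have kle : k%:R <= T / T0 + 1.
    by rewrite /k -natr1 lerD2r truncn_le divr_ge0 // ltW.
  rewrite ler_pdivrMr ?exprn_gt0 //.
  apply: le_trans (@qcount_le (fun _ _ => true) (fun _ _ => true) _ _ (fun _ _ _ => isT) kT) _.
  apply: (le_trans (qcount_scale _ _)) => //.
  rewrite [leRHS]mulrAC ler_wpM2r ?qcount_ge0 //.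
  have -> : (T0^-1 + T^-1) * (T0^-1 + T^-1) * T ^+ 2 = (T / T0 + 1) ^+ 2.
    by field; rewrite !gt_eqF.
  by rewrite ler_sqr ?nnegrE ?ler0n // addr_ge0 // divr_ge0 // ltW.
rewrite lerBrDl.
apply: le_trans (ltW dT) _.
have : inf A <= Q (T - 2 * C + 2 * C) / (T - 2 * C) ^+ 2.
  by apply: ge_inf; [exists 0|exists (T - 2 * C) => //=; rewrite subr_gt0].
rewrite subrK => h.
have h2 : 0 < (T - 2 * C) ^+ 2 by rewrite exprn_gt0 // subr_gt0.
rewrite ler_pdivlMr // in h; rewrite ler_pdivlMr ?exprn_gt0 //.
apply: le_trans h; rewrite le_eqVlt; apply/orP; left; apply/eqP.
by field; rewrite gt_eqF.
Unshelve. all: by end_near.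
Qed.

Definition prim (a b : nat) : bool := (0 < a)%N && coprime a b.

Local Notation M := (qcount prim).
Local Notation f := (qcount (fun a _ => (0 < a)%N)).

(** The points with gcd [k] are the [k]-fold multiples of the primitive points with [q <= T / k]. *)
Lemma qcount_prim_sum T N : 0 <= T -> (qbound T <= N)%N ->
  f T = \sum_(1 <= k < N) M (T / k%:R).
Proof.
move=> T0 hN.
transitivity (@sum2 R (fun a b => (0 < a)%:R * (q a b <= T)%R%:R) N).
  rewrite (qcountE _ hN); apply: sum2_eq => a b _ _.
  by case: (0 < a)%N => /=; rewrite ?mul1r ?mul0r.
rewrite sum2_gcd; last first.
  move=> a b h; case: (boolP (q a b <= T)) => hq //.
  by have /= := qbound_gt hq; move: h hN; clear; lia.
rewrite !big_nat; apply: eq_bigr => k /andP[k0 kN].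
have kR : 0 < (k%:R : R) by rewrite ltr0n.
rewrite (@qcountE _ _ N); last first.
  apply: leq_trans hN; rewrite ltnS le_truncn // ler_pM2r ?invr_gt0 //.
  by rewrite ler_pdivrMr // ler_peMr // ler1n.
apply: sum2_eq => a b _ _; rewrite q_homo ler_pdivlMr // [q a b * _]mulrC.
by rewrite /prim; case: (_ && coprime _ _); rewrite ?mul1r ?mul0r.
Qed.

Local Notation c2 := (4 / eta ^+ 2).

(** The bound is purely quadratic, without additive constant, because a primitive point has
    [q >= eta] and none is counted for [T < eta]. This is what bounds the tail of [r_sum], where
    [T / k] may be tiny. *)
Lemma qcount_prim_le T : 0 <= T -> M T <= c2 * T ^+ 2.
Proof.
move=> T0; case: (leP eta T) => h.
  apply: le_trans (qcount_le_sqr _ T0) _.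
  have -> : c2 * T ^+ 2 = (T / eta + T / eta) ^+ 2 by field; rewrite gt_eqF.
  have h1 : 1 <= T / eta by rewrite ler_pdivlMr // mul1r.
  by rewrite ler_sqr ?nnegrE; lra.
suff M0 : M T <= 0.
  by apply: le_trans M0 _; rewrite mulr_ge0 ?sqr_ge0 // divr_ge0 ?sqr_ge0.
rewrite -(mulr0 ((qbound T)%:R ^+ 2)) -sum2_const; apply: sum2_le => a b _ _.
case: (boolP (_ && _)) => // /andP[/andP[a0 _] hq].
have := le_trans (q_low a b) hq; rewrite leNgt => /negP; case.
apply: lt_le_trans h _; rewrite ler_peMr // ?ler1n ?addn_gt0 ?a0 //.
exact: ltW.
Qed.

Local Notation r T := (M T / T ^+ 2).

Lemma r_ge0 T : 0 <= r T.
Proof. by rewrite divr_ge0 ?qcount_ge0 ?sqr_ge0. Qed.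

Lemma r_le T : 0 < T -> r T <= c2.
Proof.
by move=> T0; rewrite ler_pdivrMr ?exprn_gt0 // qcount_prim_le // ltW.
Qed.

Lemma r_sum T N : 0 < T -> (qbound T <= N)%N -> (1 < N)%N ->
  f T / T ^+ 2 = r T + \sum_(2 <= k < N) k%:R ^- 2 * r (T / k%:R).
Proof.
move=> T0 hN N1; rewrite (qcount_prim_sum (ltW T0) hN) big_ltn // divr1 mulrDl.
congr (_ + _); rewrite mulr_suml !big_nat; apply: eq_bigr => k /andP[k2 _].
have k0 : (k%:R : R) != 0 by rewrite pnatr_eq0; lia.
by field; rewrite k0 gt_eqF.
Qed.

(** Discarding the axis [a = 0] removes at most [qbound T] points, which is linear in [T]. *)
Lemma f_cvg (b : R) : qcount (fun _ _ => true) T / T ^+ 2 @[T --> +oo] --> b ->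
  f T / T ^+ 2 @[T --> +oo] --> b.
Proof.
move=> hb.
have h1 T : 0 <= T -> qcount (fun _ _ => true) T - (T / eta + 1) <= f T.
  move=> T0; rewrite lerBlDl; apply: le_trans (lerD (qbound_le T0) (lexx _)).
  have -> : (qbound T)%:R = sum2 (fun a b : nat => (a == 0%N)%:R : R) (qbound T).
    rewrite /sum2 big_ltn // [X in _ + X]big1_seq => [|a]; last first.
      by rewrite mem_index_iota => /andP[_]; case: a => //= a _; rewrite big1.
    by rewrite addr0 sumr_const_nat subn0.
  rewrite /qcount /sum2 -big_split /= ler_sum // => a _.
  rewrite -big_split /= ler_sum // => b' _.
  by case: a => [|a] /=; case: (q _ _ <= T) => /=; lra.
have h2 T : f T <= qcount (fun _ _ => true) T by apply: qcount_le.
apply: (@squeeze_cvgr _ _ _ _ (fun T => qcount (fun _ _ => true) T / T ^+ 2 -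
   (T^-1 / eta + T^-1 * T^-1))); last exact: hb.
- near=> T; have T0 : 0 < T by near: T; exact: nbhs_pinfty_gt.
  rewrite [X in _ && X]ler_pM2r ?invr_gt0 ?exprn_gt0 // h2 andbT.
  apply: le_trans (_ : _ <= (qcount (fun _ _ => true) T - (T / eta + 1)) / T ^+ 2) _.
    rewrite le_eqVlt; apply/orP; left; apply/eqP; field.
    by rewrite !gt_eqF.
  by rewrite ler_pM2r ?invr_gt0 ?exprn_gt0 // h1 // ltW.
- rewrite -[X in _ --> X]subr0; apply: cvgB => //.
  have -> : 0 = 0 / eta + 0 * 0 :> R by rewrite mul0r mulr0 addr0.
  apply: cvgD; apply: cvgM; by [exact: inv_cvg0_pinfty|exact: cvg_cst].
Unshelve. all: by end_near.
Qed.

(** Solve [r_sum] for [r T]: up to the convergent [f T / T^2], the oscillation of [r] is a sum of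
    those at [T / k] with weights [k^-2]. The terms [k < k0] give at most [3/4 E], the tail and the
    variation of [f] at most [E / 16] each, in total [7/8 E]. *)
Lemma r_osc_step (E : R) : 0 < E ->
  (exists T1, forall T T', T1 <= T -> T1 <= T' -> `|r T - r T'| <= E) ->
  exists T1, forall T T', T1 <= T -> T1 <= T' -> `|r T - r T'| <= 7 / 8 * E.
Proof.
move=> E0 [T1 hT1]; have [b /f_cvg hb] := qcount_cvg.
have c20 : 0 < c2 by rewrite divr_gt0 // exprn_gt0.
have E32 : 0 < E / 32 by lra.
have [T2 [T2r hT2]] := cvgr_dist_le _ _ hb _ E32.
(* Beyond [k0] the terms are bounded by [c2 k^-2], with sum at most [c2 / (k0 - 1) <= E / 16]. *)
pose k0 := (Num.truncn (16 * c2 / E)).+3.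
have hk0 : c2 * (k0.-1)%:R^-1 <= E / 16.
  rewrite ler_pdivrMr ?ltr0n // -ler_pdivrMl ?divr_gt0 //.
  have -> : (E / 16)^-1 * c2 = 16 * c2 / E by field; rewrite !gt_eqF.
  by apply: ltW; apply: lt_le_trans (truncnS_gt _) _; rewrite ler_nat.
(* Large enough that [T / k] is still in the range of the hypothesis for all [k < k0]. *)
pose T3 := Num.max 1 (Num.max (T2 + 1) (k0%:R * Num.max T1 0)).
exists T3 => T T' hT hT'.
have pos x : T3 <= x -> [/\ 0 < x, T2 < x & forall k, (0 < k < k0)%N -> T1 <= x / k%:R].
  rewrite /T3 !ge_max => /and3P[h1 h2 h3]; split; [lra|lra|move=> k /andP[kp kk]].
  rewrite ler_pdivlMr ?ltr0n //; apply: le_trans h3.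
  apply: (@le_trans _ _ (Num.max T1 0 * k%:R)).
    by rewrite ler_wpM2r // ?le_max ?lexx.
  by rewrite mulrC ler_wpM2r ?le_max ?lexx ?orbT // ler_nat ltnW.
have [Tp TT2 hTk] := pos _ hT; have [Tp' TT2' hTk'] := pos _ hT'.
pose N := maxn k0 (maxn (qbound T) (qbound T')).
have N1 : (1 < N)%N by rewrite /N !leq_max.
have hN : (qbound T <= N)%N by rewrite /N !leq_max leqnn orbT.
have hN' : (qbound T' <= N)%N by rewrite /N !leq_max leqnn !orbT.
have k0N : (k0 <= N)%N by rewrite /N leq_max leqnn.
have e1 := r_sum Tp hN N1; have e2 := r_sum Tp' hN' N1.
have d1 : `|f T / T ^+ 2 - f T' / T' ^+ 2| <= E / 16.
  have := lerD (hT2 _ TT2) (hT2 _ TT2'); rewrite distrC => h.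
  apply: le_trans (ler_distD b _ _) _; apply: le_trans h _; lra.
have -> : r T - r T' = (f T / T ^+ 2 - f T' / T' ^+ 2) -
    \sum_(2 <= k < N) k%:R ^- 2 * (r (T / k%:R) - r (T' / k%:R)).
  have -> : \sum_(2 <= k < N) k%:R ^- 2 * (r (T / k%:R) - r (T' / k%:R)) =
      \sum_(2 <= k < N) k%:R ^- 2 * r (T / k%:R) -
      \sum_(2 <= k < N) k%:R ^- 2 * r (T' / k%:R).
    by rewrite -sumrB; apply: eq_bigr => k _; rewrite mulrBr.
  by rewrite e1 e2; ring.
apply: le_trans (ler_normB _ _) _.
suff h : `|\sum_(2 <= k < N) k%:R ^- 2 * (r (T / k%:R) - r (T' / k%:R))| <= E * (3/4) + E / 16.
  by apply: le_trans (lerD d1 h) _; lra.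
apply: le_trans (ler_norm_sum _ _ _) _.
rewrite (@big_cat_nat _ _ _ k0) //=; apply: lerD.
  apply: le_trans (ler_wpM2l (ltW E0) (@sum_inv_sqr2 R k0)).
  rewrite mulr_sumr !big_nat; apply: ler_sum => k /andP[k2 kk].
  rewrite normrM ger0_norm ?invr_ge0 ?sqr_ge0 // mulrC ler_wpM2r ?invr_ge0 ?sqr_ge0 //.
  by apply: hT1; [apply: hTk|apply: hTk']; rewrite kk andbT; exact: leq_trans k2.
apply: le_trans hk0; apply: le_trans (ler_wpM2l (ltW c20) (@sum_inv_sqr R k0 N isT)).
rewrite mulr_sumr !big_nat; apply: ler_sum => k /andP[k2 kk].
rewrite normrM ger0_norm ?invr_ge0 ?sqr_ge0 // mulrC ler_wpM2r ?invr_ge0 ?sqr_ge0 //.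
have kR : 0 < (k%:R : R) by rewrite ltr0n; exact: leq_trans k2.
have := r_ge0 (T / k%:R); have := r_ge0 (T' / k%:R).
have := @r_le (T / k%:R); have := @r_le (T' / k%:R).
rewrite !divr_gt0 // => /(_ isT) u1 /(_ isT) u2 u3 u4.
by rewrite ler_norml; apply/andP; split; lra.
Qed.

(* Since [f T = \sum_k M (T / k)] and [\sum_(k >= 2) k^-2 <= 3/4 < 1], the
   eventual oscillation of [M T / T^2] contracts by a constant factor. *)
Lemma prim_count_cvg : cvg (r T @[T --> +oo]).
Proof.
have c20 : 0 < c2 by rewrite divr_gt0 // exprn_gt0.
have osc j : exists T1, forall T T', T1 <= T -> T1 <= T' ->
    `|r T - r T'| <= (7/8) ^+ j * c2.
  elim: j => [|j IH].
    exists 1 => T T' h h'; have p : 0 < T by lra.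
    have p' : 0 < T' by lra.
    have := r_ge0 T; have := r_ge0 T'; have := r_le p; have := r_le p' => ? ? ? ?.
    by rewrite expr0 mul1r ler_norml; apply/andP; split; lra.
  rewrite exprS -mulrA; apply: r_osc_step => //.
  by rewrite mulr_gt0 // exprn_gt0 //; lra.
apply: cauchy_cvg; apply: cauchy_exP => e e0.
have [j hj] : exists j, (7/8) ^+ j * c2 < e.
  have : (7/8 : R) ^+ j * c2 @[j --> \oo] --> (0 * c2 : R).
    apply: cvgM; last exact: cvg_cst.
    by apply: cvg_expr; rewrite ger0_norm; lra.
  rewrite mul0r => /cvgrPdist_lt /(_ _ e0)[j _ /(_ j (leqnn j))] /=.
  rewrite sub0r normrN ger0_norm; first by exists j.
  by rewrite mulr_ge0 ?exprn_ge0 // ?ltW //; lra.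
have [T1 hT1] := osc j; exists (r T1); rewrite /= /nbhs /=.
exists T1; split; first exact: num_real.
move=> T hT /=; rewrite -ball_normE /=; apply: le_lt_trans hj.
by apply: hT1 => //; exact: ltW.
Qed.

(** In the limit [b] is the sum of [k^-2 a] over all [k >= 1], hence at most [(1 + 3/4) a]. *)
Lemma prim_count_ge (b a : R) : qcount (fun _ _ => true) T / T ^+ 2 @[T --> +oo] --> b ->
  r T @[T --> +oo] --> a -> b <= 2 * a.
Proof.
move=> /f_cvg hb ha.
have c20 : 0 < c2 by rewrite divr_gt0 // exprn_gt0.
apply/ler_addgt0Pr => e e0.
have e8 : 0 < e / 8 by lra.
have [T1 [_ h1]] := cvgr_dist_le _ _ hb _ e8; have [T2 [_ h2]] := cvgr_dist_le _ _ ha _ e8.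
pose k0 := (Num.truncn (16 * c2 / e)).+3.
have hk0 : c2 * (k0.-1)%:R^-1 <= e / 16.
  rewrite ler_pdivrMr ?ltr0n // -ler_pdivrMl ?divr_gt0 //.
  have -> : (e / 16)^-1 * c2 = 16 * c2 / e by field; rewrite !gt_eqF.
  by apply: ltW; apply: lt_le_trans (truncnS_gt _) _; rewrite ler_nat.
pose T := Num.max 1 (Num.max (T1 + 1) (k0%:R * (Num.max T2 0 + 1))).
have [hT1' hT1 hT2] : [/\ 1 <= T, T1 + 1 <= T & k0%:R * (Num.max T2 0 + 1) <= T].
  by rewrite /T; split; rewrite !le_max lexx ?orbT.
have Tp : 0 < T by lra.
have hTk k : (0 < k < k0)%N -> T2 < T / k%:R.
  move=> /andP[kp kk]; have m0 : 0 <= Num.max T2 0 by rewrite le_max lexx orbT.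
  have m1 : T2 <= Num.max T2 0 by rewrite le_max lexx.
  rewrite ltr_pdivlMr ?ltr0n //; apply: lt_le_trans hT2.
  apply: (@lt_le_trans _ _ ((Num.max T2 0 + 1) * k%:R)).
    by rewrite ltr_pM2r ?ltr0n //; lra.
  by rewrite mulrC ler_wpM2r ?ler_nat ?(ltnW kk) //; lra.
pose N := maxn k0 (qbound T).
have N1 : (1 < N)%N by rewrite /N !leq_max.
have hN : (qbound T <= N)%N by rewrite /N !leq_max leqnn orbT.
have k0N : (k0 <= N)%N by rewrite /N leq_max leqnn.
have e1 := r_sum Tp hN N1.
have := h1 T; rewrite e1 ler_distl => /(_ ltac:(lra)) /andP[_ u1].
have rk k : (0 < k < k0)%N -> r (T / k%:R) <= a + e / 8.
  by move=> /hTk /h2; rewrite ler_distl => /andP[]; lra.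
have u2 : r T <= a + e / 8 by have := rk 1%N; rewrite divr1; apply.
have a0 : 0 <= a + e/8 by apply: le_trans u2; exact: r_ge0.
suff u3 : \sum_(2 <= k < N) k%:R ^- 2 * r (T / k%:R) <= (a + e/8) * (3/4) + e / 16.
  by move: u1 u2 u3; move: (\sum_(_ <= _ < _) _) => X; lra.
rewrite (@big_cat_nat _ _ _ k0) //=; apply: lerD.
  apply: le_trans (ler_wpM2l a0 (@sum_inv_sqr2 R k0)).
  rewrite mulr_sumr !big_nat; apply: ler_sum => k /andP[k2 kk].
  by rewrite mulrC ler_wpM2r ?invr_ge0 ?sqr_ge0 // rk // kk andbT; exact: leq_trans k2.
apply: le_trans hk0; apply: le_trans (ler_wpM2l (ltW c20) (@sum_inv_sqr R k0 N isT)).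
rewrite mulr_sumr !big_nat; apply: ler_sum => k /andP[k2 kk].
rewrite mulrC ler_wpM2r ?invr_ge0 ?sqr_ge0 // r_le // divr_gt0 // ltr0n.
exact: leq_trans k2.
Qed.

(** Counts a strip along the direction [(1, rho)]: in each of [A] columns it takes the [B] integers
    just above the line of slope [rho]. The alternative hypothesis is the same with the axes
    exchanged. *)
Lemma qcount_ge (kappa C' rho T : R) (A B : nat) : 0 <= kappa -> 0 <= C' ->
  0 <= rho ->
  (forall a b, q a b <= kappa * a%:R + C' * `|b%:R - rho * a%:R|) \/
  (forall a b, q b a <= kappa * a%:R + C' * `|b%:R - rho * a%:R|) ->
  kappa * A%:R + C' * B%:R <= T -> (A * B)%:R <= qcount (fun _ _ => true) T.
Proof.
move=> k0 C0 r0 hq hT.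
(* The least integer above [rho a], so that [b - rho a] lies in [[0, B]] for the [B] values of [b]
   starting there. *)
pose t a := (Num.truncn (rho * a%:R)).+1.
pose N := maxn (qbound T) (maxn A (\max_(a < A) (t a + B))).
have key (p : nat -> nat -> R) :
    (forall a b, p a b <= kappa * a%:R + C' * `|b%:R - rho * a%:R|) ->
    (A * B)%:R <= @sum2 R (fun a b => (p a b <= T)%R%:R) N.
  move=> hp.
  have AN : (A <= N)%N by rewrite /N !leq_max leqnn orbT.
  rewrite /sum2 (@big_cat_nat _ _ _ A) //= -[leLHS]addr0 lerD //; last first.
    by apply: sumr_ge0 => a _; apply: sumr_ge0 => b _.
  rewrite natrM mulrC -[A in leLHS]subn0 mulr_natr -sumr_const_nat.
  rewrite !big_nat; apply: ler_sum => a /andP[_ aA].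
  have tN : (t a + B <= N)%N.
    rewrite /N !leq_max; apply/orP; right; apply/orP; right.
    exact: (@leq_bigmax _ (fun a : 'I_A => (t a + B)%N) (Ordinal aA)).
  rewrite (@big_cat_nat _ _ _ (t a + B)) //= (@big_cat_nat _ _ _ (t a)) //= ?leq_addr //.
  rewrite -addrA addrC -addrA -[leLHS]addr0 lerD //; last first.
    by rewrite addr_ge0 // sumr_ge0.
  have -> : B%:R = \sum_(t a <= b < t a + B) 1 :> R by rewrite sumr_const_nat addKn.
  rewrite !big_nat; apply: ler_sum => b /andP[b1 b2].
  suff -> : p a b <= T by [].
  apply: le_trans (hp a b) _; apply: le_trans hT; apply: lerD.
    by rewrite ler_wpM2l // ler_nat ltnW.
  rewrite ler_wpM2l //.
  have x0 : 0 <= rho * a%:R by rewrite mulr_ge0.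
  have x1 : (Num.truncn (rho * a%:R))%:R <= rho * a%:R by rewrite truncn_le.
  have x2 : rho * a%:R < (t a)%:R by exact: truncnS_gt.
  rewrite ger0_norm; last by rewrite subr_ge0; apply: le_trans (ltW x2) _; rewrite ler_nat.
  have : (b <= Num.truncn (rho * a%:R)%R + B)%N by move: b2; rewrite /t addSn ltnS.
  by rewrite -(ler_nat R) natrD; lra.
rewrite (@qcountE _ _ N) ?leq_maxl //=.
by case: hq => /key // h; rewrite -sum2_exchange.
Qed.

(** Strip of length about [T / (2 kappa)] and thickness about [T / (2 C')]. The density is large if
    [q] is small along some direction, which later keeps minimising norms from degenerating. *)
Lemma qcount_lim_ge (kappa C' rho b : R) : 0 < kappa -> 0 < C' -> 0 <= rho ->
  (forall a b, q a b <= kappa * a%:R + C' * `|b%:R - rho * a%:R|) \/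
  (forall a b, q b a <= kappa * a%:R + C' * `|b%:R - rho * a%:R|) ->
  qcount (fun _ _ => true) T / T ^+ 2 @[T --> +oo] --> b -> (4 * kappa * C')^-1 <= b.
Proof.
move=> k0 C0 r0 hq hb.
have lim : ((2 * kappa)^-1 - T^-1) * ((2 * C')^-1 - T^-1) @[T --> +oo] --> (4 * kappa * C')^-1.
  have -> : (4 * kappa * C')^-1 = ((2 * kappa)^-1 - 0) * ((2 * C')^-1 - 0).
    by field; rewrite !gt_eqF.
  by apply: cvgM; apply: cvgB; by [exact: cvg_cst|exact: inv_cvg0_pinfty].
apply: (ler_cvg_to lim hb); near=> T.
have T0 : 0 < T by near: T; exact: nbhs_pinfty_gt.
have Tk : 2 * kappa < T by near: T; apply: nbhs_pinfty_gt; rewrite num_real.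
have TC : 2 * C' < T by near: T; apply: nbhs_pinfty_gt; rewrite num_real.
rewrite ler_pdivlMr ?exprn_gt0 //.
pose A := Num.truncn (T / (2 * kappa)); pose B := Num.truncn (T / (2 * C')).
have kk : 0 < 2 * kappa by lra.
have CC : 0 < 2 * C' by lra.
have A1 : T / (2 * kappa) - 1 <= A%:R.
  by rewrite lerBlDr natr1 ltW // truncnS_gt.
have B1 : T / (2 * C') - 1 <= B%:R.
  by rewrite lerBlDr natr1 ltW // truncnS_gt.
have A2 : A%:R <= T / (2 * kappa) by rewrite truncn_le divr_ge0 // ltW.
have B2 : B%:R <= T / (2 * C') by rewrite truncn_le divr_ge0 // ltW.
apply: le_trans (@qcount_ge kappa C' rho T A B (ltW k0) (ltW C0) r0 hq _).
  rewrite natrM.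
  have -> : ((2 * kappa)^-1 - T^-1) * ((2 * C')^-1 - T^-1) * T ^+ 2 =
     (T / (2 * kappa) - 1) * (T / (2 * C') - 1) by field; rewrite !gt_eqF.
  by rewrite ler_pM // subr_ge0 ler_pdivlMr // mul1r ltW.
have -> : T = kappa * (T / (2 * kappa)) + C' * (T / (2 * C')).
  by field; rewrite !gt_eqF.
by rewrite lerD // ler_wpM2l // ltW.
Unshelve. all: by end_near.
Qed.

End QuadrantCount.

(** * The log partition function of a geometric variable and its Taylor bounds *)

Section GeometricWeights.
Variable R : realType.
Implicit Types x y : R.

(* [gg x] is the log partition function of a geometric variable of ratio
   [exp (- x)] and [mu x = - gg' x] its mean; [hh] dominates both, up to constants. *)
Definition gg x : R := - ln (1 - expR (- x)).
Definition mu x : R := (expR x - 1)^-1.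
Definition hh x : R := expR (- (x / 16)) / x.

Lemma expRN1_gt0 x : 0 < x -> 0 < 1 - expR (- x).
Proof. by move=> x0; rewrite subr_gt0 expR_lt1 oppr_lt0. Qed.

Lemma expR1_gt0 x : 0 < x -> 0 < expR x - 1.
Proof. by move=> x0; rewrite subr_gt0 expR_gt1. Qed.

Lemma mu_gt0 x : 0 < x -> 0 < mu x.
Proof. by move=> x0; rewrite invr_gt0 expR1_gt0. Qed.

Lemma expR_gg x : 0 < x -> expR (gg x) = (1 - expR (- x))^-1.
Proof. by move=> x0; rewrite /gg expRN lnK // posrE expRN1_gt0. Qed.

Lemma gg_ge0 x : 0 < x -> 0 <= gg x.
Proof.
by move=> x0; rewrite /gg oppr_ge0 ln_le0 // lerBlDr lerDl expR_ge0.
Qed.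

Lemma ln_leB1 x : 0 < x -> ln x <= x - 1.
Proof.
by move=> x0; have := @expR_ge1Dx R (ln x); rewrite lnK ?posrE //; lra.
Qed.

(** Convexity of [gg] as a tangent-line inequality with slope [- mu x']. It follows from
    [ln z <= z - 1] and [1 + z <= expR z], without differentiation. *)
Lemma gg_tangent x x' : 0 < x -> 0 < x' -> gg x' - gg x <= mu x' * (x - x').
Proof.
move=> x0 x'0; have p := expRN1_gt0 x0; have p' := expRN1_gt0 x'0.
have -> : gg x' - gg x = ln ((1 - expR (- x)) / (1 - expR (- x'))).
  by rewrite ln_div ?posrE // /gg; lra.
apply: le_trans (ln_leB1 (divr_gt0 p p')) _.
have q' := expR1_gt0 x'0.
have -> : (1 - expR (- x)) / (1 - expR (- x')) - 1 = mu x' * (1 - expR (x' - x)).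
  rewrite expRD /mu !expRN in p' *; field.
  by rewrite !gt_eqF ?expR_gt0 // subr_gt0 expR_gt1.
rewrite ler_pM2l ?mu_gt0 //; have := expR_ge1Dx (x' - x); lra.
Qed.

Lemma gg_le_mu x : 0 < x -> gg x <= mu x.
Proof.
move=> x0; have p := expRN1_gt0 x0.
rewrite /gg -lnV ?posrE //; apply: le_trans (ln_leB1 _) _; first by rewrite invr_gt0.
have q := expR1_gt0 x0.
rewrite le_eqVlt; apply/orP; left; apply/eqP; rewrite /mu.
rewrite expRN in p *; field.
by rewrite !gt_eqF ?expR_gt0.
Qed.

Lemma gg_le x y : 0 < x -> x <= y -> gg y <= gg x.
Proof.
move=> x0 xy; have y0 : 0 < y by lra.
rewrite -subr_le0; apply: le_trans (gg_tangent x0 y0) _.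
by rewrite pmulr_rle0 ?mu_gt0 //; lra.
Qed.

Lemma mu_le x : 0 < x -> mu x <= 2 * expR (- (x / 2)) / x.
Proof.
move=> x0; have q := expR1_gt0 x0.
rewrite /mu -[leRHS]invrK lef_pV2 ?posrE ?invr_gt0 ?divr_gt0 ?mulr_gt0 ?expR_gt0 //.
have e2 : expR x = expR (x / 2) * expR (x / 2) by rewrite -expRD; congr expR; lra.
have -> : (2 * expR (- (x / 2)) / x)^-1 = x / 2 * expR (x / 2).
  by rewrite expRN; field; rewrite !gt_eqF ?expR_gt0.
have := @expR_ge1Dx R (x / 2); rewrite e2.
move: (expR (x / 2)) => e he; nra.
Qed.

Lemma mu_le_inv x : 0 < x -> mu x <= x^-1.
Proof.
move=> x0; rewrite lef_pV2 ?posrE ?expR1_gt0 //.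
by have := @expR_ge1Dx R x; lra.
Qed.

Lemma mu_anti x y : 0 < x -> x <= y -> mu y <= mu x.
Proof.
move=> x0 xy; have y0 : 0 < y by lra.
by rewrite lef_pV2 ?posrE ?expR1_gt0 // lerB // ler_expR.
Qed.

Lemma hh_gt0 x : 0 < x -> 0 < hh x.
Proof. by move=> x0; rewrite divr_gt0 ?expR_gt0. Qed.

Lemma hh_anti x y : 0 < x -> x <= y -> hh y <= hh x.
Proof.
move=> x0 xy; have y0 : 0 < y by lra.
by rewrite ler_pM ?expR_ge0 ?invr_ge0 ?(ltW y0) ?ler_expR ?lef_pV2 ?posrE //; lra.
Qed.

Lemma mu_le_hh x : 0 < x -> mu x <= 2 * hh x.
Proof.
move=> x0; apply: le_trans (mu_le x0) _; rewrite /hh mulrA ler_pM2r ?invr_gt0 //.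
by rewrite ler_pM2l // ler_expR; lra.
Qed.

Lemma gg_taylor_ge x y : 0 < x -> 0 < x - y -> mu x * y <= gg (x - y) - gg x.
Proof.
move=> x0 xy; have := gg_tangent xy x0.
have -> : x - y - x = - y by lra.
lra.
Qed.

(** The error is quadratic in the relative perturbation [y / x] and carries the factor [hh x], so
    that it can be summed over all lattice vectors with a bound uniform in the scale. *)
Lemma gg_taylor_le x y : 0 < x -> `|y| <= x / 8 ->
  gg (x - y) - gg x <= mu x * y + 150 * (y / x) ^+ 2 * hh x.
Proof.
move=> x0; rewrite ler_norml => /andP[y1 y2].
have xy : 0 < x - y by lra.
apply: le_trans (gg_tangent x0 xy) _.
have -> : x - (x - y) = y by lra.
rewrite -lerBlDl -mulrBl.
have q := expR1_gt0 x0; have q' := expR1_gt0 xy.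
(* The tangent at [x - y] leaves the increment of [mu] as error; this factorisation makes it visibly
   quadratic in [y]. *)
have -> : (mu (x - y) - mu x) * y =
    (y * (1 - expR (- y))) * (1 + mu x) * mu (x - y).
  rewrite /mu expRD in q' *; field.
  by rewrite !gt_eqF ?expR_gt0.
have h1 : y * (1 - expR (- y)) <= y ^+ 2 * expR (x / 8).
  have e1 : 1 <= expR (x / 8) by rewrite -[leLHS]expR0 ler_expR; lra.
  case: (leP 0 y) => hy.
    have := @expR_ge1Dx R (- y); move: (expR (- y)) => e he; nra.
  have e2 : expR (- y) <= expR (x / 8) by rewrite ler_expR; lra.
  have e3 : 1 - expR (- y) >= y * expR (- y).
    have := @expR_ge1Dx R y; have : expR (-y) * expR y = 1 by rewrite -expRD addNr expR0.
    have := expR_gt0 (- y); move: (expR y) (expR (-y)) => a b; nra.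
  move: e2 e3; move: (expR (-y)) (expR (x / 8)) => a b; nra.
have h0 : 0 <= y * (1 - expR (- y)).
  case: (leP 0 y) => hy; first by rewrite mulr_ge0 // subr_ge0 expR_le1; lra.
  by apply: mulr_le0; [exact: ltW|rewrite subr_le0 -[leLHS]expR0 ler_expR; lra].
have h2 : 1 + mu x <= (x + 1) / x.
  by have := mu_le_inv x0; rewrite mulrDl mul1r divff ?gt_eqF //; lra.
have h3 : mu (x - y) <= 16 / 7 * expR (- (7 / 16 * x)) / x.
  apply: le_trans (_ : mu (7 / 8 * x) <= _); first by apply: mu_anti; lra.
  apply: le_trans (mu_le _) _; first by lra.
  rewrite le_eqVlt; apply/orP; left; apply/eqP.
  have -> : 7 / 8 * x / 2 = 7 / 16 * x by field.
  by field; rewrite gt_eqF.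
(* The polynomial factor is paid with [expR (x / 4)]. The exponents [1/8 - 7/16 + 1/4] add up to the
   [- 1/16] of [hh], and the constants [16/7 * 64] stay below 150. *)
have h4 : (x + 1) * x <= 64 * expR (x / 4).
  have -> : expR (x / 4) = expR (x / 8) * expR (x / 8).
    by rewrite -expRD; congr expR; field.
  have := @expR_ge1Dx R (x / 8); move: (expR _) => e; nra.
apply: (@le_trans _ _ (y ^+ 2 * expR (x / 8) * ((x + 1) / x) *
    (16 / 7 * expR (- (7 / 16 * x)) / x))).
  have m0 := mu_gt0 x0; have m1 := mu_gt0 xy.
  apply: ler_pM => //; [apply: mulr_ge0 => //; lra|exact: ltW|].
  by apply: ler_pM => //; lra.
have -> : y ^+ 2 * expR (x / 8) * ((x + 1) / x) * (16 / 7 * expR (- (7 / 16 * x)) / x) =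
   16 / 7 * (y / x) ^+ 2 * (((x + 1) * x) * expR (- (5 / 16 * x))) / x.
  have -> : - (5 / 16 * x) = x / 8 + - (7 / 16 * x) by lra.
  by rewrite expRD; field; rewrite gt_eqF.
rewrite /hh mulrA ler_pM2r ?invr_gt0 //.
apply: (@le_trans _ _ (16 / 7 * (y / x) ^+ 2 * (64 * expR (x / 4) * expR (- (5 / 16 * x))))).
  apply: ler_wpM2l; first by apply: mulr_ge0; [lra|exact: sqr_ge0].
  by apply: ler_wpM2r => //; exact: expR_ge0.
have -> : - (x / 16) = x / 4 + - (5 / 16 * x) by lra.
rewrite expRD; have s0 := sqr_ge0 (y / x).
have e0 := mulr_ge0 s0 (mulr_ge0 (expR_ge0 (x / 4)) (expR_ge0 (- (5 / 16 * x)))).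
move: ((y / x) ^+ 2) (expR (x / 4)) (expR (- (5 / 16 * x))) e0 => a b c; lra.
Qed.

End GeometricWeights.

(** * Seminorms on the plane and sums over primitive vectors of a half-plane *)

Section Plane.
Variable R : realType.
Local Notation plane := 'rV[R]_2.
Implicit Types (x y u v : plane) (psi phi : plane -> R).

Definition pt (a b : R) : plane := \row_j (if j == 0 then a else b).
Definition dot u v : R := u 0 0 * v 0 0 + u 0 1 * v 0 1.
Definition n1 x : R := `|x 0 0| + `|x 0 1|.

Lemma pt0 a b : pt a b 0 0 = a. Proof. by rewrite mxE. Qed.
Lemma pt1 a b : pt a b 0 1 = b. Proof. by rewrite mxE. Qed.

Lemma planeP x y : x 0 0 = y 0 0 -> x 0 1 = y 0 1 -> x = y.
Proof.
move=> h0 h1; apply/rowP; case=> [[|[|//]]] i.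
- by have -> : Ordinal i = 0 by exact: val_inj.
- by have -> : Ordinal i = 1 by exact: val_inj.
Qed.

Lemma pt_eta x : x = pt (x 0 0) (x 0 1).
Proof. by apply: planeP; rewrite ?pt0 ?pt1. Qed.

Definition seminorm psi :=
  [/\ forall x y, psi (x + y) <= psi x + psi y,
      forall (k : R) x, 0 <= k -> psi (k *: x) = k * psi x &
      forall x, psi (- x) = psi x].

Definition coercive (eta : R) psi := forall x, eta * n1 x <= psi x.

Definition is_norm psi := seminorm psi /\ exists2 eta, 0 < eta & coercive eta psi.

Lemma seminorm0 psi : seminorm psi -> psi 0 = 0.
Proof. by case=> _ h _; have := h 0 0 (lexx 0); rewrite scale0r mul0r. Qed.

Lemma seminorm_ge0 psi x : seminorm psi -> 0 <= psi x.
Proof.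
move=> h; have h0 := seminorm0 h; case: h => sub _ ev.
by have := sub x (- x); rewrite subrr h0 ev; lra.
Qed.

Lemma seminormZ psi (k : R) x : seminorm psi -> psi (k *: x) = `|k| * psi x.
Proof.
case=> _ hom ev; case: (leP 0 k) => hk; first by rewrite hom // ger0_norm.
by rewrite -ev -scaleNr hom ?oppr_ge0 ?(ltW hk) // ltr0_norm.
Qed.

(** Serves as a Lipschitz constant of [psi] with respect to [n1]. *)
Definition sbound psi : R := psi (pt 1 0) + psi (pt 0 1).

Lemma sbound_ge0 psi : seminorm psi -> 0 <= sbound psi.
Proof. by move=> h; rewrite addr_ge0 // seminorm_ge0. Qed.

Lemma seminorm_le psi x : seminorm psi -> psi x <= sbound psi * n1 x.
Proof.
move=> h; have -> : x = x 0 0 *: pt 1 0 + x 0 1 *: pt 0 1.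
  by apply: planeP; rewrite !mxE /= ?mulr1 ?mulr0 ?addr0 ?add0r.
case: (h) => sub _ _; apply: le_trans (sub _ _) _.
rewrite !(seminormZ _ _ h) /sbound /n1 !mxE /= !mulr1 !mulr0 !addr0 !add0r.
have := seminorm_ge0 (pt 1 0) h; have := seminorm_ge0 (pt 0 1) h.
have := normr_ge0 (x 0 0); have := normr_ge0 (x 0 1).
move: `|x 0 0| `|x 0 1| (psi (pt 1 0)) (psi (pt 0 1)) => a b c d; nra.
Qed.

Lemma seminorm_lip psi x y : seminorm psi -> psi x <= psi y + sbound psi * n1 (x - y).
Proof.
move=> h; case: (h) => sub _ _; rewrite -{1}[x](subrK y) addrC.
by apply: le_trans (sub _ _) _; rewrite lerD2l seminorm_le.
Qed.

Lemma n1_ge0 x : 0 <= n1 x. Proof. by rewrite addr_ge0. Qed.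

Lemma n1_eq0 x : n1 x = 0 -> x = 0.
Proof.
rewrite /n1 => h; have := normr_ge0 (x 0 0); have := normr_ge0 (x 0 1) => h1 h2.
by apply: planeP; rewrite mxE; apply/eqP; rewrite -normr_eq0; apply/eqP; lra.
Qed.

Lemma seminorm_n1 : seminorm n1.
Proof.
split=> [x y|k x k0|x]; rewrite /n1 !mxE ?normrN //.
- by rewrite addrACA lerD // ler_normD.
- by rewrite !normrM ger0_norm // mulrDr.
Qed.

Lemma seminorm_dot u : seminorm (fun v => `|dot u v|).
Proof.
split=> [x y|k x k0|x]; rewrite /dot !mxE.
- by apply: le_trans (ler_normD _ _); rewrite le_eqVlt; apply/orP; left; apply/eqP; congr `|_|; ring.
- by rewrite -[k in RHS](ger0_norm k0) -normrM; congr `|_|; ring.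
- by rewrite -normrN; congr `|_|; ring.
Qed.

Lemma seminormD psi phi : seminorm psi -> seminorm phi ->
  seminorm (fun x => psi x + phi x).
Proof.
move=> [s1 h1 e1] [s2 h2 e2]; split=> [x y|k x k0|x].
- by have := s1 x y; have := s2 x y; lra.
- by rewrite h1 // h2 // mulrDr.
- by rewrite e1 e2.
Qed.

Lemma seminormM psi (k : R) : 0 <= k -> seminorm psi -> seminorm (fun x => k * psi x).
Proof.
move=> k0 [s h e]; split=> [x y|l x l0|x].
- by rewrite -mulrDr ler_wpM2l.
- by rewrite h // mulrCA.
- by rewrite e.
Qed.

Lemma dot_le u v : `|dot u v| <= n1 u * n1 v.
Proof.
rewrite /dot /n1; apply: le_trans (ler_normD _ _) _; rewrite !normrM.
have := normr_ge0 (u 0 0); have := normr_ge0 (u 0 1).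
have := normr_ge0 (v 0 0); have := normr_ge0 (v 0 1).
move: `|u 0 0| `|u 0 1| `|v 0 0| `|v 0 1| => a b c d; nra.
Qed.

(* The vectors [(a, b)] and [(-b, a)] with [a >= 1] run once through a half-plane. *)
Definition vecn (s : bool) (a b : nat) : plane :=
  if s then pt a%:R b%:R else pt (- b%:R) a%:R.

Lemma n1_vecn s a b : n1 (vecn s a b) = (a + b)%:R.
Proof.
by case: s; rewrite /n1 /vecn ?pt0 ?pt1 ?normrN !ger0_norm ?ler0n // natrD // addrC.
Qed.

Lemma vecnM s k a b : vecn s (k * a) (k * b) = k%:R *: vecn s a b.
Proof.
by case: s; apply: planeP; rewrite !mxE /= !natrM // mulrN.
Qed.

Lemma vecnD s a b i j : vecn s (a + i) (b + j) = vecn s a b + vecn s i j.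
Proof.
by case: s; apply: planeP; rewrite !mxE /= !natrD // opprD.
Qed.

Definition primset (B : nat) := [set i : bool * 'I_B * 'I_B | prim i.1.2 i.2]%SET.

(** A finite type of its own, so that multiplicity families form a finite type
    [{ffun idx B -> 'I_N}] and partition functions are finite sums that factor over the index. *)
Definition idx (B : nat) := {i | i \in primset B}.

Definition vec B (i : idx B) : plane := vecn (val i).1.1 (val i).1.2 (val i).2.

Lemma idxP B (i : idx B) : prim (val i).1.2 (val i).2.
Proof. by have := valP i; rewrite inE. Qed.

Lemma n1_vec_gt0 B (i : idx B) : 0 < n1 (vec i).
Proof. by rewrite n1_vecn ltr0n addn_gt0; have /andP[-> _] := idxP i. Qed.

Definition psum (F : plane -> R) (B : nat) : R := \sum_(i : idx B) F (vec i).

Lemma psumE F B : psum F B =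
  \sum_(s : bool) sum2 (fun a b => (prim a b)%:R * F (vecn s a b)) B.
Proof.
rewrite /psum -(big_sub (primset B) (fun i => F (vecn i.1.1 i.1.2 i.2))).
pose G (p : bool * 'I_B) (b : 'I_B) : R := (prim p.2 b)%:R * F (vecn p.1 p.2 b).
transitivity (\sum_(i : bool * 'I_B * 'I_B) G i.1 i.2).
  rewrite big_mkcond; apply: eq_bigr => -[[s a] b] _; rewrite inE /G /=.
  by case: (prim a b); rewrite ?mul1r ?mul0r.
rewrite -(pair_bigA _ G) -(pair_bigA _ (fun s a => \sum_b G (s, a) b)) /=.
apply: eq_bigr => s _; rewrite /sum2 big_mkord; apply: eq_bigr => a _.
by rewrite big_mkord.
Qed.

Lemma psum_le F G B : (forall v, 0 < n1 v -> F v <= G v) -> psum F B <= psum G B.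
Proof.
by move=> h; apply: ler_sum => i _; apply: h; exact: n1_vec_gt0.
Qed.

Lemma psum_ge0 F B : (forall v, 0 < n1 v -> 0 <= F v) -> 0 <= psum F B.
Proof.
by move=> h; apply: le_trans (psum_le _ h); rewrite /psum big1.
Qed.

Lemma psumD F G B : psum (fun v => F v + G v) B = psum F B + psum G B.
Proof. exact: big_split. Qed.

Lemma psumZ (k : R) F B : psum (fun v => k * F v) B = k * psum F B.
Proof. by rewrite /psum mulr_sumr. Qed.

Lemma psum_eq F G B : (forall v, 0 < n1 v -> F v = G v) -> psum F B = psum G B.
Proof.
by move=> h; apply/eqP; rewrite eq_le !psum_le // => v hv; rewrite h.
Qed.

Lemma psum_sum I (r : seq I) (F : I -> plane -> R) B :
  psum (fun v => \sum_(i <- r) F i v) B = \sum_(i <- r) psum (F i) B.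
Proof. exact: exchange_big. Qed.

End Plane.

(** * The limit of small scale *)

Section ScaleFilter.
Variable R : realType.

(* The scale [e] tends to [0]; the box size [B] only has to exceed [e^-2], beyond
   which the terms are negligible. *)
Definition scaleF : set_system (R * nat) :=
  [set A | exists2 e0 : R, 0 < e0 &
    forall e B, 0 < e < e0 -> e ^- 2 <= B%:R -> A (e, B)].

Global Instance scaleF_filter : ProperFilter scaleF.
Proof.
split; last split.
- move=> [e0 e00 h]; have := h (e0 / 2) (Num.truncn ((e0 / 2) ^- 2)).+1.
  by apply; [lra|exact/ltW/truncnS_gt].
- by exists 1.
- move=> P Q [e1 e10 h1] [e2 e20 h2]; exists (Num.min e1 e2).
    by rewrite lt_min e10.
  by move=> e B /andP[e0]; rewrite lt_min => /andP[l1 l2] hB; split; [apply: h1|apply: h2]; rewrite ?e0.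
- by move=> P Q PQ [e0 e00 h]; exists e0 => // e B he hB; apply: PQ; exact: h.
Qed.

Lemma near_scale_gt0 : \forall p \near scaleF, 0 < p.1.
Proof. by exists 1 => // e B /andP[]. Qed.

Lemma near_scale_lt (d : R) : 0 < d -> \forall p \near scaleF, p.1 < d.
Proof. by move=> d0; exists d => // e B /andP[]. Qed.

Lemma near_scale_box : \forall p \near scaleF, p.1 ^- 2 <= p.2%:R.
Proof. by exists 1 => // e B. Qed.

Lemma scale_cvg_pinfty (X : R) : 0 < X -> X / p.1 @[p --> scaleF] --> +oo.
Proof.
move=> X0 A [M [Mr hM]]; have m0 : 0 < Num.max M 0 + 1.
  by rewrite ltr_pwDr // le_max lexx orbT.
exists (X / (Num.max M 0 + 1)); first by rewrite divr_gt0.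
move=> e B /andP[e0 he] _ /=; apply: hM.
rewrite ltr_pdivlMr // in he; rewrite ltr_pdivlMr //.
apply: le_lt_trans he; rewrite mulrC ler_pM2l //.
by apply: (@le_trans _ _ (Num.max M 0)); rewrite ?le_max ?lexx ?lerDl.
Qed.

(** For [1 <= l] the box condition survives, since [(l e)^-2 <= e^-2 <= B]. This is the source of
    the condition [1 <= l] in the homogeneity statements for [Ent] and [Dlim]. *)
Lemma scale_mul (l : R) : 1 <= l -> (l * p.1, p.2) @[p --> scaleF] --> scaleF.
Proof.
move=> l1 A [e0 e00 h]; exists (e0 / l); first by rewrite divr_gt0 //; lra.
move=> e B /andP[ep he] hB /=; have l0 : 0 < l by lra.
apply: h; first by rewrite mulr_gt0 //= mulrC -ltr_pdivlMr.
apply: le_trans hB; rewrite lef_pV2 ?posrE ?exprn_gt0 ?mulr_gt0 //.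
have h1 : e <= l * e by rewrite ler_peMl // ltW.
by rewrite ler_sqr ?nnegrE //; [exact: ltW|apply: le_trans h1; exact: ltW].
Qed.

End ScaleFilter.

(** * Primitive vectors in dilates of a norm ball *)

Section PrimitiveSums.
Variable R : realType.
Local Notation plane := 'rV[R]_2.
Variables (psi : plane -> R) (eta : R).
Hypothesis psi_sn : seminorm psi.
Hypothesis eta_gt0 : 0 < eta.
Hypothesis psi_low : coercive eta psi.

Let q (s : bool) (a b : nat) : R := psi (vecn R s a b).

Lemma psi_gt0 v : 0 < n1 v -> 0 < psi v.
Proof. by move=> h; apply: lt_le_trans (psi_low v); rewrite mulr_gt0. Qed.

Lemma quad_homo s k a b : q s (k * a) (k * b) = k%:R * q s a b.
Proof. by rewrite /q vecnM; case: psi_sn => _ h _; rewrite h ?ler0n. Qed.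

Lemma quad_lip s a b i j : q s a b <= q s (a + i) (b + j) + sbound psi * (i + j)%:R.
Proof.
apply: le_trans (seminorm_lip _ (vecn R s (a + i) (b + j)) psi_sn) _.
rewrite lerD2l ler_wpM2l ?sbound_ge0 // vecnD opprD addrA subrr sub0r.
by case: (@seminorm_n1 R) => _ _ ->; rewrite n1_vecn.
Qed.

Lemma quad_low s a b : eta * (a + b)%:R <= q s a b.
Proof. by apply: le_trans (psi_low _); rewrite n1_vecn. Qed.

Lemma psum_indicator (e X : R) B : 0 < e -> (qbound eta (X / e) <= B)%N ->
  psum (fun v => (e * psi v <= X)%R%:R) B =
  \sum_(s : bool) qcount (q s) eta prim (X / e).
Proof.
move=> e0 hB; rewrite psumE; apply: eq_bigr => s _.
rewrite (qcountE eta_gt0 (quad_low s) _ hB); apply: sum2_eq => a b _ _.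
rewrite ler_pdivlMr // mulrC [q s a b * e]mulrC /q.
by case: (prim a b) => /=; rewrite ?mulr1 ?mulr0.
Qed.

(** The vectors with [e psi v <= X] have size of order [e^-1], so a box of side [e^-2] eventually
    contains them all. *)
Lemma near_qbound (X : R) : 0 < X ->
  \forall p \near @scaleF R, (qbound eta (X / p.1) <= p.2)%N.
Proof.
move=> X0; near=> p.
have p0 : 0 < p.1 by near: p; exact: near_scale_gt0.
have pB : p.1 ^- 2 <= p.2%:R by near: p; exact: near_scale_box.
have pm : p.1 < Num.min 1 ((X / eta + 1)^-1).
  near: p; apply: near_scale_lt; rewrite lt_min ltr01 invr_gt0.
  by rewrite addr_gt0 // divr_gt0.
move: pm; rewrite lt_min => /andP[p1 p2].
rewrite -(ler_nat R); apply: le_trans pB.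
have T0 : 0 <= X / p.1 by rewrite divr_ge0 // ltW.
apply: le_trans (qbound_le eta_gt0 T0) _.
have -> : p.1 ^- 2 = p.1^-1 * p.1^-1 by rewrite -exprVn expr2.
have i1 : 1 <= p.1^-1 by rewrite -[leLHS]invr1 lef_pV2 ?posrE // ltW.
have i2 : X / eta + 1 <= p.1^-1.
  by rewrite -[leLHS]invrK lef_pV2 ?posrE ?invr_gt0 ?addr_gt0 ?divr_gt0 // ltW.
have -> : X / p.1 / eta = X / eta * p.1^-1 by ring.
have := divr_gt0 X0 eta_gt0.
by move: (X / eta) p.1^-1 i1 i2 => a b; nra.
Unshelve. all: by end_near.
Qed.

(** The constant [a] adds up the densities of the two quadrants that make up the half-plane. The
    lower bound says that the density is large as soon as [psi] is small in a single direction [v0];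
    it comes from counting in a strip along [v0]. *)
Lemma indicator_cvg : exists a : R,
  (forall X, 0 < X ->
    p.1 ^+ 2 * psum (fun v => (p.1 * psi v <= X)%R%:R) p.2 @[p --> @scaleF R]
      --> a * X ^+ 2) /\
  (forall (eta' : R) v0, 0 < eta' -> 0 < n1 v0 -> psi v0 <= eta' * n1 v0 ->
    (16 * eta' * sbound psi)^-1 <= a).
Proof.
have cv s := prim_count_cvg eta_gt0 (sbound_ge0 psi_sn) (quad_homo s) (quad_lip s) (quad_low s).
pose a s := lim (qcount (q s) eta prim T / T ^+ 2 @[T --> +oo]).
have a_ge0 s : 0 <= a s.
  by apply: limr_ge; [exact: cv|near=> T; rewrite divr_ge0 ?qcount_ge0 ?sqr_ge0].
exists (\sum_(s : bool) a s); split=> [X X0|eta' v0 eta0 v00 hv0].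
  have h s : (qcount (q s) eta prim (X / p.1) / (X / p.1) ^+ 2) * X ^+ 2
      @[p --> @scaleF R] --> a s * X ^+ 2.
    apply: cvgM; last exact: cvg_cst.
    exact: (cvg_comp _ _ (scale_cvg_pinfty X0) (cv s)).
  rewrite big_bool /= mulrDl.
  apply: cvg_trans (cvgD (h true) (h false)).
  apply: near_eq_cvg; near=> p.
  have p0 : 0 < p.1 by near: p; exact: near_scale_gt0.
  have hB : (qbound eta (X / p.1) <= p.2)%N by near: p; exact: near_qbound.
  rewrite (psum_indicator p0 hB) big_bool fctE /=.
  by field; rewrite !gt_eqF.
have C0 : 0 < sbound psi by rewrite addr_gt0 // psi_gt0 // /n1 ?pt0 ?pt1 normr1 normr0; lra.
(* Extends [vecn] to real coordinates, so that [v0], up to sign, can be written in one of the two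
   quadrants. *)
pose w (s : bool) (x y : R) : plane := if s then pt x y else pt (- y) x.
have w_ab s a' b' : vecn R s a' b' = w s a'%:R b'%:R by case: s.
have n1w s x y : 0 <= x -> 0 <= y -> n1 (w s x y) = x + y.
  by move=> x0 y0; case: s; rewrite /n1 /w ?pt0 ?pt1 ?normrN !ger0_norm // addrC.
have [s [x [y [x0 y0 xy hw]]]] : exists s x y, [/\ 0 <= x, 0 <= y, 0 < x + y &
    psi (w s x y) <= eta' * (x + y)].
  have sg : exists v, [/\ n1 v = n1 v0, psi v = psi v0 & 0 <= v 0 1].
    case: (leP 0 (v0 0 1)) => h; first by exists v0.
    case: psi_sn => _ _ ev; case: (@seminorm_n1 R) => _ _ ev'.
    by exists (- v0); rewrite ev ev' mxE; split=> //; rewrite oppr_ge0 ltW.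
  have [v [e1 e2 v1]] := sg; rewrite -e1 in v00; rewrite -e2 -e1 in hv0.
  case: (leP 0 (v 0 0)) => h.
    have wE : w true (v 0 0) (v 0 1) = v by rewrite /w -pt_eta.
    by exists true, (v 0 0), (v 0 1); rewrite -(n1w true) // wE; split.
  have wE : w false (v 0 1) (- v 0 0) = v by rewrite /w opprK -pt_eta.
  have h' : 0 <= - v 0 0 by rewrite oppr_ge0 ltW.
  by exists false, (v 0 1), (- v 0 0); rewrite -(n1w false) // wE; split.
have [b hb] := qcount_cvg eta_gt0 (sbound_ge0 psi_sn) (quad_homo s) (quad_lip s) (quad_low s).
have wD x1 y1 x2 y2 : w s x1 y1 + w s x2 y2 = w s (x1 + x2) (y1 + y2).
  by case: (s); apply: planeP; rewrite !mxE //= ?opprD.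
have wZ k x1 y1 : k *: w s x1 y1 = w s (k * x1) (k * y1).
  by case: (s); apply: planeP; rewrite !mxE //= ?mulrN.
have b_ge : (4 * (2 * eta') * sbound psi)^-1 <= b.
  have hz z t : psi (w s z t) <= sbound psi * (`|z| + `|t|).
    apply: le_trans (seminorm_le _ psi_sn) _; rewrite ler_wpM2l ?(ltW C0) //.
    by case: (s); rewrite /n1 /w ?pt0 ?pt1 ?normrN // addrC.
  case: psi_sn => sub hom _.
  (* The larger coordinate parametrises the strip: a unit step along [v0] then costs at most
     [eta' (x + y) / x <= 2 eta'], and a step across costs at most [sbound psi]. *)
  case: (leP y x) => hxy.
    have xp : 0 < x by lra.
    apply: (@qcount_lim_ge R (q s) eta eta_gt0 (quad_low s) (2 * eta') (sbound psi) (y / x)) hb => //.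
    - lra.
    - by rewrite divr_ge0.
    left=> a' b'; rewrite /q w_ab.
    have -> : w s a'%:R b'%:R = (a'%:R / x) *: w s x y + w s 0 (b'%:R - y / x * a'%:R).
      by rewrite wZ wD; congr w; field; rewrite gt_eqF.
    apply: le_trans (sub _ _) _; apply: lerD; last first.
      by apply: le_trans (hz _ _) _; rewrite normr0 add0r.
    have ax : 0 <= a'%:R / x by rewrite divr_ge0 // ltW.
    rewrite hom //; apply: le_trans (ler_wpM2l ax hw) _.
    have -> : a'%:R / x * (eta' * (x + y)) = eta' * ((x + y) / x) * a'%:R.
      by field; rewrite gt_eqF.
    apply: ler_wpM2r => //; rewrite [2 * _]mulrC ler_pM2l // ler_pdivrMr //; lra.
  have yp : 0 < y by lra.
  apply: (@qcount_lim_ge R (q s) eta eta_gt0 (quad_low s) (2 * eta') (sbound psi) (x / y)) hb => //.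
  - lra.
  - by rewrite divr_ge0.
  right=> a' b'; rewrite /q w_ab.
  have -> : w s b'%:R a'%:R = (a'%:R / y) *: w s x y + w s (b'%:R - x / y * a'%:R) 0.
    by rewrite wZ wD; congr w; field; rewrite gt_eqF.
  apply: le_trans (sub _ _) _; apply: lerD; last first.
    by apply: le_trans (hz _ _) _; rewrite normr0 addr0.
  have ax : 0 <= a'%:R / y by rewrite divr_ge0 // ltW.
  rewrite hom //; apply: le_trans (ler_wpM2l ax hw) _.
  have -> : a'%:R / y * (eta' * (x + y)) = eta' * ((x + y) / y) * a'%:R.
    by field; rewrite gt_eqF.
  apply: ler_wpM2r => //; rewrite [2 * _]mulrC ler_pM2l // ler_pdivrMr //; lra.
(* Passing to primitive points loses another factor 2, which gives [4 * 2 * 2 = 16]. *)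
have ba := prim_count_ge eta_gt0 (sbound_ge0 psi_sn) (quad_homo s) (quad_low s) hb (cv s).
apply: (@le_trans _ _ (a s)).
  have -> : (16 * eta' * sbound psi)^-1 = (4 * (2 * eta') * sbound psi)^-1 / 2.
    by field; rewrite !gt_eqF.
  by rewrite ler_pdivrMr // [a s * 2]mulrC; exact: le_trans b_ge ba.
by rewrite (bigD1 s) //= lerDl sumr_ge0.
Unshelve. all: by end_near.
Qed.

End PrimitiveSums.

(** * Existence, monotonicity and homogeneity of the entropy *)

Section EntropyLimit.
Variable R : realType.
Local Notation plane := 'rV[R]_2.
Implicit Types (psi phi : plane -> R) (e eta : R).

Lemma sum_le_nat (j N : nat) : \sum_(1 <= a < N) (a <= j)%N%:R <= j%:R :> R.
Proof.
suff h : \sum_(1 <= a < N) (a <= j)%N%:R <= (minn N.-1 j)%:R :> R.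
  by apply: le_trans h _; rewrite ler_nat geq_minr.
elim: N => [|[|N] IH]; [by rewrite big_geq|by rewrite big_geq|].
rewrite big_nat_recr //=; apply: le_trans (lerD IH (lexx _)) _.
rewrite -natrD ler_nat /=; clear; lia.
Qed.

(** At most [j] pairs with [0 < a] satisfy [a + b = j]. *)
Lemma sum2_shell (F : nat -> R) B : (forall j, 0 <= F j) ->
  sum2 (fun a b => (0 < a)%:R * F (a + b)%N) B <= \sum_(1 <= j < 2 * B) j%:R * F j.
Proof.
move=> F0; case: B => [|B]; first by rewrite /sum2 !big_geq.
rewrite /sum2 big_ltn // big1 ?add0r; last by move=> b _; rewrite mul0r.
apply: (@le_trans _ _ (\sum_(1 <= a < B.+1) \sum_(1 <= j < 2 * B.+1) (a <= j)%N%:R * F j)).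
  rewrite !big_nat; apply: ler_sum => a /andP[a1 aB].
  have -> : \sum_(0 <= b < B.+1) (0 < a)%:R * F (a + b)%N = \sum_(a <= j < a + B.+1) F j.
    have -> : \sum_(a <= j < a + B.+1) F j = \sum_(0 + a <= j < B.+1 + a) F j.
      by rewrite add0n addnC.
    by rewrite big_addn addnK; apply: eq_bigr => b _; rewrite a1 mul1r addnC.
  rewrite (@big_cat_nat _ _ _ a 1) //=; last by rewrite ltnW // (leq_trans aB) // leq_pmull.
  rewrite [X in _ <= _ + X](@big_cat_nat _ _ _ (a + B.+1) a) ?leq_addr //=; last by rewrite mul2n -addnn leq_add2r ltnW.
  rewrite [X in _ <= _ + (X + _)](_ : _ = \sum_(a <= j < a + B.+1) F j); last first.
    by rewrite !big_nat; apply: eq_bigr => j /andP[-> _]; rewrite mul1r.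
  have p1 : 0 <= \sum_(1 <= i < a) (a <= i)%N%:R * F i.
    by apply: sumr_ge0 => i _; rewrite mulr_ge0.
  have p2 : 0 <= \sum_(a + B.+1 <= i < 2 * B.+1) (a <= i)%N%:R * F i.
    by apply: sumr_ge0 => i _; rewrite mulr_ge0.
  by rewrite -[leLHS]add0r lerD // -[leLHS]addr0 lerD.
rewrite exchange_big /=; apply: ler_sum => j _.
by rewrite -mulr_suml ler_wpM2r // sum_le_nat.
Qed.

Lemma sum_expR_le (t : R) N : 0 < t -> \sum_(1 <= j < N) expR (- (t * j%:R)) <= mu t.
Proof.
move=> t0; set y := expR (- t).
have yE j : expR (- (t * j%:R)) = y ^+ j by rewrite /y -expRM_natr mulNr.
have y0 : 0 <= y by exact: expR_ge0.
have y1 : 0 < 1 - y by exact: expRN1_gt0.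
have -> : mu t = y / (1 - y).
  have := expR1_gt0 t0; rewrite /y /mu expRN in y1 * => ?.
  by field; rewrite !gt_eqF ?expR_gt0.
rewrite ler_pdivlMr // mulr_suml.
case: (leqP 1 N) => hN; last by rewrite big_geq // ltnW.
apply: (@le_trans _ _ (- \sum_(1 <= j < N) (y ^+ j.+1 - y ^+ j))).
  rewrite -sumrN; apply: ler_sum => j _; rewrite yE exprS opprB le_eqVlt; apply/orP; left.
  by apply/eqP; ring.
by rewrite telescope_sumr // expr1 opprB lerBlDr lerDl exprn_ge0.
Qed.

Definition hbound eta : R := 32 / eta ^+ 2.

(** Uniform in the box. The factor [1 / x] of [hh] cancels the multiplicity [j] of the shell
    [a + b = j], leaving a geometric series of ratio [expR (- e eta / 16)]; each quadrant
    contributes [16 / (e eta)^2]. *)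
Lemma psum_hh_le psi eta e B : 0 < eta -> coercive eta psi -> 0 < e ->
  e ^+ 2 * psum (fun v => hh (e * psi v)) B <= hbound eta.
Proof.
move=> eta0 low e0; have ee : 0 < e * eta by rewrite mulr_gt0.
pose F (j : nat) : R := (0 < j)%:R * hh (e * eta * j%:R).
have F0 j : 0 <= F j.
  by rewrite /F; case: j => [|j]; rewrite ?mul0r // mul1r ltW // hh_gt0 // mulr_gt0.
have h s : sum2 (fun a b => (prim a b)%:R * hh (e * psi (vecn R s a b))) B <=
    32 / (e * eta) ^+ 2 / 2.
  apply: (@le_trans _ _ (sum2 (fun a b => (0 < a)%:R * F (a + b)%N) B)).
    apply: sum2_le => a b _ _; rewrite /F /prim; case: a => [|a]; first by rewrite !mul0r.
    rewrite /= mul1r addSn mul1r.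
    have le : hh (e * psi (vecn R s a.+1 b)) <= hh (e * eta * (a + b).+1%:R).
      apply: hh_anti; first by rewrite mulr_gt0.
      by rewrite -mulrA ler_pM2l //; apply: le_trans (low _); rewrite n1_vecn.
    case: (coprime _ _); rewrite ?mul1r ?mul0r // ltW // hh_gt0 // mulr_gt0 //.
  apply: le_trans (sum2_shell _ F0) _.
  apply: (@le_trans _ _ ((e * eta)^-1 * \sum_(1 <= j < 2 * B) expR (- (e * eta / 16 * j%:R)))).
    rewrite mulr_sumr !big_nat; apply: ler_sum => j /andP[j1 _].
    have jp : 0 < (j%:R : R) by rewrite ltr0n.
    rewrite /F j1 mul1r /hh le_eqVlt; apply/orP; left; apply/eqP.
    have -> : e * eta * j%:R / 16 = e * eta / 16 * j%:R by field.
    by field; rewrite !gt_eqF.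
  have t0 : 0 < e * eta / 16 by rewrite divr_gt0.
  apply: le_trans (ler_wpM2l _ (le_trans (sum_expR_le _ t0) (mu_le_inv t0))) _.
    by rewrite invr_ge0 ltW.
  by rewrite le_eqVlt; apply/orP; left; apply/eqP; field; rewrite !gt_eqF.
rewrite psumE big_bool /=; apply: le_trans (ler_wpM2l (sqr_ge0 e) (lerD (h true) (h false))) _.
rewrite /hbound le_eqVlt; apply/orP; left; apply/eqP.
by field; rewrite !gt_eqF.
Qed.

(** Decreasing step function approximating [gg] on a grid of mesh [t], written by Abel summation as
    a combination of the indicators whose sums are controlled by [indicator_cvg]. *)
Definition gstep (t : R) (I : nat) (x : R) : R :=
  \sum_(1 <= i < I.+1) (gg (i%:R * t) - gg (i.+1%:R * t)) * (x <= i%:R * t)%R%:R.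

(** If [j] is the first index with [x <= j t], the sum telescopes to [gg (j t) - gg ((I + 1) t)].
    The mesh costs [2 t hh x] because the slope [mu] is at most [2 hh]. Beyond [I t] the decay
    [expR (- x / 2)] beats that of [hh] by the factor [expR (- 7/16 x)], which [d] measures. *)
Lemma gstep_approx (t d x : R) (I : nat) : 0 < t -> 0 < x ->
  2 * expR (- (7 / 16 * (I%:R * t))) <= d ->
  `|gg x - gstep t I x| <= (2 * t + d) * hh x.
Proof.
move=> t0 x0 hd.
have d0 : 0 <= d by apply: le_trans hd; rewrite mulr_ge0 // expR_ge0.
have hx := hh_gt0 x0.
have tail y : 0 < y -> I%:R * t <= y -> gg y <= d * hh y.
  move=> y0 hy; apply: le_trans (le_trans (gg_le_mu y0) (mu_le y0)) _.
  rewrite /hh [leRHS]mulrA ler_pM2r ?invr_gt0 //.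
  have -> : - (y / 2) = - (7 / 16 * y) + - (y / 16) by field.
  rewrite expRD mulrA ler_wpM2r ?expR_ge0 //; apply: le_trans hd.
  by rewrite ler_pM2l // ler_expR lerN2 ler_pM2l //; lra.
case: (leP x (I%:R * t)) => hI; last first.
  have -> : gstep t I x = 0.
    rewrite /gstep big_nat big1 // => i /andP[_ iI]; rewrite leNgt.
    have -> : i%:R * t < x.
      by apply: le_lt_trans hI; rewrite ler_pM2r // ler_nat.
    by rewrite mulr0.
  rewrite subr0 ger0_norm ?gg_ge0 //; apply: le_trans (tail _ x0 (ltW hI)) _.
  by rewrite ler_pM2r // lerDr mulr_ge0 // ltW.
have ex : exists j, x <= j%:R * t by exists I.
case: (ex_minnP ex) => j hj jmin.
have jI : (j <= I)%N by exact: jmin.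
have j0 : (0 < j)%N.
  by case: (j) hj => // ; rewrite mul0r leNgt x0.
have jx : j%:R * t <= x + t.
  case: j j0 jmin {hj jI} => // j _ jmin.
  have : ~~ (x <= j%:R * t) by apply/negP => /jmin; rewrite ltnn.
  by rewrite -ltNge -natr1 mulrDl mul1r lerD2r => /ltW.
have pos i : (0 < i)%N -> 0 < i%:R * t by move=> i0; rewrite mulr_gt0 // ltr0n.
have sE : gstep t I x = gg (j%:R * t) - gg (I.+1%:R * t).
  rewrite /gstep (@big_cat_nat _ _ _ j) //=; last by rewrite ltnW.
  rewrite [X in X + _]big_nat [X in X + _]big1 ?add0r => [|i /andP[_ ij]]; last first.
    case: (boolP (x <= i%:R * t)) => h; last by rewrite mulr0.
    by have := jmin _ h; rewrite leqNgt ij.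
  have -> : gg (j%:R * t) - gg (I.+1%:R * t) = - (gg (I.+1%:R * t) - gg (j%:R * t)) by ring.
  rewrite -(@telescope_sumr _ _ _ (fun i => gg (i%:R * t))); last by rewrite ltnW.
  rewrite -sumrN !big_nat; apply: eq_bigr => i /andP[ji _].
  rewrite (_ : x <= i%:R * t) ?mulr1 ?opprB //.
  by apply: le_trans hj _; rewrite ler_pM2r // ler_nat.
have xI : x <= I.+1%:R * t by apply: le_trans hI _; rewrite ler_pM2r // ler_nat.
have g1 : gg (I.+1%:R * t) <= d * hh x.
  apply: le_trans (tail _ (pos _ _) _) _ => //.
    by rewrite ler_pM2r // ler_nat.
  by rewrite ler_wpM2l // hh_anti.
have g2 : gg x - gg (j%:R * t) <= 2 * t * hh x.
  apply: (@le_trans _ _ (gg x - gg (x + t))).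
    by rewrite lerB // gg_le // pos.
  have xt : 0 < x + t by lra.
  apply: le_trans (gg_tangent xt x0) _.
  have -> : x + t - x = t by lra.
  by rewrite mulrAC; apply: ler_wpM2r; [exact: ltW|exact: mu_le_hh].
have g3 : gg (j%:R * t) <= gg x by exact: gg_le.
have g4 : 0 <= gg (I.+1%:R * t) by apply: gg_ge0; exact: pos.
by rewrite sE ger0_norm ?mulrDl; lra.
Qed.

Definition Sfun psi (p : R * nat) : R :=
  p.1 ^+ 2 * psum (fun v => gg (p.1 * psi v)) p.2.

Definition Ent psi : R := lim (Sfun psi p @[p --> @scaleF R]).

(** The sums of [gstep] converge, and [psum_hh_le] turns the pointwise error of [gstep_approx] into
    a uniformly small one, so the family is Cauchy. *)
Lemma Sfun_cvg psi : is_norm psi -> cvg (Sfun psi p @[p --> @scaleF R]).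
Proof.
move=> [sn [eta eta0 low]].
have [a [ha _]] := indicator_cvg sn eta0 low.
apply: cauchy_cvg; apply: cauchy_exP => d d0.
have H0 : 0 < hbound eta by rewrite divr_gt0 // exprn_gt0.
(* With these values [(2 t + d') * hbound eta = d / 4]; [I] is then taken so large that
   [expR (7/16 I t) >= 2 / d']. *)
pose t := d / (16 * hbound eta); have t0 : 0 < t by rewrite divr_gt0 // mulr_gt0.
pose d' := d / (8 * hbound eta); have d'0 : 0 < d' by rewrite divr_gt0 // mulr_gt0.
pose I := (Num.truncn (2 / d' * 16 / 7 / t)).+1.
have hI : 2 * expR (- (7 / 16 * (I%:R * t))) <= d'.
  have h1 : 2 / d' <= 7 / 16 * (I%:R * t).
    have : 2 / d' * 16 / 7 / t < I%:R by exact: truncnS_gt.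
    by rewrite ltr_pdivrMr //; lra.
  rewrite expRN ler_pdivrMr ?expR_gt0 // -ler_pdivrMl // mulrC.
  by apply: le_trans h1 (le_trans _ (expR_ge1Dx _)); lra.
pose c i := gg (i%:R * t) - gg (i.+1%:R * t).
pose lim0 := \sum_(1 <= i < I.+1) c i * (a * (i%:R * t) ^+ 2).
have cvI : \sum_(1 <= i < I.+1) c i * (p.1 ^+ 2 *
    psum (fun v => (p.1 * psi v <= i%:R * t)%R%:R) p.2) @[p --> @scaleF R] --> lim0.
  rewrite /lim0; elim: (I) => [|n IH].
    by rewrite big_geq //; under eq_fun do rewrite big_geq //; exact: cvg_cst.
  rewrite big_nat_recr //=; under eq_fun do rewrite big_nat_recr //=.
  apply: cvgD => //; apply: cvgM; first exact: cvg_cst.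
  by apply: ha; rewrite mulr_gt0 // ltr0n.
have d2 : 0 < d / 2 by lra.
have nI := cvgr_dist_le _ _ cvI _ d2.
exists lim0; rewrite /= nbhs_filterE; near=> p; rewrite -ball_normE /=.
have p0 : 0 < p.1 by near: p; exact: near_scale_gt0.
set X := \sum_(1 <= i < I.+1) c i * (p.1 ^+ 2 *
    psum (fun v => (p.1 * psi v <= i%:R * t)%R%:R) p.2).
have h1 : `|lim0 - X| <= d / 2 by rewrite /X; near: p; exact: nI.
have h2 : `|X - Sfun psi p| <= d / 4.
  have -> : X = p.1 ^+ 2 * psum (fun v => gstep t I (p.1 * psi v)) p.2.
    rewrite /gstep psum_sum mulr_sumr; apply: eq_bigr => i _.
    by rewrite psumZ mulrCA.
  rewrite /Sfun -mulrBr normrM ger0_norm ?sqr_ge0 //.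
  have h3 : `|psum (fun v => gstep t I (p.1 * psi v)) p.2 -
      psum (fun v => gg (p.1 * psi v)) p.2| <=
      (2 * t + d') * psum (fun v => hh (p.1 * psi v)) p.2.
    rewrite -psumZ distrC /psum -sumrB; apply: le_trans (ler_norm_sum _ _ _) _.
    apply: ler_sum => i _; apply: gstep_approx => //.
    by rewrite mulr_gt0 // (psi_gt0 eta0 low) // n1_vec_gt0.
  apply: le_trans (ler_wpM2l (sqr_ge0 _) h3) _.
  rewrite mulrCA.
  have td : 0 <= 2 * t + d' by lra.
  apply: le_trans (ler_wpM2l td (psum_hh_le p.2 eta0 low p0)) _.
  rewrite le_eqVlt; apply/orP; left; apply/eqP; rewrite /t /d'; field.
  by rewrite gt_eqF.
by apply: le_lt_trans (ler_distD X _ _) _; lra.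
Unshelve. all: by end_near.
Qed.

Lemma Ent_cvg psi : is_norm psi -> Sfun psi p @[p --> @scaleF R] --> Ent psi.
Proof. exact: Sfun_cvg. Qed.

Lemma Sfun_ge0 psi eta p : 0 < eta -> coercive eta psi -> 0 < p.1 -> 0 <= Sfun psi p.
Proof.
move=> eta0 low p0; rewrite mulr_ge0 ?sqr_ge0 // psum_ge0 // => v hv.
by rewrite gg_ge0 // mulr_gt0 // (psi_gt0 eta0 low).
Qed.

Lemma Ent_ge0 psi : is_norm psi -> 0 <= Ent psi.
Proof.
move=> h; case: (h) => _ [eta eta0 low]; apply: limr_ge; first exact: Sfun_cvg.
near=> p; apply: (Sfun_ge0 eta0 low); near: p; exact: near_scale_gt0.
Unshelve. all: by end_near.
Qed.

Lemma Ent_anti psi phi : is_norm psi -> is_norm phi ->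
  (forall v, psi v <= phi v) -> Ent phi <= Ent psi.
Proof.
move=> h1 h2 h; case: (h1) => _ [eta eta0 low].
apply: (ler_cvg_to (Ent_cvg h2) (Ent_cvg h1)); near=> p.
have p0 : 0 < p.1 by near: p; exact: near_scale_gt0.
rewrite ler_wpM2l ?sqr_ge0 // psum_le // => v hv; apply: gg_le.
  by rewrite mulr_gt0 // (psi_gt0 eta0 low).
by rewrite ler_pM2l.
Unshelve. all: by end_near.
Qed.

Lemma is_normZ psi (l : R) : 0 < l -> is_norm psi -> is_norm (fun v => l * psi v).
Proof.
move=> l0 [sn [eta eta0 low]]; split; first exact: seminormM (ltW l0) sn.
by exists (l * eta); [rewrite mulr_gt0|move=> x; rewrite -mulrA ler_pM2l].
Qed.

Lemma is_normD psi phi : is_norm psi -> seminorm phi -> is_norm (fun v => psi v + phi v).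
Proof.
move=> [sn [eta eta0 low]] h; split; first exact: seminormD.
by exists eta => // x; apply: le_trans (low x) _; rewrite lerDl seminorm_ge0.
Qed.

(** Scaling the norm by [l] is the same as scaling [e] by [l], up to the prefactor [e^2]. *)
Lemma Ent_homo psi (l : R) : is_norm psi -> 1 <= l ->
  Ent (fun v => l * psi v) = l ^- 2 * Ent psi.
Proof.
move=> h l1; have l0 : 0 < l by lra.
apply: cvg_lim; first exact: norm_hausdorff.
have c := cvg_comp _ _ (scale_mul l1) (Ent_cvg h).
apply: cvg_trans (cvgM (cvg_cst (l ^- 2)) c).
apply: near_eq_cvg; near=> p; rewrite fctE /Sfun /=.
rewrite (_ : psum _ _ = psum (fun v => gg (l * p.1 * psi v)) p.2).
  by field; rewrite gt_eqF.
by apply: psum_eq => v _; congr gg; ring.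
Unshelve. all: by end_near.
Qed.

(** Keeps only the vectors with [e psi v <= 1], each of which contributes at least [gg 1]. The
    entropy therefore blows up along bounded norms that degenerate in some direction. *)
Lemma Ent_lower psi (eta' : R) v0 : is_norm psi -> 0 < eta' -> 0 < n1 v0 ->
  psi v0 <= eta' * n1 v0 -> gg 1 * (16 * eta' * sbound psi)^-1 <= Ent psi.
Proof.
move=> h e0 v00 hv; case: (h) => sn [eta eta0 low].
have [a [ha hl]] := indicator_cvg sn eta0 low.
have g0 : 0 <= gg (1 : R) by exact: gg_ge0.
apply: le_trans (ler_wpM2l g0 (hl _ _ e0 v00 hv)) _.
have c : gg 1 * (p.1 ^+ 2 * psum (fun v => (p.1 * psi v <= 1)%R%:R) p.2)
    @[p --> @scaleF R] --> gg 1 * a.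
  by apply: cvgM; [exact: cvg_cst|have := ha 1 ltr01; rewrite expr1n mulr1].
apply: (ler_cvg_to c (Ent_cvg h)); near=> p.
have p0 : 0 < p.1 by near: p; exact: near_scale_gt0.
rewrite mulrCA ler_wpM2l ?sqr_ge0 // -psumZ psum_le // => v hv'.
have pv : 0 < p.1 * psi v by rewrite mulr_gt0 // (psi_gt0 eta0 low).
case: (boolP (p.1 * psi v <= 1)) => hle; rewrite ?mulr1 ?mulr0; last exact: gg_ge0.
exact: gg_le.
Unshelve. all: by end_near.
Qed.

End EntropyLimit.

(** * Directional derivatives of the entropy *)

Section Derivative.
Variable R : realType.
Local Notation plane := 'rV[R]_2.
Implicit Types (psi phi : plane -> R) (eta : R) (p : R * nat).

Definition Dfun psi phi p : R :=
  p.1 ^+ 2 * psum (fun v => p.1 * phi v * mu (p.1 * psi v)) p.2.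

Definition Dlim psi phi : R := lim (Dfun psi phi p @[p --> @scaleF R]).

(** The Taylor bounds of [gg] summed over the vectors. Since [phi] is controlled relative to [psi],
    the relative perturbation is at most [1/8] for every vector at once and the error does not
    depend on the scale. *)
Lemma Sfun_taylor psi phi eta (k s : R) p : 0 < eta -> coercive eta psi -> 0 < p.1 ->
  (forall v, `|phi v| <= k * psi v) -> `|s| * k <= 1 / 8 ->
  Sfun psi p + s * Dfun psi phi p <= Sfun (fun v => psi v - s * phi v) p /\
  Sfun (fun v => psi v - s * phi v) p <=
    Sfun psi p + s * Dfun psi phi p + 150 * (s * k) ^+ 2 * hbound eta.
Proof.
move=> eta0 low p0 hphi hs.
have pos v : 0 < n1 v -> 0 < psi v by exact: (psi_gt0 eta0 low).
have hy v : 0 < n1 v -> `|p.1 * (s * phi v)| <= p.1 * psi v / 8.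
  move=> hv; rewrite !normrM (gtr0_norm p0) -mulrA ler_pM2l //.
  apply: le_trans (ler_wpM2l (normr_ge0 _) (hphi v)) _.
  by rewrite mulrA [leRHS]mulrC -div1r ler_wpM2r // ltW // pos.
have xv v : p.1 * (psi v - s * phi v) = p.1 * psi v - p.1 * (s * phi v) by ring.
have E : Sfun psi p + s * Dfun psi phi p =
  p.1 ^+ 2 * psum (fun v => gg (p.1 * psi v) + s * (p.1 * phi v * mu (p.1 * psi v))) p.2.
  by rewrite psumD psumZ /Sfun /Dfun; ring.
rewrite E; split.
  rewrite ler_wpM2l ?sqr_ge0 // psum_le // => v hv.
  have x0 : 0 < p.1 * psi v by rewrite mulr_gt0 // pos.
  have := hy _ hv; rewrite ler_norml => /andP[y1 y2].
  have := @gg_taylor_ge R (p.1 * psi v) (p.1 * (s * phi v)) x0 ltac:(lra).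
  rewrite xv; lra.
have := psum_hh_le p.2 eta0 low p0 => hH.
apply: (@le_trans _ _ (p.1 ^+ 2 * psum (fun v => (gg (p.1 * psi v) +
  s * (p.1 * phi v * mu (p.1 * psi v))) + 150 * (s * k) ^+ 2 * hh (p.1 * psi v)) p.2)).
  rewrite ler_wpM2l ?sqr_ge0 // psum_le // => v hv.
  have x0 : 0 < p.1 * psi v by rewrite mulr_gt0 // pos.
  have := gg_taylor_le x0 (hy _ hv); rewrite -xv => h.
  have h2 : (p.1 * (s * phi v) / (p.1 * psi v)) ^+ 2 <= (s * k) ^+ 2.
    rewrite -[leLHS]real_normK ?num_real // -[leRHS]real_normK ?num_real // ler_sqr ?nnegrE //.
    rewrite normrM normfV (gtr0_norm x0) ler_pdivrMr // !normrM (gtr0_norm p0).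
    have := ler_wpM2l (normr_ge0 s) (hphi v) => hh1.
    have k0 : k * psi v <= `|k| * psi v by rewrite ler_pM2r ?pos // ler_norm.
    have := ler_wpM2l (normr_ge0 s) k0 => hh2.
    rewrite [leRHS](_ : _ = p.1 * (`|s| * (`|k| * psi v))); last ring.
    by rewrite ler_pM2l //; exact: le_trans hh2.
  have h3 := hh_gt0 x0.
  have h4 : 150 * (p.1 * (s * phi v) / (p.1 * psi v)) ^+ 2 * hh (p.1 * psi v) <=
     150 * (s * k) ^+ 2 * hh (p.1 * psi v) by rewrite ler_pM2r // ler_pM2l.
  lra.
rewrite psumD psumZ mulrDr lerD2l mulrCA; apply: ler_wpM2l => //.
by apply: mulr_ge0 => //; exact: sqr_ge0.
Qed.

Definition relc eta phi : R := sbound phi / eta.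

Lemma relc_ge0 eta phi : 0 < eta -> seminorm phi -> 0 <= relc eta phi.
Proof. by move=> e0 h; rewrite divr_ge0 ?sbound_ge0 // ltW. Qed.

Lemma relcP eta psi phi v : 0 < eta -> coercive eta psi -> seminorm phi ->
  `|phi v| <= relc eta phi * psi v.
Proof.
move=> e0 low sn; rewrite ger0_norm ?seminorm_ge0 //.
apply: le_trans (seminorm_le _ sn) _; rewrite /relc -mulrA ler_wpM2l ?sbound_ge0 //.
by rewrite ler_pdivlMl.
Qed.

(** No new counting is required: difference quotients of [Sfun] converge because both entropies
    exist, and by [Sfun_taylor] they differ from [Dfun] by a multiple of [s], uniformly in the
    scale. *)
Lemma Dfun_cvg psi phi : is_norm psi -> seminorm phi ->
  cvg (Dfun psi phi p @[p --> @scaleF R]).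
Proof.
move=> hn sn; case: (hn) => psn [eta eta0 low].
set k := relc eta phi; have k0 : 0 <= k by exact: relc_ge0.
have H0 : 0 < hbound eta by rewrite divr_gt0 // exprn_gt0.
apply: cauchy_cvg; apply: cauchy_exP => d d0.
pose c := 150 * k ^+ 2 * hbound eta.
have c0 : 0 <= c by rewrite mulr_ge0 ?(ltW H0) // mulr_ge0 ?sqr_ge0.
(* The first bound keeps the perturbation within the range of [Sfun_taylor], the second makes its
   error at most [d / 4] after division by [s]. *)
pose s := Num.min ((8 * (k + 1))^-1) (d / (4 * (c + 1))).
have s0 : 0 < s by rewrite lt_min invr_gt0 divr_gt0 ?mulr_gt0 //; lra.
have s1 : `|- s| * k <= 1 / 8.
  rewrite normrN gtr0_norm //.
  have : s <= (8 * (k + 1))^-1 by rewrite ge_min lexx.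
  move=> h; apply: le_trans (ler_wpM2r k0 h) _.
  by rewrite -ler_pdivlMl ?mulr_gt0 ?invr_gt0 //; [rewrite invrK|]; lra.
have s2 : s * c <= d / 4.
  have : s <= d / (4 * (c + 1)) by rewrite ge_min lexx orbT.
  move=> h; apply: le_trans (ler_wpM2r c0 h) _.
  rewrite mulrAC ler_pdivrMr ?mulr_gt0 //; last lra.
  by have := mulr_ge0 (ltW d0) c0; lra.
(* The perturbation goes in the direction [+ phi], since subtracting a multiple of [phi] may destroy
   the triangle inequality. *)
have hn' : is_norm (fun v => psi v - (- s) * phi v).
  have -> : (fun v => psi v - (- s) * phi v) = (fun v => psi v + s * phi v).
    by apply: funext => v; ring.
  by apply: is_normD => //; apply: seminormM => //; exact: ltW.
set psi' := fun v => psi v - (- s) * phi v in hn'.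
have cv : (Sfun psi p - Sfun psi' p) * s^-1 @[p --> @scaleF R] -->
    (Ent psi - Ent psi') * s^-1.
  by apply: cvgM; [apply: cvgB; exact: Ent_cvg|exact: cvg_cst].
have d2 : 0 < d / 2 by lra.
have nI := cvgr_dist_le _ _ cv _ d2.
exists ((Ent psi - Ent psi') * s^-1); rewrite /= nbhs_filterE; near=> p; rewrite -ball_normE /=.
have p0 : 0 < p.1 by near: p; exact: near_scale_gt0.
have h1 : `|(Ent psi - Ent psi') * s^-1 - (Sfun psi p - Sfun psi' p) * s^-1| <= d / 2.
  by near: p; exact: nI.
have [h2 h3] := @Sfun_taylor psi phi eta k (- s) p eta0 low p0
  (fun v => relcP v eta0 low sn) s1.
rewrite -/psi' in h2 h3.
have h4 : `|(Sfun psi p - Sfun psi' p) * s^-1 - Dfun psi phi p| <= d / 4.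
  have -> : (Sfun psi p - Sfun psi' p) * s^-1 - Dfun psi phi p =
    (Sfun psi p - Sfun psi' p - s * Dfun psi phi p) / s by field; rewrite gt_eqF.
  rewrite normrM normfV (gtr0_norm s0) ler_pdivrMr //.
  have h5 : 150 * (- s * k) ^+ 2 * hbound eta <= d / 4 * s.
    have -> : 150 * (- s * k) ^+ 2 * hbound eta = s * c * s by rewrite /c; ring.
    by rewrite ler_pM2r.
  have h6 : 0 <= d / 4 * s by rewrite mulr_ge0 ?ltW //; lra.
  by rewrite ler_norml; apply/andP; split; lra.
by apply: le_lt_trans (ler_distD ((Sfun psi p - Sfun psi' p) * s^-1) _ _) _; lra.
Unshelve. all: by end_near.
Qed.

Lemma Dlim_cvg psi phi : is_norm psi -> seminorm phi ->
  Dfun psi phi p @[p --> @scaleF R] --> Dlim psi phi.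
Proof. exact: Dfun_cvg. Qed.

Lemma Ent_taylor psi phi : is_norm psi -> seminorm phi ->
  exists c s0 : R, [/\ 0 <= c, 0 < s0 & forall s, 0 <= s <= s0 ->
    Ent (fun v => psi v + s * phi v) <= Ent psi - s * Dlim psi phi + c * s ^+ 2].
Proof.
move=> hn sn; case: (hn) => psn [eta eta0 low].
set k := relc eta phi; have k0 : 0 <= k by exact: relc_ge0.
have H0 : 0 < hbound eta by rewrite divr_gt0 // exprn_gt0.
exists (150 * k ^+ 2 * hbound eta), (8 * (k + 1))^-1; split.
- by rewrite mulr_ge0 ?(ltW H0) // mulr_ge0 ?sqr_ge0.
- by rewrite invr_gt0 mulr_gt0 //; lra.
move=> s /andP[s0 hs].
have s1 : `|- s| * k <= 1 / 8.
  rewrite normrN ger0_norm //; apply: le_trans (ler_wpM2r k0 hs) _.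
  by rewrite -ler_pdivlMl ?mulr_gt0 ?invr_gt0 //; [rewrite invrK|]; lra.
have hn' : is_norm (fun v => psi v + s * phi v).
  by apply: is_normD => //; exact: seminormM.
have cv : Sfun psi p - s * Dfun psi phi p + 150 * k ^+ 2 * hbound eta * s ^+ 2
    @[p --> @scaleF R] -->
    Ent psi - s * Dlim psi phi + 150 * k ^+ 2 * hbound eta * s ^+ 2.
  apply: cvgD; last exact: cvg_cst.
  apply: cvgB; first exact: Ent_cvg.
  by apply: cvgM; [exact: cvg_cst|exact: Dlim_cvg].
apply: (ler_cvg_to (Ent_cvg hn') cv); near=> p.
have p0 : 0 < p.1 by near: p; exact: near_scale_gt0.
have [_ h3] := @Sfun_taylor psi phi eta k (- s) p eta0 low p0
  (fun v => relcP v eta0 low sn) s1.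
have -> : (fun v => psi v + s * phi v) = (fun v => psi v - (- s) * phi v).
  by apply: funext => v; ring.
by apply: le_trans h3 _; rewrite le_eqVlt; apply/orP; left; apply/eqP; ring.
Unshelve. all: by end_near.
Qed.

(** Along [psi] itself the norm may also be decreased; this supplies the opposite inequality in the
    first order condition. *)
Lemma Ent_taylor_self psi : is_norm psi ->
  exists2 c : R, 0 <= c & forall s, 0 <= s <= 1 / 8 ->
    Ent (fun v => (1 - s) * psi v) <= Ent psi + s * Dlim psi psi + c * s ^+ 2.
Proof.
move=> hn; case: (hn) => psn [eta eta0 low].
have H0 : 0 < hbound eta by rewrite divr_gt0 // exprn_gt0.
exists (150 * hbound eta); first by rewrite mulr_ge0 // ltW.
move=> s /andP[s0 hs].
have hn' : is_norm (fun v => (1 - s) * psi v) by apply: is_normZ => //; lra.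
have cv : Sfun psi p + s * Dfun psi psi p + 150 * hbound eta * s ^+ 2
    @[p --> @scaleF R] -->
    Ent psi + s * Dlim psi psi + 150 * hbound eta * s ^+ 2.
  apply: cvgD; last exact: cvg_cst.
  apply: cvgD; first exact: Ent_cvg.
  by apply: cvgM; [exact: cvg_cst|exact: Dlim_cvg].
apply: (ler_cvg_to (Ent_cvg hn') cv); near=> p.
have p0 : 0 < p.1 by near: p; exact: near_scale_gt0.
have [|_ h3] := @Sfun_taylor psi psi eta 1 s p eta0 low p0
  (fun v => ltac:(rewrite mul1r ger0_norm ?seminorm_ge0 //)).
  by rewrite ger0_norm //; lra.
have -> : (fun v => (1 - s) * psi v) = (fun v => psi v - s * psi v).
  by apply: funext => v; ring.
by apply: le_trans h3 _; rewrite le_eqVlt; apply/orP; left; apply/eqP; ring.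
Unshelve. all: by end_near.
Qed.

Lemma DlimD psi phi phi' : is_norm psi -> seminorm phi -> seminorm phi' ->
  Dlim psi (fun v => phi v + phi' v) = Dlim psi phi + Dlim psi phi'.
Proof.
move=> hn h h'; apply: cvg_lim; first exact: norm_hausdorff.
apply: cvg_trans (cvgD (Dlim_cvg hn h) (Dlim_cvg hn h')).
apply: near_eq_cvg; near=> p; rewrite ?fctE /Dfun -mulrDr -psumD.
by congr (_ * _); apply: psum_eq => v _; ring.
Unshelve. all: by end_near.
Qed.

Lemma DlimZ psi phi (k : R) : is_norm psi -> seminorm phi ->
  Dlim psi (fun v => k * phi v) = k * Dlim psi phi.
Proof.
move=> hn h; apply: cvg_lim; first exact: norm_hausdorff.
have cv : k * Dfun psi phi p @[p --> @scaleF R] --> k * Dlim psi phi.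
  by apply: cvgM; [exact: cvg_cst|exact: Dlim_cvg].
apply: cvg_trans cv; apply: near_eq_cvg; near=> p; rewrite /Dfun mulrCA -!psumZ.
by apply: psum_eq => v _; ring.
Unshelve. all: by end_near.
Qed.

Lemma Dlim_le psi phi phi' : is_norm psi -> seminorm phi -> seminorm phi' ->
  (forall v, phi v <= phi' v) -> Dlim psi phi <= Dlim psi phi'.
Proof.
move=> hn h h' le; case: (hn) => _ [eta eta0 low].
apply: (ler_cvg_to (Dlim_cvg hn h) (Dlim_cvg hn h')); near=> p.
have p0 : 0 < p.1 by near: p; exact: near_scale_gt0.
rewrite ler_wpM2l ?sqr_ge0 // psum_le // => v hv.
rewrite ler_wpM2r ?ler_pM2l // ltW // mu_gt0 // mulr_gt0 //.
exact: (psi_gt0 eta0 low).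
Unshelve. all: by end_near.
Qed.

Lemma Dlim_ge0 psi phi : is_norm psi -> seminorm phi -> 0 <= Dlim psi phi.
Proof.
move=> hn h; case: (hn) => _ [eta eta0 low]; apply: limr_ge; first exact: Dfun_cvg.
near=> p; have p0 : 0 < p.1 by near: p; exact: near_scale_gt0.
rewrite mulr_ge0 ?sqr_ge0 // psum_ge0 // => v hv.
rewrite !mulr_ge0 ?(ltW p0) ?seminorm_ge0 // ltW // mu_gt0 // mulr_gt0 //.
exact: (psi_gt0 eta0 low).
Unshelve. all: by end_near.
Qed.

Lemma Dlim_homo psi phi (l : R) : is_norm psi -> seminorm phi -> 1 <= l ->
  Dlim (fun v => l * psi v) phi = l ^- 3 * Dlim psi phi.
Proof.
move=> hn h l1; have l0 : 0 < l by lra.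
apply: cvg_lim; first exact: norm_hausdorff.
have c := cvg_comp _ _ (scale_mul l1) (Dlim_cvg hn h).
apply: cvg_trans (cvgM (cvg_cst (l ^- 3)) c).
apply: near_eq_cvg; near=> p; rewrite ?fctE /Dfun /=.
rewrite (_ : psum _ _ = l * psum (fun v => p.1 * phi v * mu (p.1 * (l * psi v))) p.2).
  by field; rewrite gt_eqF.
rewrite -psumZ; apply: psum_eq => v _; rewrite [l * p.1]mulrC -![p.1 * l * _]mulrA.
ring.
Unshelve. all: by end_near.
Qed.

End Derivative.

(** * Large deviations for the weighted multiplicities *)

Section Weights.
Variable R : realType.
Local Notation plane := 'rV[R]_2.
Implicit Types (psi phi : plane -> R) (eta e : R).

Definition mdot phi B N (m : {ffun idx B -> 'I_N}) : R :=
  \sum_(i : idx B) (m i)%:R * phi (vec R i).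

Lemma mdotB psi phi (s : R) B N (m : {ffun idx B -> 'I_N}) :
  mdot (fun v => psi v - s * phi v) m = mdot psi m - s * mdot phi m.
Proof.
by rewrite /mdot mulr_sumr -sumrB; apply: eq_bigr => i _; ring.
Qed.

Lemma weight_prod psi e B N :
  \sum_(m : {ffun idx B -> 'I_N}) expR (- (e * mdot psi m)) =
  \prod_(i : idx B) \sum_(k < N) expR (- (e * psi (vec R i))) ^+ k.
Proof.
rewrite bigA_distr_bigA; apply: eq_bigr => m _.
rewrite /mdot mulr_sumr -sumrN expR_sum; apply: eq_bigr => i _.
by rewrite -expRM_natl; congr expR; ring.
Qed.

Lemma expR_Sfun psi e B : 0 < e -> (forall v, 0 < n1 v -> 0 < psi v) ->
  expR (e ^- 2 * Sfun psi (e, B)) =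
  \prod_(i : idx B) (1 - expR (- (e * psi (vec R i))))^-1.
Proof.
move=> e0 pos; rewrite /Sfun /= mulrA mulVf ?mul1r ?expf_neq0 ?gt_eqF //.
rewrite /psum expR_sum; apply: eq_bigr => i _.
by rewrite expR_gg // mulr_gt0 // pos // n1_vec_gt0.
Qed.

Lemma geom_sum (y : R) N : (\sum_(k < N) y ^+ k) * (1 - y) = 1 - y ^+ N.
Proof.
have := subrX1 y N; move: (\sum_(k < N) _) => S h.
have -> : S * (1 - y) = - ((y - 1) * S) by ring.
by rewrite -h opprB.
Qed.

Lemma weight_sum_le psi e B N : 0 < e -> (forall v, 0 < n1 v -> 0 < psi v) ->
  \sum_(m : {ffun idx B -> 'I_N}) expR (- (e * mdot psi m)) <=
  expR (e ^- 2 * Sfun psi (e, B)).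
Proof.
move=> e0 pos; rewrite weight_prod expR_Sfun //; apply: ler_prod => i _.
set y := expR _.
have y0 : 0 <= y by exact: expR_ge0.
have y1 : 0 < 1 - y by apply: expRN1_gt0; rewrite mulr_gt0 // pos // n1_vec_gt0.
rewrite sumr_ge0 => [|k _]; last exact: exprn_ge0.
by rewrite -[leRHS]mul1r ler_pdivlMr // geom_sum lerBlDr lerDl exprn_ge0.
Qed.

Lemma prod_1B_ge (I : Type) (r : seq I) (F : I -> R) :
  (forall i, 0 <= F i <= 1) -> 1 - \sum_(i <- r) F i <= \prod_(i <- r) (1 - F i).
Proof.
move=> h; elim: r => [|i r IH]; first by rewrite !big_nil subr0.
rewrite !big_cons; have /andP[h0 h1] := h i.
have p : \prod_(j <- r) (1 - F j) <= 1.
  elim: (r) => [|j s IH']; first by rewrite big_nil.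
  rewrite big_cons; have /andP[j0 j1] := h j.
  rewrite -[leRHS]mulr1 ler_pM //; try lra.
  by apply: prodr_ge0 => k _; have /andP[_ ?] := h k; lra.
move: IH p; move: (\prod_(j <- r) _) (\sum_(j <- r) _) => P S; nra.
Qed.

(** Truncating the geometric series at [N] multiplies the full product by the product of the
    [1 - y_i^N], which is at least [1/2] once [N] is large for the given scale and box. *)
Lemma weight_sum_ge psi eta e B : 0 < eta -> coercive eta psi -> 0 < e ->
  exists N, 2^-1 * expR (e ^- 2 * Sfun psi (e, B)) <=
    \sum_(m : {ffun idx B -> 'I_N}) expR (- (e * mdot psi m)).
Proof.
move=> eta0 low e0.
have pos v : 0 < n1 v -> 0 < psi v by exact: (psi_gt0 eta0 low).
pose z := expR (- (e * eta)).
have ee : 0 < e * eta by rewrite mulr_gt0.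
have z0 : 0 <= z by exact: expR_ge0.
have z1 : z < 1 by rewrite expR_lt1 oppr_lt0.
have [N hN] : exists N, z ^+ N * #|{: idx B}|%:R < 2^-1.
  have : z ^+ j * #|{: idx B}|%:R @[j --> \oo] --> (0 * #|{: idx B}|%:R : R).
    apply: cvgM; last exact: cvg_cst.
    by apply: cvg_expr; rewrite ger0_norm.
  rewrite mul0r => /cvgrPdist_lt /(_ 2^-1)[|j _ /(_ j (leqnn j))] /=; first lra.
  rewrite sub0r normrN ger0_norm; first by exists j.
  by rewrite mulr_ge0 ?exprn_ge0.
exists N; rewrite weight_prod expR_Sfun //.
have -> : \prod_(i : idx B) \sum_(k < N) expR (- (e * psi (vec R i))) ^+ k =
  (\prod_(i : idx B) (1 - expR (- (e * psi (vec R i))) ^+ N)) *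
  \prod_(i : idx B) (1 - expR (- (e * psi (vec R i))))^-1.
  rewrite -big_split /=; apply: eq_bigr => i _; rewrite -geom_sum mulfK //.
  by rewrite gt_eqF // expRN1_gt0 // mulr_gt0 // pos // n1_vec_gt0.
have y1 i : 0 < 1 - expR (- (e * psi (vec R (i : idx B)))).
  by rewrite expRN1_gt0 // mulr_gt0 // pos // n1_vec_gt0.
apply: ler_wpM2r; first by apply: prodr_ge0 => i _; rewrite invr_ge0 ltW.
have le i : expR (- (e * psi (vec R (i : idx B)))) <= z.
  rewrite ler_expR lerN2 ler_pM2l //; apply: le_trans (low _).
  rewrite ler_peMr ?(ltW eta0) // n1_vecn ler1n addn_gt0.
  by have /andP[-> _] := idxP i.
apply: le_trans (prod_1B_ge _ _); last first.
  move=> i; rewrite exprn_ge0 ?expR_ge0 // exprn_ile1 ?expR_ge0 //.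
  exact: ltW (le_lt_trans (le i) z1).
have : \sum_(i : idx B) expR (- (e * psi (vec R i))) ^+ N <= z ^+ N * #|{: idx B}|%:R.
  rewrite mulr_natr -sumr_const; apply: ler_sum => i _.
  by apply: lerXn2r; rewrite ?nnegrE ?expR_ge0.
by move: hN; lra.
Qed.

(** Half of the smaller rate is sacrificed: [expR (e^-2 c) >= 2] absorbs the number of summands when
    [e^2 < c]. *)
Lemma expR_merge (c1 c2 : R) : 0 < c1 -> 0 < c2 -> exists2 c : R, 0 < c &
  forall (e X1 X2 : R), 0 < e -> e ^+ 2 < c ->
    forall S, X1 <= expR (e ^- 2 * (S - c1)) -> X2 <= expR (e ^- 2 * (S - c2)) ->
    X1 + X2 <= expR (e ^- 2 * (S - c)).
Proof.
move=> h1 h2; pose d := Num.min c1 c2.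
have d0 : 0 < d by rewrite lt_min h1.
exists (d / 2); first by lra.
move=> e X1 X2 e0 he T hX1 hX2.
have e20 : 0 < e ^+ 2 by rewrite exprn_gt0.
have ei : 0 < e ^- 2 by rewrite invr_gt0.
have b c : d <= c -> expR (e ^- 2 * (T - c)) <= expR (e ^- 2 * (T - d)).
  by move=> dc; rewrite ler_expR ler_pM2l //; lra.
have d1 : d <= c1 by rewrite ge_min lexx.
have d2 : d <= c2 by rewrite ge_min lexx orbT.
apply: le_trans (lerD (le_trans hX1 (b _ d1)) (le_trans hX2 (b _ d2))) _.
have -> : e ^- 2 * (T - d / 2) = e ^- 2 * (T - d) + e ^- 2 * (d / 2) by field; rewrite gt_eqF.
rewrite expRD -mulr2n -[leLHS]mulr_natr ler_pM2l ?expR_gt0 //.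
apply: le_trans (expR_ge1Dx _).
suff : 1 <= e ^- 2 * (d / 2) by lra.
by rewrite ler_pdivlMl // mulr1 ltW.
Qed.

Definition deviates psi (Phi : seq (plane -> R)) (h : R) e B N (m : {ffun idx B -> 'I_N}) :=
  has (fun phi => h < `|e ^+ 3 * mdot phi m - Dlim psi phi|) Phi.

(** Exponential Markov inequality. Tilting by [phi] turns the weights of [psi] into those of
    [psi - s t phi], whose partition function is bounded through [Sfun_taylor]. The linear gain
    [s h] dominates the quadratic error for small [s]. The sign [t] selects the upper or the lower
    tail. *)
Lemma chernoff psi phi (h t : R) : is_norm psi -> seminorm phi -> 0 < h ->
  `|t| = 1 ->
  exists2 c : R, 0 < c & \forall p \near @scaleF R, forall N,
    \sum_(m : {ffun idx p.2 -> 'I_N} | h < t * (p.1 ^+ 3 * mdot phi m - Dlim psi phi))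
      expR (- (p.1 * mdot psi m)) <= expR (p.1 ^- 2 * (Sfun psi p - c)).
Proof.
move=> hn sn h0 ht; case: (hn) => psn [eta eta0 low].
set k := relc eta phi; have k0 : 0 <= k by exact: relc_ge0.
have H0 : 0 < hbound eta by rewrite divr_gt0 // exprn_gt0.
pose c0 := 150 * k ^+ 2 * hbound eta.
have c00 : 0 <= c0 by rewrite mulr_ge0 ?(ltW H0) // mulr_ge0 ?sqr_ge0.
(* The first bound keeps the tilt in the Taylor range; the second makes its error at most [s h / 4].
   The convergence of [Dfun] costs another [s h / 4], which leaves the rate [s h / 2]. *)
pose s := Num.min ((8 * (k + 1))^-1) (h / (4 * (c0 + 1))).
have s0 : 0 < s by rewrite lt_min invr_gt0 divr_gt0 ?mulr_gt0 //; lra.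
have s1 : s * k <= 1 / 8.
  have : s <= (8 * (k + 1))^-1 by rewrite ge_min lexx.
  move=> hh; apply: le_trans (ler_wpM2r k0 hh) _.
  by rewrite -ler_pdivlMl ?mulr_gt0 ?invr_gt0 //; [rewrite invrK|]; lra.
have s2 : s * c0 <= h / 4.
  have : s <= h / (4 * (c0 + 1)) by rewrite ge_min lexx orbT.
  move=> hh; apply: le_trans (ler_wpM2r c00 hh) _.
  rewrite mulrAC ler_pdivrMr ?mulr_gt0 //; last lra.
  by have := mulr_ge0 (ltW h0) c00; lra.
have h4 : 0 < h / 4 by lra.
have nD := cvgr_dist_le _ _ (Dlim_cvg hn sn) _ h4.
exists (s * h / 2); first by rewrite divr_gt0 // mulr_gt0.
near=> p => N.
have p0 : 0 < p.1 by near: p; exact: near_scale_gt0.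
have dD : `|Dlim psi phi - Dfun psi phi p| <= h / 4 by near: p; exact: nD.
have ei : 0 < p.1 ^- 2 by rewrite invr_gt0 exprn_gt0.
have ts : `|s * t| * k <= 1 / 8 by rewrite normrM ht mulr1 gtr0_norm.
have [_ tay] := @Sfun_taylor R psi phi eta k (s * t) p eta0 low p0
  (fun v => relcP v eta0 low sn) ts.
have pos v : 0 < n1 v -> 0 < psi v - s * t * phi v.
  move=> hv; have pv := psi_gt0 eta0 low hv.
  have : `|s * t * phi v| <= 1 / 8 * psi v.
    rewrite normrM; apply: le_trans (ler_wpM2l (normr_ge0 _) (relcP v eta0 low sn)) _.
    by rewrite mulrA ler_pM2r.
  by rewrite ler_norml => /andP[_ ?]; lra.
apply: (@le_trans _ _ (\sum_(m : {ffun idx p.2 -> 'I_N})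
  expR (- (p.1 ^- 2 * (s * (t * Dlim psi phi + h)))) *
  expR (- (p.1 * mdot (fun v => psi v - s * t * phi v) m)))).
  rewrite big_mkcond; apply: ler_sum => m _; case: ifPn => [hm|_]; last first.
    by rewrite mulr_ge0 // expR_ge0.
  rewrite -expRD ler_expR mdotB.
  have : 0 <= p.1 ^- 2 * (s * (t * (p.1 ^+ 3 * mdot phi m - Dlim psi phi) - h)).
    by rewrite !mulr_ge0 ?(ltW ei) ?(ltW s0) // subr_ge0 ltW.
  have -> : p.1 ^- 2 * (s * (t * (p.1 ^+ 3 * mdot phi m - Dlim psi phi) - h)) =
    - (p.1 ^- 2 * (s * (t * Dlim psi phi + h))) + p.1 * (s * t * mdot phi m).
    by field; rewrite gt_eqF.
  by rewrite mulrBr; lra.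
rewrite -mulr_sumr.
apply: le_trans (ler_wpM2l (expR_ge0 _) (weight_sum_le _ _ p0 pos)) _.
rewrite -expRD ler_expR -mulrN -mulrDr ler_pM2l // -surjective_pairing.
apply: le_trans (lerD (lexx _) tay) _.
have e1 : 150 * (s * t * k) ^+ 2 * hbound eta = s * (s * c0).
  have t2 : t ^+ 2 = 1 by rewrite -real_normK ?num_real // ht expr1n.
  have -> : 150 * (s * t * k) ^+ 2 * hbound eta = t ^+ 2 * (s * (s * c0)).
    by rewrite /c0; ring.
  by rewrite t2 mul1r.
have e2 : s * t * (Dfun psi phi p - Dlim psi phi) <= s * (h / 4).
  rewrite -mulrA ler_pM2l //; apply: le_trans (ler_norm _) _.
  by rewrite normrM ht mul1r distrC.
have e3 : s * (s * c0) <= s * (h / 4) by rewrite ler_pM2l.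
rewrite e1; lra.
Unshelve. all: by end_near.
Qed.

(** Union bound over the tests and the two tails. The default [n1] of [nth] is a seminorm, so the
    hypothesis can range over all indices and passes to the tail of the list. *)
Lemma concentration psi (Phi : seq (plane -> R)) (h : R) : is_norm psi -> 0 < h ->
  (forall i, seminorm (nth (@n1 R) Phi i)) ->
  exists2 c : R, 0 < c & \forall p \near @scaleF R, forall N,
    \sum_(m : {ffun idx p.2 -> 'I_N} | deviates psi Phi h p.1 m)
      expR (- (p.1 * mdot psi m)) <= expR (p.1 ^- 2 * (Sfun psi p - c)).
Proof.
move=> hn h0; elim: Phi => [|phi Phi IH] hP.
  by exists 1 => //; near=> p => N; rewrite big1 // expR_ge0.
have sn : seminorm phi by exact: (hP 0%N).
have [c1 c10 H1] := IH (fun i => hP i.+1).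
have [c2 c20 H2] := chernoff hn sn h0 (normr1 _).
have [c3 c30 H3] := chernoff hn sn h0 (t := -1) ltac:(by rewrite normrN normr1).
have [c4 c40 m4] := @expR_merge c2 c3 c20 c30.
have [c5 c50 m5] := @expR_merge c4 c1 c40 c10.
exists c5 => //; near=> p => N.
have p0 : 0 < p.1 by near: p; exact: near_scale_gt0.
have pm : p.1 < Num.min 1 (Num.min c4 c5).
  by near: p; apply: near_scale_lt; rewrite !lt_min ltr01 c40.
move: pm; rewrite !lt_min => /and3P[q1 q2 q3].
have psq : p.1 ^+ 2 <= p.1 by rewrite expr2 ler_piMl // ltW.
have K1 : \sum_(m : {ffun idx p.2 -> 'I_N} | deviates psi Phi h p.1 m)
      expR (- (p.1 * mdot psi m)) <= expR (p.1 ^- 2 * (Sfun psi p - c1)).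
  by move: N; near: p.
have K2 : \sum_(m : {ffun idx p.2 -> 'I_N} | h < 1 * (p.1 ^+ 3 * mdot phi m - Dlim psi phi))
      expR (- (p.1 * mdot psi m)) <= expR (p.1 ^- 2 * (Sfun psi p - c2)).
  by move: N {K1}; near: p.
have K3 : \sum_(m : {ffun idx p.2 -> 'I_N} | h < -1 * (p.1 ^+ 3 * mdot phi m - Dlim psi phi))
      expR (- (p.1 * mdot psi m)) <= expR (p.1 ^- 2 * (Sfun psi p - c3)).
  by move: N {K1 K2}; near: p.
have K4 := m4 _ _ _ p0 (le_lt_trans psq q2) _ K2 K3.
have K5 := m5 _ _ _ p0 (le_lt_trans psq q3) _ K4 K1.
apply: le_trans K5; rewrite big_mkcond [X in _ <= X + _ + _]big_mkcond
  [X in _ <= _ + X + _]big_mkcond [X in _ <= _ + X]big_mkcond -2!big_split /=; apply: ler_sum => m _.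
rewrite /deviates /= ltr_normr mul1r mulN1r.
have w0 := expR_ge0 (- (p.1 * mdot psi m)).
by case: (_ < _); case: (_ < _); case: (has _ _) => /=; clear -w0; lra.
Unshelve. all: by end_near.
Qed.

End Weights.

(** * Non-degeneracy of the mean width and the number of typical families *)

Section Typical.
Variable R : realType.
Local Notation plane := 'rV[R]_2.
Implicit Types (psi phi : plane -> R) (eta e : R).

(** The two vectors are orthogonal and of equal length, so the left-out Euclidean product of lengths
    is a lower bound; passing from Euclidean lengths to [n1] costs a factor [sqrt 2] twice. *)
Lemma dot_rot_ge (u : plane) a b :
  n1 u * n1 (vecn R true a b) / 2 <= `|dot u (vecn R true a b)| + `|dot u (vecn R false a b)|.
Proof.
rewrite n1_vecn natrD /dot /n1 /vecn !pt0 !pt1.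
have ha : 0 <= (a%:R : R) by []; have hb : 0 <= (b%:R : R) by [].
move: (u 0 0) (u 0 1) (a%:R : R) (b%:R : R) ha hb => x y {}a {}b ha hb.
set P := `|x * a + y * b|; set Q := `|x * - b + y * a|.
have P0 : 0 <= P by exact: normr_ge0.
have Q0 : 0 <= Q by exact: normr_ge0.
have P2 : P ^+ 2 = (x * a + y * b) ^+ 2 by rewrite real_normK ?num_real.
have Q2 : Q ^+ 2 = (x * - b + y * a) ^+ 2 by rewrite real_normK ?num_real.
have x2 : `|x| ^+ 2 = x ^+ 2 by rewrite real_normK ?num_real.
have y2 : `|y| ^+ 2 = y ^+ 2 by rewrite real_normK ?num_real.
have nx := normr_ge0 x; have ny := normr_ge0 y.
rewrite -ler_sqr ?nnegrE; last 2 first.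
- by rewrite divr_ge0 // mulr_ge0 // addr_ge0.
- exact: addr_ge0.
have PQ : 0 <= P * Q by exact: mulr_ge0.
have -> : (P + Q) ^+ 2 = (x ^+ 2 + y ^+ 2) * (a ^+ 2 + b ^+ 2) + 2 * (P * Q).
  have -> : (P + Q) ^+ 2 = P ^+ 2 + Q ^+ 2 + 2 * (P * Q) by ring.
  by rewrite P2 Q2; ring.
rewrite -x2 -y2; move: `|x| `|y| nx ny => X Y X0 Y0.
have h1 : (X + Y) ^+ 2 <= 2 * (X ^+ 2 + Y ^+ 2) by have := sqr_ge0 (X - Y); lra.
have h2 : (a + b) ^+ 2 <= 2 * (a ^+ 2 + b ^+ 2) by have := sqr_ge0 (a - b); lra.
have := ler_pM (sqr_ge0 _) (sqr_ge0 _) h1 h2.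
have -> : ((X + Y) * (a + b) / 2) ^+ 2 = (X + Y) ^+ 2 * (a + b) ^+ 2 / 4 by field.
lra.
Qed.

(** Says that the limit zonoid is not flat, so that errors proportional to [n1 u] become relative
    errors of its width. After [psi] is replaced by a multiple of [n1], a vector and its quarter
    turn carry the same weight, and [dot_rot_ge] applies to each such pair. *)
Lemma Dlim_dot_ge psi : is_norm psi ->
  exists2 rho : R, 0 < rho & forall u, rho * n1 u <= Dlim psi (fun v => `|dot u v|).
Proof.
move=> hn; case: (hn) => sn [eta eta0 low].
have n1e : n1 (pt 1 0 : plane) = 1 by rewrite /n1 pt0 pt1 normr1 normr0 addr0.
pose C := sbound psi.
have C0 : 0 < C.
  rewrite /C /sbound ltr_pwDl ?seminorm_ge0 //.
  by apply: (psi_gt0 eta0 low); rewrite n1e.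
have hn1 : seminorm (@n1 R) by exact: seminorm_n1.
(* Dominates [psi], hence lowers [mu], and takes equal values on [vecn true a b] and
   [vecn false a b]. *)
pose bar := fun v : plane => C * n1 v.
have snb : seminorm bar by exact: seminormM (ltW C0) hn1.
have lowb : coercive C bar by [].
have hb : is_norm bar by split => //; exists C.
have [a [ha hl]] := indicator_cvg snb C0 lowb.
have sb : 0 < sbound bar.
  by rewrite /sbound /bar n1e mulr1 ltr_pwDl // mulr_ge0 ?n1_ge0 // ltW.
have a0 : 0 < a.
  apply: lt_le_trans (hl C (pt 1 0) C0 _ (lexx _)); last by rewrite n1e.
  by rewrite invr_gt0 !mulr_gt0.
have e1 : 0 < expR 1 :> R by exact: expR_gt0.
(* On [0 < x <= 1] one has [x mu x >= expR (- 1)], which bounds the derivative below by the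
   indicator sum. *)
pose d0 := (C * expR 1)^-1 * a.
have d00 : 0 < d0 by rewrite mulr_gt0 // invr_gt0 mulr_gt0.
have Dn1 : d0 <= Dlim bar (@n1 R).
  have cv : (C * expR 1)^-1 * (p.1 ^+ 2 * psum (fun v => (p.1 * bar v <= 1)%R%:R) p.2)
    @[p --> @scaleF R] --> d0.
    by apply: cvgM; [exact: cvg_cst|have := ha 1 ltr01; rewrite expr1n mulr1].
  apply: (ler_cvg_to cv (Dlim_cvg hb hn1)); near=> p.
  have p0 : 0 < p.1 by near: p; exact: near_scale_gt0.
  rewrite mulrCA ler_wpM2l ?sqr_ge0 // -psumZ psum_le // => v hv.
  have x0 : 0 < p.1 * bar v by rewrite mulr_gt0 // mulr_gt0.
  case: (boolP (p.1 * bar v <= 1)) => hx; rewrite ?mulr0 ?mulr1; last first.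
    by rewrite mulr_ge0 ?mulr_ge0 ?n1_ge0 ?(ltW p0) // ltW // mu_gt0.
  have -> : p.1 * n1 v = C^-1 * (p.1 * bar v) by rewrite /bar; field; rewrite gt_eqF.
  rewrite invfM -mulrA ler_pM2l ?invr_gt0 // /mu.
  move: (p.1 * bar v) x0 hx => x x0 hx.
  rewrite ler_pdivlMr ?expR1_gt0 // ler_pdivrMl //.
  have h1 : expR x - 1 <= x * expR x.
    have := ler_wpM2r (expR_ge0 x) (expR_ge1Dx (- x)).
    by rewrite -expRD addNr expR0; lra.
  apply: le_trans h1 _; rewrite mulrC ler_pM2r // ler_expR //.
exists (d0 / 4); first by rewrite divr_gt0.
move=> u.
have snu := seminorm_dot u.
apply: (@le_trans _ _ (n1 u / 4 * Dlim bar (@n1 R))).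
  rewrite mulrAC [leRHS]mulrAC; apply: ler_wpM2r => //.
  by rewrite [leRHS]mulrC; apply: ler_wpM2r => //; exact: n1_ge0.
have cv : n1 u / 4 * Dfun bar (@n1 R) p @[p --> @scaleF R] --> n1 u / 4 * Dlim bar (@n1 R).
  by apply: cvgM; [exact: cvg_cst|exact: Dlim_cvg].
apply: (ler_cvg_to cv (Dlim_cvg hn snu)); near=> p.
have p0 : 0 < p.1 by near: p; exact: near_scale_gt0.
rewrite /Dfun mulrCA; apply: ler_wpM2l; first exact: sqr_ge0.
apply: (@le_trans _ _ (psum (fun v => p.1 * `|dot u v| * mu (p.1 * bar v)) p.2)); last first.
  apply: psum_le => v hv; apply: ler_wpM2l; first by rewrite mulr_ge0 // ltW.
  apply: mu_anti; first by rewrite mulr_gt0 // (psi_gt0 eta0 low).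
  by rewrite ler_pM2l //; exact: seminorm_le.
rewrite !psumE !big_bool /= mulrDr /sum2 -!big_split /= !mulr_sumr -!big_split /=.
apply: ler_sum => i _; rewrite !mulr_sumr -!big_split /=; apply: ler_sum => j _.
case hp : (prim i j); last by rewrite !mul0r !mulr0 addr0.
rewrite !mul1r /bar -/(vecn R true i j) -/(vecn R false i j) !n1_vecn.
have x0 : 0 < mu (p.1 * (C * (i + j)%:R)).
  apply: mu_gt0; rewrite !mulr_gt0 // ltr0n addn_gt0.
  by move: hp => /andP[-> _].
have := dot_rot_ge u i j; rewrite n1_vecn.
move: (mu _) x0 (dot u _) (dot u _) => M M0 d1 d2 hd.
have := ler_wpM2l (ltW (mulr_gt0 p0 M0)) hd; lra.
Unshelve. all: by end_near.
Qed.

(** A number is at least a total weight divided by the largest weight. Since [psi] is among the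
    tests, each typical weight is at most [expR (- e^-2 (Dlim psi psi - h))]. *)
Lemma typical_card psi (Phi : seq (plane -> R)) (h : R) : is_norm psi -> 0 < h ->
  (forall i, seminorm (nth (@n1 R) Phi i)) ->
  \forall p \near @scaleF R, exists N,
    4^-1 * expR (p.1 ^- 2 * (Ent psi + Dlim psi psi - 2 * h)) <=
    #|[pred m : {ffun idx p.2 -> 'I_N} | ~~ deviates psi (psi :: Phi) h p.1 m]|%:R.
Proof.
move=> hn h0 hP; case: (hn) => sn [eta eta0 low].
have hP' i : seminorm (nth (@n1 R) (psi :: Phi) i) by case: i => //= i.
have [c c0 H] := concentration hn h0 hP'.
have nS := cvgr_dist_le _ _ (Ent_cvg hn) _ h0.
near=> p.
have p0 : 0 < p.1 by near: p; exact: near_scale_gt0.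
have K : forall N, \sum_(m : {ffun idx p.2 -> 'I_N} | deviates psi (psi :: Phi) h p.1 m)
      expR (- (p.1 * mdot psi m)) <= expR (p.1 ^- 2 * (Sfun psi p - c)).
  by near: p.
have dS : `|Ent psi - Sfun psi p| <= h by near: p; exact: nS.
have pm : p.1 < Num.min 1 (c / 3).
  by near: p; apply: near_scale_lt; rewrite lt_min ltr01 divr_gt0.
move: pm; rewrite lt_min => /andP[q1 q2].
have ei : 0 < p.1 ^- 2 by rewrite invr_gt0 exprn_gt0.
have [N hN] := weight_sum_ge p.2 eta0 low p0; exists N.
rewrite -surjective_pairing in hN.
set W := expR (p.1 ^- 2 * Sfun psi p) in hN.
have W0 : 0 < W by exact: expR_gt0.
(* Half of the full weight survives truncation, and at most a quarter of it deviates because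
   [expR (e^-2 c) >= 4]. *)
have hdev : \sum_(m : {ffun idx p.2 -> 'I_N} | deviates psi (psi :: Phi) h p.1 m)
      expR (- (p.1 * mdot psi m)) <= 4^-1 * W.
  apply: le_trans (K N) _; rewrite mulrBr expRD mulrC ler_pM2r // expRN.
  rewrite lef_pV2 ?posrE ?expR_gt0 //; apply: le_trans (expR_ge1Dx _).
  suff : 3 <= p.1 ^- 2 * c by lra.
  rewrite ler_pdivlMl ?exprn_gt0 //.
  have : p.1 ^+ 2 <= p.1 by rewrite expr2 ler_piMl // ltW.
  by lra.
rewrite (bigID (fun m : {ffun idx p.2 -> 'I_N} => deviates psi (psi :: Phi) h p.1 m)) /= in hN.
have typ : 4^-1 * W <= \sum_(m : {ffun idx p.2 -> 'I_N} | ~~ deviates psi (psi :: Phi) h p.1 m)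
      expR (- (p.1 * mdot psi m)) by lra.
have each : \sum_(m : {ffun idx p.2 -> 'I_N} | ~~ deviates psi (psi :: Phi) h p.1 m)
      expR (- (p.1 * mdot psi m)) <=
    #|[pred m : {ffun idx p.2 -> 'I_N} | ~~ deviates psi (psi :: Phi) h p.1 m]|%:R *
      expR (- (p.1 ^- 2 * (Dlim psi psi - h))).
  rewrite mulr_natl -sumr_const; apply: ler_sum => m.
  rewrite /deviates /= negb_or -leNgt ler_distl => /andP[/andP[h1 _] _].
  rewrite ler_expR lerN2 ler_pdivrMl ?exprn_gt0 //.
  by apply: le_trans h1 _; rewrite le_eqVlt; apply/orP; left; apply/eqP; ring.
have := le_trans typ each; rewrite expRN ler_pdivlMr ?expR_gt0 // => hh.
apply: le_trans hh; rewrite -mulrA /W -expRD ler_pM2l // ler_expR -mulrDr ler_pM2l //.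
by move: dS; rewrite ler_norml => /andP[]; lra.
Unshelve. all: by end_near.
Qed.

End Typical.

(** * Zonotopes as intersections of half-planes *)

Section Zonotopes.
Variable R : realType.
Local Notation plane := 'rV[R]_2.
Implicit Types (x y z u v c t : plane) (s : seq plane) (A K P : set plane).

Definition conv_closed A := forall x y (k : R), A x -> A y -> 0 <= k <= 1 ->
  A ((1 - k) *: x + k *: y).

Lemma convex_setP A : convex_set A -> conv_closed A.
Proof.
move=> h x y k Ax Ay /andP[k0 k1].
have := h y x (Itv01 k0 k1); rewrite !inE => /(_ Ay Ax).
by rewrite addrC.
Qed.

Lemma dotDr u x y : dot u (x + y) = dot u x + dot u y.
Proof. by rewrite /dot !mxE; ring. Qed.
Lemma dotBr u x y : dot u (x - y) = dot u x - dot u y.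
Proof. by rewrite /dot !mxE; ring. Qed.
Lemma dotZr u (k : R) x : dot u (k *: x) = k * dot u x.
Proof. by rewrite /dot !mxE; ring. Qed.
Lemma dotDl u u' x : dot (u + u') x = dot u x + dot u' x.
Proof. by rewrite /dot !mxE; ring. Qed.
Lemma dotBl u u' x : dot (u - u') x = dot u x - dot u' x.
Proof. by rewrite /dot !mxE; ring. Qed.
Lemma dotNl u x : dot (- u) x = - dot u x.
Proof. by rewrite /dot !mxE; ring. Qed.
Lemma dotZl (k : R) u x : dot (k *: u) x = k * dot u x.
Proof. by rewrite /dot !mxE; ring. Qed.
Lemma dot0r u : dot u 0 = 0.
Proof. by rewrite /dot !mxE; ring. Qed.

Lemma dot_subZ u w (k : R) :
  dot (u - k *: w) (u - k *: w) = dot u u - 2 * (k * dot u w) + k * (k * dot w w).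
Proof. by rewrite /dot !mxE; ring. Qed.

Lemma dot_continuous u : continuous (dot u).
Proof.
have h (k : R) i : continuous (fun v : plane => k * v 0 i).
  move=> x; have c : {for x, continuous (fun v : plane => v 0 i)}.
    exact: coord_continuous.
  exact: (@cvgMl_tmp R _ _ _ _ k _ c).
by move=> x; exact: (cvgD (h (u 0 0) 0 x) (h (u 0 1) 1 x)).
Qed.

(** The separating direction is [x - b] with [b] a point of [A] nearest to [x], and the gap is the
    squared distance. *)
Lemma compact_sep A x : compact A -> conv_closed A -> A !=set0 -> ~ A x ->
  exists u (d : R), 0 < d /\ forall a, A a -> dot u a + d <= dot u x.
Proof.
move=> cA cvA A0 nAx.
have cont : continuous (fun a : plane => dot (x - a) (x - a)).
  move=> a; have c i : continuous (fun a : plane => (x - a) 0 i).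
    move=> b; rewrite /continuous_at.
    have -> : (fun a0 : plane => (x - a0) 0 i) = (fun a0 : plane => x 0 i - a0 0 i).
      by apply: funext => b'; rewrite !mxE.
    have c : {for b, continuous (fun v : plane => v 0 i)} by exact: coord_continuous.
    by rewrite !mxE; apply: (cvgB _ c); exact: cvg_cst.
  exact: (cvgD (cvgM (c 0 a) (c 0 a)) (cvgM (c 1 a) (c 1 a))).
have [b bA bmin] := EVT_min_rV A0 cA (continuous_subspaceT cont).
rewrite inE in bA; set u := x - b; exists u, (dot u u).
have u0 : 0 < dot u u.
  rewrite lt_neqAle; apply/andP; split; last first.
    by rewrite /dot -!expr2 addr_ge0 // sqr_ge0.
  apply/eqP => h; apply: nAx; suff <- : b = x by [].
  have h1 : u 0 0 = 0 /\ u 0 1 = 0.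
    move: h; rewrite /dot; move: (u 0 0) (u 0 1) => p q /esym/eqP.
    rewrite -!expr2 paddr_eq0 ?sqr_ge0 // !sqrf_eq0 => /andP[/eqP -> /eqP ->].
    by [].
  have : u = 0 by apply: planeP; rewrite [RHS]mxE; case: h1.
  by move=> /subr0_eq.
split=> // a Aa.
suff : dot u (a - b) <= 0 by rewrite dotBr -/u /u dotBr; lra.
rewrite leNgt; apply/negP => hpos.
(* A step from [b] towards [a] short enough that the first-order decrease of the distance beats the
   quadratic term, against the choice of [b]. *)
set w := a - b; have [k k01 hk] : exists2 k : R, 0 < k <= 1 & k * dot w w < dot u w.
  have w0 : 0 <= dot w w by rewrite /dot -!expr2 addr_ge0 // sqr_ge0.
  exists (Num.min 1 (dot u w / (dot w w + 1) / 2)).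
    by rewrite lt_min ltr01 ge_min lexx /= !divr_gt0 //; lra.
  apply: (@le_lt_trans _ _ (dot u w / (dot w w + 1) / 2 * dot w w)).
    by apply: ler_wpM2r => //; rewrite ge_min lexx orbT.
  rewrite mulrAC ltr_pdivrMr // mulrAC ltr_pdivrMr; last lra.
  by rewrite -/w in hpos; nra.
case/andP: k01 => k0 k1.
have := bmin ((1 - k) *: b + k *: a); rewrite !inE => /(_ (cvA b a k bA Aa _)).
rewrite (ltW k0) k1 => /(_ isT).
have -> : x - ((1 - k) *: b + k *: a) = u - k *: w.
  by rewrite /u /w; apply: planeP; rewrite !mxE; ring.
rewrite -/u dot_subZ.
have : k * (k * dot w w) < k * dot u w by rewrite ltr_pM2l.
have : 0 < k * dot u w by rewrite mulr_gt0.
lra.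
Qed.

Definition zset s : set plane :=
  \big[@minkowski_sum R/[set 0]]_(v <- s) segment 0 v.

Lemma zset_nil : zset [::] = [set 0]. Proof. exact: big_nil. Qed.

Lemma zset_cons v s z : zset (v :: s) z <->
  exists (k : R) y, [/\ 0 <= k <= 1, zset s y & z = k *: v + y].
Proof.
rewrite /zset big_cons -/(zset s); split.
  move=> [a [k /=]]; rewrite in_itv /= => k01 <- [y sy <-].
  by exists k, y; rewrite scaler0 add0r.
move=> [k [y [k01 sy ->]]]; exists (k *: v); last by exists y.
by exists k; rewrite ?in_itv //= scaler0 add0r.
Qed.

Lemma zset_conv s : conv_closed (zset s).
Proof.
elim: s => [|v s IH] x y k.
  by rewrite zset_nil => -> -> _ /=; rewrite !scaler0 addr0.
move=> /zset_cons[p [a [/andP[p0 p1] sa ->]]] /zset_cons[q [b [/andP[q0 q1] sb ->]]] k01.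
apply/zset_cons; exists ((1 - k) * p + k * q), ((1 - k) *: a + k *: b).
split; [|exact: IH|by apply: planeP; rewrite !mxE; ring].
move: k01 => /andP[k0 k1]; apply/andP; split.
  by apply: addr_ge0; apply: mulr_ge0 => //; lra.
have h1 := ler_wpM2l k0 q1.
have k1' : 0 <= 1 - k by lra.
have h2 := ler_wpM2l k1' p1; lra.
Qed.

Lemma zset_compact s : compact (zset s).
Proof.
elim: s => [|v s IH]; first by rewrite zset_nil; exact: compact_set1.
have -> : zset (v :: s) = (fun p : R * plane => p.1 *: v + p.2) @` (`[0, 1] `*` zset s).
  apply/seteqP; split=> z.
    move=> /zset_cons[k [y [k01 sy ->]]]; exists (k, y) => //.
  move=> [[k y] /= [k01 sy] <-].
  by apply/zset_cons; exists k, y.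
apply: continuous_compact; last by apply: compact_setX => //; exact: segment_compact.
apply: continuous_subspaceT => p.
by apply: cvgD; [apply: cvgZ; [exact: cvg_fst|exact: cvg_cst]|exact: cvg_snd].
Qed.

Definition center s : plane := 2^-1 *: \sum_(v <- s) v.
(** The full width in direction [u]: [zset s] is symmetric about [center s], and its support
    function from there is half of this. *)
Definition wd s u : R := \sum_(v <- s) `|dot u v|.

Lemma center_cons v s : center (v :: s) = 2^-1 *: v + center s.
Proof. by rewrite /center big_cons scalerDr. Qed.

Lemma wd_cons v s u : wd (v :: s) u = `|dot u v| + wd s u.
Proof. by rewrite /wd big_cons. Qed.

Lemma wd_ge0 s u : 0 <= wd s u.
Proof. by apply: sumr_ge0 => v _. Qed.

Lemma wd_cat s s' u : wd (s ++ s') u = wd s u + wd s' u.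
Proof. by rewrite /wd big_cat. Qed.

Lemma wd_scale (k : R) s u : 0 <= k -> wd [seq k *: v | v <- s] u = k * wd s u.
Proof.
move=> k0; rewrite /wd big_map mulr_sumr; apply: eq_bigr => v _.
by rewrite dotZr normrM ger0_norm.
Qed.

Lemma zset_dot_le s z u : zset s z -> dot u (z - center s) <= wd s u / 2.
Proof.
elim: s z => [|v s IH] z.
  rewrite zset_nil => ->; rewrite /center /wd !big_nil scaler0 subrr dot0r mul0r.
  exact: lexx.
move=> /zset_cons[k [y [/andP[k0 k1] sy ->]]]; rewrite center_cons wd_cons.
have := IH _ sy; rewrite !dotBr !dotDr !dotZr.
have : (k - 2^-1) * dot u v <= `|dot u v| / 2.
  apply: le_trans (ler_norm _) _; rewrite normrM mulrC ler_wpM2l //.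
  by rewrite ler_norml; apply/andP; split; lra.
lra.
Qed.

Lemma zset_dot_attained s u : exists2 z, zset s z & dot u (z - center s) = wd s u / 2.
Proof.
elim: s => [|v s [y sy hy]].
  by exists 0; rewrite ?zset_nil // /center /wd !big_nil scaler0 subrr dot0r mul0r.
exists ((0 <= dot u v)%R%:R *: v + y).
  by apply/zset_cons; exists (0 <= dot u v)%R%:R, y; split=> //; case: (0 <= dot u v) => /=; lra.
rewrite center_cons wd_cons opprD addrACA dotDr hy -scalerBl dotZr mulrDl.
by case: (leP 0 (dot u v)) => h /=; [rewrite ger0_norm|rewrite ltr0_norm] => //; lra.
Qed.

Definition body t (w : plane -> R) : set plane := [set x | forall u, dot u (x - t) <= w u / 2].

(** The zonotope attains its width in every direction, so a point outside, being separated from it,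
    violates the inequality in the separating direction. *)
Lemma zset_body c s : [set c + z | z in zset s] = body (c + center s) (wd s).
Proof.
apply/seteqP; split=> x.
  by move=> [z sz <-] u; rewrite addrAC opprD addrA subrr sub0r addrC; exact: zset_dot_le.
move=> h; exists (x - c); last by rewrite addrC subrK.
apply: contrapT => nz.
have [z0 sz0 _] := zset_dot_attained s 0.
have [u [d [d0 hd]]] := compact_sep (@zset_compact s) (@zset_conv s) (ex_intro _ z0 sz0) nz.
have [z sz hz] := zset_dot_attained s u.
have := hd z sz; have := h u; move: hz; rewrite !dotBr dotDr; lra.
Qed.

Lemma zset_center s : zset s (center s).
Proof.
elim: s => [|v s IH]; first by rewrite zset_nil /center big_nil scaler0.
by apply/zset_cons; exists 2^-1, (center s); split; rewrite ?center_cons //; lra.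
Qed.

(** The support function in [u] and [- u] determines both the centre and the width, since widths are
    even. *)
Lemma body_inj c s c' s' : body c (wd s) = body c' (wd s') ->
  c = c' /\ wd s = wd s'.
Proof.
have E t r : body t (wd r) = [set (t - center r) + z | z in zset r].
  by rewrite zset_body subrK.
move=> h.
have at_ t r u : exists2 x, body t (wd r) x & dot u (x - t) = wd r u / 2.
  have [z sz hz] := zset_dot_attained r u; exists (t - center r + z).
    by rewrite E; exists z.
  by rewrite -hz; congr dot; apply: planeP; rewrite !mxE; ring.
have le t r t' r' u : body t (wd r) = body t' (wd r') ->
    dot u t + wd r u / 2 <= dot u t' + wd r' u / 2.
  move=> e; have [x bx hx] := at_ t r u; rewrite e in bx.
  by have := bx u; rewrite -hx !dotBr; lra.
have eq u : dot u c + wd s u / 2 = dot u c' + wd s' u / 2.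
  by apply/eqP; rewrite eq_le !le.
have wN r u : wd r (- u) = wd r u.
  by apply: eq_bigr => v _; rewrite dotNl normrN.
have eq2 u : dot u c = dot u c'.
  by have := eq u; have := eq (- u); rewrite !wN !dotNl; lra.
split; last by apply: funext => u; have := eq u; rewrite eq2; lra.
apply: planeP.
  by have := eq2 (pt 1 0); rewrite /dot !pt0 !pt1 !mul1r !mul0r !addr0.
by have := eq2 (pt 0 1); rewrite /dot !pt0 !pt1 !mul1r !mul0r !add0r.
Qed.

End Zonotopes.

(** * Vertices and edges of a zonotope *)

Section LatticeZonotopes.
Variable R : realType.
Local Notation plane := 'rV[R]_2.
Implicit Types (x y z u v c d t : plane) (s : seq plane) (K P : set plane).

Lemma zonotopeP P : zonotope P -> exists c s, P = [set c + z | z in zset s].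
Proof.
move=> [c [s ->]]; exists (c + \sum_(e <- s) e.1), [seq e.2 - e.1 | e <- s].
suff -> : \big[@minkowski_sum R/[set 0]]_(e <- s) segment e.1 e.2 =
    [set \sum_(e <- s) e.1 + z | z in zset [seq e.2 - e.1 | e <- s]].
  apply/seteqP; split=> x.
    by move=> [_ [z sz <-] <-]; exists z => //; rewrite addrA.
  by move=> [z sz <-]; exists (\sum_(e <- s) e.1 + z); [exists z|rewrite addrA].
elim: s => [|e s IH].
  rewrite !big_nil /= zset_nil; apply/seteqP; split=> x.
    by move=> ->; exists 0; rewrite ?addr0.
  by move=> [z -> <-]; rewrite addr0.
rewrite !big_cons /= IH; apply/seteqP; split=> x.
  move=> [a [k]]; rewrite /= in_itv /= => k01 <- [_ [z sz <-] <-].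
  exists (k *: (e.2 - e.1) + z); first by apply/zset_cons; exists k, z.
  by apply: planeP; rewrite !mxE; ring.
move=> [y /zset_cons[k [z [k01 sz ->]]] <-].
exists ((1 - k) *: e.1 + k *: e.2); first by exists k => //=; rewrite in_itv.
exists (\sum_(e <- s) e.1 + z); first by exists z.
by apply: planeP; rewrite !mxE; ring.
Qed.

Lemma zonotope_zset c s : zonotope [set c + z | z in zset s].
Proof.
exists c, [seq (0, v) | v <- s].
by rewrite /zset big_map.
Qed.

(** The unique maximiser of [dot u] on [zset s] when no generator is orthogonal to [u], hence a
    vertex. *)
Definition top u s : plane := \sum_(v <- s | 0 < dot u v) v.

Lemma top_cons u v s : top u (v :: s) = (0 < dot u v)%R%:R *: v + top u s.
Proof. by rewrite /top big_cons; case: ifP => _; rewrite ?scale1r ?scale0r ?add0r. Qed.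

Lemma zset_top u s : zset s (top u s).
Proof.
elim: s => [|v s IH]; first by rewrite zset_nil /top big_nil.
rewrite top_cons; apply/zset_cons; exists (0 < dot u v)%R%:R, (top u s); split=> //.
by case: (0 < dot u v) => /=; lra.
Qed.

Lemma top_dot u s : dot u (top u s - center s) = wd s u / 2.
Proof.
elim: s => [|v s IH].
  by rewrite /top /center /wd !big_nil scaler0 subrr dot0r mul0r.
rewrite top_cons center_cons wd_cons opprD addrACA dotDr IH -scalerBl dotZr mulrDl.
by case: (ltP 0 (dot u v)) => h /=; [rewrite gtr0_norm|rewrite ler0_norm] => //; lra.
Qed.

Lemma top_unique u s z : zset s z -> all (fun v => dot u v != 0) s ->
  dot u (z - center s) = wd s u / 2 -> z = top u s.
Proof.
elim: s z => [|v s IH] z.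
  by rewrite zset_nil /top big_nil => ->.
move=> /zset_cons[k [y [/andP[k0 k1] sy ->]]] /= /andP[v0 hs].
rewrite center_cons wd_cons top_cons opprD addrACA dotDr -scalerBl dotZr mulrDl => h.
have hy := zset_dot_le u sy.
have hv : (k - 2^-1) * dot u v <= `|dot u v| / 2.
  apply: le_trans (ler_norm _) _; rewrite normrM mulrC ler_wpM2l //.
  by rewrite ler_norml; apply/andP; split; lra.
have e1 : (k - 2^-1) * dot u v = `|dot u v| / 2 by lra.
have e2 : dot u (y - center s) = wd s u / 2 by lra.
rewrite -(IH _ sy hs e2); congr (_ *: _ + _).
case: (ltP 0 (dot u v)) => hd /=.
  move: e1; rewrite gtr0_norm // => e1.
  have : (k - 1) * dot u v = 0 by lra.
  by move/eqP; rewrite mulf_eq0 (negPf v0) orbF subr_eq0 => /eqP.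
move: e1; rewrite ler0_norm // => e1.
have : k * dot u v = 0 by lra.
by move/eqP; rewrite mulf_eq0 (negPf v0) orbF => /eqP.
Qed.

Lemma top_vertex c u s : all (fun v => dot u v != 0) s ->
  vertex [set c + z | z in zset s] (c + top u s).
Proof.
move=> hs; split; first by exists (top u s) => //; exact: zset_top.
move=> _ _ k [x sx <-] [y sy <-] /andP[k0 k1] e.
have eq : top u s = (1 - k) *: x + k *: y.
  apply: (addrI c); rewrite e; apply: planeP; rewrite !mxE; ring.
have hx := zset_dot_le u sx; have hy := zset_dot_le u sy; have ht := top_dot u s.
have e2 : dot u (top u s - center s) =
    (1 - k) * dot u (x - center s) + k * dot u (y - center s).
  by rewrite eq !dotBr dotDr !dotZr; ring.
rewrite ht in e2.
have ex : dot u (x - center s) = wd s u / 2 by nra.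
have ey : dot u (y - center s) = wd s u / 2 by nra.
by rewrite (top_unique sx hs ex) (top_unique sy hs ey).
Qed.

Definition cross d v : R := d 0 0 * v 0 1 - d 0 1 * v 0 0.
Definition perp d : plane := pt (- d 0 1) (d 0 0).

Lemma dot_perp d v : dot (perp d) v = cross d v.
Proof. by rewrite /dot /perp pt0 pt1 /cross; ring. Qed.

Lemma dot_sqr_gt0 d : d != 0 -> 0 < dot d d.
Proof.
move=> d0; rewrite lt_neqAle eq_sym; apply/andP; split; last first.
  by rewrite /dot -!expr2 addr_ge0 // sqr_ge0.
apply: contra d0; rewrite /dot -!expr2 paddr_eq0 ?sqr_ge0 // !sqrf_eq0.
by move=> /andP[/eqP h0 /eqP h1]; apply/eqP; apply: planeP; rewrite [RHS]mxE.
Qed.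

Lemma cross0P d v : d != 0 -> cross d v = 0 -> v = (dot d v / dot d d) *: d.
Proof.
move=> d0 h; have dd := dot_sqr_gt0 d0.
apply: planeP; rewrite !mxE; apply: (mulIf (lt0r_neq0 dd)).
  rewrite mulrAC divfK ?gt_eqF //.
  have : d 0 1 * cross d v = 0 by rewrite h mulr0.
  by rewrite /cross /dot; move: (d 0 0) (d 0 1) (v 0 0) (v 0 1) => p q r w; lra.
rewrite mulrAC divfK ?gt_eqF //.
have : d 0 0 * cross d v = 0 by rewrite h mulr0.
by rewrite /cross /dot; move: (d 0 0) (d 0 1) (v 0 0) (v 0 1) => p q r w; lra.
Qed.

Lemma small_tau d s : exists2 tau : R, 0 < tau &
  forall v, v \in s -> cross d v != 0 -> tau * `|dot d v| < `|cross d v|.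
Proof.
elim: s => [|v s [tau t0 IH]]; first by exists 1.
have p0 : 0 < `|dot d v| + 1 by rewrite ltr_pwDr.
exists (Num.min tau (if cross d v == 0 then 1 else `|cross d v| / (`|dot d v| + 1))).
  rewrite lt_min t0 /=; case: ifPn => // h; by rewrite divr_gt0 // normr_gt0.
move=> w; rewrite inE => /orP[/eqP ->|ws] h.
  rewrite (negPf h); apply: (@le_lt_trans _ _ (`|cross d v| / (`|dot d v| + 1) * `|dot d v|)).
    by apply: ler_wpM2r => //; rewrite ge_min lexx orbT.
  rewrite mulrAC ltr_pdivrMr // ltr_pM2l ?normr_gt0 //; lra.
apply: le_lt_trans (IH w ws h); apply: ler_wpM2r => //.
by rewrite ge_min lexx.
Qed.

(* Sum of the generators parallel to [d], oriented along [d]: an edge of the zonotope. *)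
Definition Sd d s : plane := \sum_(v <- s | cross d v == 0) Num.sg (dot d v) *: v.

(** Tilt the normal [perp d] slightly to both sides. Generators not parallel to [d] keep the sign
    given by [perp d] in both tilts and cancel; the parallel ones change sides. So the edge vector
    in direction [d] is a difference of two vertices. *)
Lemma top_diff d s : d != 0 -> all (fun v => v != 0) s -> exists u1 u2,
  [/\ all (fun v => dot u1 v != 0) s, all (fun v => dot u2 v != 0) s &
      top u1 s - top u2 s = Sd d s].
Proof.
move=> d0 hs; have [tau t0 ht] := small_tau d s.
exists (perp d + tau *: d), (perp d - tau *: d).
have dE v : (dot (perp d + tau *: d) v = cross d v + tau * dot d v) *
            (dot (perp d - tau *: d) v = cross d v - tau * dot d v).
  by rewrite dotBl dotDl dotZl dot_perp.
have par v : v != 0 -> cross d v = 0 -> dot d v != 0.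
  move=> v0 h; apply: contra v0 => /eqP e.
  by rewrite (cross0P d0 h) e mul0r scale0r.
have big v : v \in s -> cross d v != 0 ->
    (0 < cross d v) = (0 < cross d v + tau * dot d v) /\
    (0 < cross d v) = (0 < cross d v - tau * dot d v) /\
    cross d v + tau * dot d v != 0 /\ cross d v - tau * dot d v != 0.
  move=> vs hv; have := ht v vs hv.
  have -> : tau * `|dot d v| = `|tau * dot d v| by rewrite normrM gtr0_norm.
  move: (tau * dot d v) => r.
  case: (ltP 0 (cross d v)) => hc.
    rewrite (gtr0_norm hc) ltr_norml => /andP[r1 r2].
    by rewrite !lt0r_neq0; [repeat split; apply/esym|..]; lra.
  rewrite (ler0_norm hc) ltr_norml => /andP[r1 r2].
  by rewrite !ltr0_neq0; [repeat split; apply/esym/negbTE; rewrite -leNgt|..]; lra.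
split.
- apply/allP => v vs; rewrite dE; case: (eqVneq (cross d v) 0) => h.
    by rewrite h add0r; apply: mulf_neq0; [exact: lt0r_neq0|exact: par (allP hs _ vs) h].
  by have [_ [_ []]] := big v vs h.
- apply/allP => v vs; rewrite dE; case: (eqVneq (cross d v) 0) => h.
    by rewrite h sub0r oppr_eq0; apply: mulf_neq0; [exact: lt0r_neq0|exact: par (allP hs _ vs) h].
  by have [_ [_ []]] := big v vs h.
rewrite /top /Sd [X in X - _]big_mkcond [X in _ - X]big_mkcond [RHS]big_mkcond -sumrB /=.
rewrite !big_seq; apply: eq_bigr => v vs; rewrite !dE.
case: (eqVneq (cross d v) 0) => h.
  rewrite h add0r sub0r; have := par v (allP hs _ vs) h.
  rewrite neq_lt => /orP[hd|hd].
    have a1 : (0 < tau * dot d v) = false by apply/negbTE; rewrite -leNgt; rewrite nmulr_lle0 // ltW.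
    have a2 : 0 < - (tau * dot d v) by rewrite -mulrN mulr_gt0 // oppr_gt0.
    by rewrite a1 a2 sub0r ltr0_sg // scaleN1r.
  have a1 : 0 < tau * dot d v by rewrite mulr_gt0.
  have a2 : (0 < - (tau * dot d v)) = false by apply/negbTE; rewrite -leNgt oppr_le0 ltW.
  by rewrite a1 a2 subr0 gtr0_sg // scale1r.
have [<- [<- _]] := big v vs h.
by case: ifP => _; rewrite ?subrr.
Qed.

End LatticeZonotopes.

(** * Lattice generators of lattice zonotopes *)

Section LatticeRepresentation.
Variable R : realType.
Local Notation plane := 'rV[R]_2.
Implicit Types (x y z u v c d t : plane) (s : seq plane) (K P : set plane).

Lemma latticeP n x : scaled_lattice n x <->
  exists p q : int, x = n%:R^-1 *: pt p%:~R q%:~R.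
Proof.
split=> [[z _ <-]|[p [q ->]]].
  exists (z 0 0), (z 0 1); congr (_ *: _).
  by apply: planeP; rewrite !mxE.
exists (\row_j (if j == 0 then p else q)) => //; congr (_ *: _).
by apply: planeP; rewrite !mxE.
Qed.

Lemma latticeD n x y : scaled_lattice n x -> scaled_lattice n y -> scaled_lattice n (x + y).
Proof.
move=> /latticeP[p [q ->]] /latticeP[p' [q' ->]]; apply/latticeP.
exists (p + p'), (q + q'); rewrite -scalerDr; congr (_ *: _).
by apply: planeP; rewrite !mxE /= intrD.
Qed.

Lemma latticeN n x : scaled_lattice n x -> scaled_lattice n (- x).
Proof.
move=> /latticeP[p [q ->]]; apply/latticeP.
exists (- p), (- q); rewrite -scalerN; congr (_ *: _).
by apply: planeP; rewrite !mxE /= intrN.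
Qed.

Lemma lattice0 n : scaled_lattice n (0 : plane).
Proof.
by apply/latticeP; exists 0, 0; apply: planeP; rewrite !mxE /= mulr0.
Qed.

Lemma lattice_Sd n c s d : all (fun v => v != 0) s ->
  vertex [set c + z | z in zset s] `<=` scaled_lattice n -> scaled_lattice n (Sd d s).
Proof.
move=> hs hv; case: (eqVneq d 0) => [->|d0].
  rewrite /Sd big1; first exact: lattice0.
  by move=> v _; rewrite /dot !mxE !mul0r addr0 sgr0 scale0r.
have [u1 [u2 [h1 h2 <-]]] := top_diff d0 hs.
have -> : top u1 s - top u2 s = (c + top u1 s) - (c + top u2 s).
  by apply: planeP; rewrite !mxE; ring.
by apply: latticeD; [|apply: latticeN]; apply: hv; exact: top_vertex.
Qed.

Lemma wd_filter0 s u : wd [seq v <- s | v != 0] u = wd s u.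
Proof.
rewrite /wd big_filter big_mkcond; apply: eq_bigr => v _.
by case: eqVneq => //= ->; rewrite dot0r normr0.
Qed.

Lemma center_filter0 s : center [seq v <- s | v != 0] = center s.
Proof.
rewrite /center big_filter big_mkcond; congr (_ *: _); apply: eq_bigr => v _.
by case: eqVneq.
Qed.

(** Single generators may lie off the lattice, but the sum of a class of parallel generators,
    oriented alike, is an edge and so a lattice vector. Merging such classes one by one preserves
    all widths. *)
Lemma lattice_generators n s : all (fun v => v != 0) s ->
  (forall d, scaled_lattice n (Sd d s)) ->
  exists L : seq plane, [/\ wd L = wd s, all (fun v => v != 0) L &
    forall v, v \in L -> scaled_lattice n v].
Proof.
have [k] := ubnP (size s); elim: k s => // k IH s hk hs hl.
case: s hk hs hl => [|d s0]; first by move=> _ _ _; exists [::].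
set s := d :: s0 => hk hs hl; have d0 : d != 0 by move: hs => /andP[].
have dd := dot_sqr_gt0 d0.
pose s' := [seq v <- s | cross d v != 0].
have hs' : all (fun v => v != 0) s' by rewrite all_filter; apply/allP => v vs; apply/implyP => _; exact: (allP hs).
have cd : cross d d = 0 by rewrite /cross; ring.
have size' : (size s' < k)%N.
  rewrite /s' /s /= cd eqxx /= size_filter.
  by apply: leq_ltn_trans (count_size _ _) _; rewrite -ltnS.
(* Removing the class of [d] empties the classes parallel to [d] and leaves all others unchanged. *)
have hl' d' : scaled_lattice n (Sd d' s').
  case: (eqVneq d' 0) => [->|d'0].
    rewrite /Sd big1; first exact: lattice0.
    by move=> v _; rewrite /dot !mxE !mul0r addr0 sgr0 scale0r.
  have pp v : cross d' v = 0 -> v = (dot d' v / dot d' d') *: d' by exact: cross0P.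
  have cZ k' : cross d (k' *: d') = k' * cross d d' by rewrite /cross !mxE; ring.
  case: (eqVneq (cross d d') 0) => hdd.
    rewrite (_ : Sd d' s' = 0); first exact: lattice0.
    rewrite /Sd /s' big_filter_cond big1 // => v /andP[h1 /eqP h2].
    by move: h1; rewrite (pp v h2) cZ hdd mulr0 eqxx.
  rewrite (_ : Sd d' s' = Sd d' s) //.
  rewrite /Sd /s' big_filter_cond big_seq_cond [RHS]big_seq_cond; apply: eq_bigl => v.
  case vs : (v \in s) => //=; case: (eqVneq (cross d' v) 0) => h; rewrite ?andbF ?andbT //.
  rewrite (pp v h) cZ mulf_neq0 //; apply: contraTneq (allP hs _ vs) => h0.
  by rewrite (pp v h) h0 scale0r eqxx.
pose al := \sum_(v <- s | cross d v == 0) `|dot d v| / dot d d.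
have SdE : Sd d s = al *: d.
  rewrite /Sd /al scaler_suml; apply: eq_bigr => v /eqP hv.
  by rewrite {2}(cross0P d0 hv) scalerA normrEsg mulrA.
have al1 : 1 <= al.
  rewrite /al /s big_cons cd eqxx ger0_norm ?(ltW dd) // divff ?gt_eqF // lerDl.
  by apply: sumr_ge0 => v _; rewrite divr_ge0 // ltW.
have [L' [w' n' l']] := IH s' size' hs' hl'.
exists (Sd d s :: L'); split.
- apply: funext => u; rewrite wd_cons w' /wd /s' big_filter.
  rewrite [RHS](bigID (fun v => cross d v == 0)) /=; congr (_ + _).
  rewrite SdE dotZr normrM ger0_norm; last by lra.
  rewrite /al mulr_suml; apply: eq_bigr => v /eqP hv.
  rewrite {2}(cross0P d0 hv) dotZr normrM normrM normfV.
  by rewrite (ger0_norm (ltW dd)).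
- by rewrite /= n' andbT SdE scaler_eq0 negb_or d0 andbT gt_eqF //; lra.
- by move=> v; rewrite inE => /orP[/eqP ->|/l'].
Qed.

(** Divide by the gcd and turn by a multiple of a right angle into the closed first quadrant; a half
    turn is recorded by [sg], a quarter turn by [si]. *)
Lemma nat_int_vec (p q : int) : (p, q) != (0, 0) ->
  exists (sg : R) k (si : bool) a b, [/\ `|sg| = 1, (0 < k)%N, prim a b &
    pt p%:~R q%:~R = (sg * k%:R) *: vecn R si a b].
Proof.
move=> h.
have key (a b : nat) : (0 < a)%N -> exists k a' b', [/\ (0 < k)%N, prim a' b', a = (k * a')%N & b = (k * b')%N].
  move=> a0; pose g := gcdn a b; have g0 : (0 < g)%N by rewrite gcdn_gt0 a0.
  have ea : (g * (a %/ g))%N = a by rewrite mulnC divnK // dvdn_gcdl.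
  have eb : (g * (b %/ g))%N = b by rewrite mulnC divnK // dvdn_gcdr.
  exists g, (a %/ g)%N, (b %/ g)%N; split=> //.
  rewrite /prim divn_gt0 // dvdn_leq ?dvdn_gcdl //= /coprime.
  by rewrite -(eqn_pmul2l g0) muln_gcdr ea eb muln1.
have mk (sg : R) si (a b : nat) : `|sg| = 1 -> (0 < a)%N -> pt p%:~R q%:~R = sg *: vecn R si a b ->
    exists (sg : R) k (si : bool) a b, [/\ `|sg| = 1, (0 < k)%N, prim a b &
    pt p%:~R q%:~R = (sg * k%:R) *: vecn R si a b].
  move=> s1 a0 ->; have [k [a' [b' [k0 pr -> ->]]]] := key a b a0.
  by exists sg, k, si, a', b'; rewrite vecnM scalerA.
case: p q h mk => [[|a]|a] [[|b]|b] h mk //.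
- by apply: (mk 1 false b.+1 0%N); rewrite ?normr1 //; apply: planeP; rewrite !mxE /= ?oppr0 ?mulr0 ?mul1r.
- by apply: (mk (-1) false b.+1 0%N); rewrite ?normrN ?normr1 //; apply: planeP; rewrite !mxE /= ?NegzE ?oppr0 ?mulr0 ?mulN1r ?intrN.
- by apply: (mk 1 true a.+1 0%N); rewrite ?normr1 //; apply: planeP; rewrite !mxE /= ?oppr0 ?mulr0 ?mul1r.
- by apply: (mk 1 true a.+1 b.+1); rewrite ?normr1 //; apply: planeP; rewrite !mxE /= ?mul1r.
- by apply: (mk (-1) false b.+1 a.+1); rewrite ?normrN ?normr1 //; apply: planeP; rewrite !mxE /= ?NegzE ?mulN1r ?opprK ?intrN.
- by apply: (mk (-1) true a.+1 0%N); rewrite ?normrN ?normr1 //; apply: planeP; rewrite !mxE /= ?NegzE ?mulr0 ?mulN1r ?intrN.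
- by apply: (mk 1 false b.+1 a.+1); rewrite ?normr1 //; apply: planeP; rewrite !mxE /= ?NegzE ?mul1r ?intrN.
- by apply: (mk (-1) true a.+1 b.+1); rewrite ?normrN ?normr1 //; apply: planeP; rewrite !mxE /= ?NegzE ?mulN1r ?intrN.
Qed.

End LatticeRepresentation.

(** * Lattice zonotopes as pairs of a centre and a multiplicity family *)

Section Encoding.
Variable R : realType.
Local Notation plane := 'rV[R]_2.
Implicit Types (x y z u v c d t : plane) (s : seq plane) (K P : set plane).

Definition wm (n : nat) B N (m : {ffun idx B -> 'I_N}) u : R :=
  n%:R^-1 * mdot (fun v => `|dot u v|) m.

Definition glist (n : nat) B N (m : {ffun idx B -> 'I_N}) : seq plane :=
  [seq (n%:R^-1 * (m i)%:R) *: vec R i | i <- index_enum (idx B)].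

Lemma wd_glist n B N (m : {ffun idx B -> 'I_N}) : wd (glist n m) = wm n m.
Proof.
apply: funext => u; rewrite /wd /glist big_map /wm /mdot mulr_sumr.
by apply: eq_bigr => i _; rewrite dotZr normrM ger0_norm ?mulr_ge0 ?invr_ge0 // mulrA.
Qed.

Lemma sum_glist n B N (m : {ffun idx B -> 'I_N}) (psi : plane -> R) : seminorm psi ->
  \sum_(v <- glist n m) psi v = n%:R^-1 * mdot psi m.
Proof.
move=> h; rewrite /glist big_map /mdot mulr_sumr; apply: eq_bigr => i _.
by rewrite seminormZ // ger0_norm ?mulr_ge0 ?invr_ge0 // mulrA.
Qed.

Lemma n1_dot v : n1 v = `|dot (pt 1 0) v| + `|dot (pt 0 1) v|.
Proof. by rewrite /n1 /dot !pt0 !pt1 !mul1r !mul0r addr0 add0r. Qed.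

Lemma sum_n1_wd s : \sum_(v <- s) n1 v = wd s (pt 1 0) + wd s (pt 0 1).
Proof.
by rewrite /wd -big_split /=; apply: eq_bigr => v _; rewrite n1_dot.
Qed.

(** Each generator is [k / n] times a signed primitive vector and adds [k] to its multiplicity. The
    sign is invisible to the width. *)
Lemma generators_to_mult n B (L : seq plane) : (0 < n)%N ->
  all (fun v => v != 0) L -> (forall v, v \in L -> scaled_lattice n v) ->
  (forall v, v \in L -> n%:R * n1 v < B%:R) ->
  exists m : {ffun idx B -> nat}, forall u,
    wd L u = n%:R^-1 * \sum_i (m i)%:R * `|dot u (vec R i)|.
Proof.
move=> n0; have nR : 0 < (n%:R : R) by rewrite ltr0n.
elim: L => [|v L IH] hL hl hB.
  exists [ffun=> 0%N] => u; rewrite /wd big_nil big1 ?mulr0 // => i _.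
  by rewrite ffunE mul0r.
move: hL => /= /andP[v0 hL].
have [m hm] := IH hL (fun w hw => hl w ltac:(by rewrite inE hw orbT))
  (fun w hw => hB w ltac:(by rewrite inE hw orbT)).
have /latticeP[p [q vE]] := hl v ltac:(by rewrite inE eqxx).
have pq : (p, q) != (0, 0).
  apply: contra v0 => /eqP[p0 q0]; apply/eqP; rewrite vE p0 q0.
  by apply: planeP; rewrite !mxE /= mulr0.
have [sg [k [si [a [b [sg1 k0 pr eq]]]]]] := nat_int_vec R pq.
have hn1 : n%:R * n1 v = (k * (a + b))%:R.
  rewrite vE eq scalerA (seminormZ _ _ (@seminorm_n1 R)) n1_vecn.
  rewrite !normrM sg1 mul1r normfV !ger0_norm // natrM mulrA mulrA mulfV ?gt_eqF //.
  by rewrite mul1r.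
have abB : (a + b < B)%N.
  have := hB v ltac:(by rewrite inE eqxx); rewrite hn1 ltr_nat.
  by apply: leq_ltn_trans; rewrite leq_pmull.
have aB : (a < B)%N by apply: leq_ltn_trans abB; rewrite leq_addr.
have bB : (b < B)%N by apply: leq_ltn_trans abB; rewrite leq_addl.
have i0P : (si, Ordinal aB, Ordinal bB) \in primset B by rewrite inE.
pose i0 : idx B := exist (fun i => i \in primset B) _ i0P.
exists [ffun i => (m i + (i == i0) * k)%N] => u.
rewrite wd_cons hm.
have -> : `|dot u v| = n%:R^-1 * \sum_i ((i == i0) * k)%:R * `|dot u (vec R i)|.
  rewrite (bigD1 i0) //= eqxx mul1n big1 ?addr0; last first.
    by move=> i /negPf ->; rewrite mul0n mul0r.
  by rewrite vE eq scalerA dotZr !normrM sg1 mul1r normfV !normr_nat mulrA.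
rewrite -mulrDr -big_split /=; congr (_ * _); apply: eq_bigr => i _.
by rewrite ffunE natrD mulrDl addrC.
Qed.

Lemma wd_le_radius c s (Rad : R) u : (forall x, (exists2 z, zset s z & c + z = x) -> n1 x <= Rad) ->
  n1 u <= 1 -> wd s u <= 2 * Rad.
Proof.
move=> hR hu.
have [z1 s1 e1] := zset_dot_attained s u; have [z2 s2 e2] := zset_dot_attained s (- u).
have wN : wd s (- u) = wd s u by apply: eq_bigr => v _; rewrite dotNl normrN.
have b x : n1 x <= Rad -> `|dot u x| <= Rad.
  move=> hx; apply: le_trans (dot_le _ _) _; apply: le_trans hx.
  by rewrite ler_piMl ?n1_ge0.
have b1 := b _ (hR _ (ex_intro2 _ _ _ s1 erefl)).
have b2 := b _ (hR _ (ex_intro2 _ _ _ s2 erefl)).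
move: e1 e2 b1 b2; rewrite wN dotNl !dotBr !dotDr !ler_norml.
by move=> e1 e2 /andP[_ ?] /andP[? _]; lra.
Qed.

(** The generators of a zonotope in [K] have total [n1]-length at most [4 Rad]. In lattice units
    this is less than [B], which bounds the coordinates of the primitive vectors as well as their
    multiplicities. *)
Lemma lattice_zonotope_encoding K n P B (Rad : R) : lattice_zonotopes K n P ->
  (0 < n)%N -> (forall x, K x -> n1 x <= Rad) -> 4 * Rad * n%:R < B%:R ->
  exists t (m : {ffun idx B -> 'I_B}),
    [/\ P = body t (wm n m), scaled_lattice n (2 *: t) & K t].
Proof.
move=> [zP PK vP] n0 hR hB; have nR : 0 < (n%:R : R) by rewrite ltr0n.
have [c [s0 PE]] := zonotopeP zP.
pose s := [seq v <- s0 | v != 0].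
have hs : all (fun v => v != 0) s by exact: filter_all.
have PE' : P = [set c + z | z in zset s].
  rewrite PE !zset_body center_filter0; congr body.
  by apply: funext => u; rewrite wd_filter0.
have lat d : scaled_lattice n (Sd d s) by apply: (lattice_Sd (c := c) d hs); rewrite -PE'.
have [L [LE hL lL]] := lattice_generators hs lat.
have hR' x : (exists2 z, zset s z & c + z = x) -> n1 x <= Rad.
  by move=> h; apply/hR/PK; rewrite PE'.
have w1 : wd s (pt 1 0) <= 2 * Rad.
  by apply: wd_le_radius hR' _; rewrite /n1 pt0 pt1 normr1 normr0 addr0.
have w2 : wd s (pt 0 1) <= 2 * Rad.
  by apply: wd_le_radius hR' _; rewrite /n1 pt0 pt1 normr1 normr0 add0r.
have totL : \sum_(v <- L) n1 v <= 4 * Rad by rewrite sum_n1_wd LE; lra.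
have LB v : v \in L -> n%:R * n1 v < B%:R.
  move=> vL; apply: le_lt_trans hB; rewrite mulrC ler_pM2r //.
  apply: le_trans totL; rewrite (big_rem v) //= lerDl sumr_ge0 // => w _.
  exact: n1_ge0.
have [m hm] := generators_to_mult n0 hL lL LB.
have tot : \sum_i (m i)%:R * n1 (vec R i) <= n%:R * (4 * Rad).
  have -> : \sum_i (m i)%:R * n1 (vec R i) = n%:R * \sum_(v <- L) n1 v.
    rewrite sum_n1_wd !hm -mulrDr mulrA mulfV ?gt_eqF // mul1r -big_split /=.
    by apply: eq_bigr => i _; rewrite n1_dot mulrDr.
  by rewrite ler_pM2l.
have mB i : (m i < B)%N.
  rewrite -(ltr_nat R); apply: le_lt_trans hB; rewrite [leRHS]mulrC.
  apply: le_trans tot; rewrite (bigD1 i) //=; apply: (@le_trans _ _ ((m i)%:R * n1 (vec R i))).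
    rewrite ler_peMr // n1_vecn ler1n addn_gt0.
    by have /andP[-> _] := idxP i.
  by rewrite lerDl sumr_ge0 // => j _; rewrite mulr_ge0 ?n1_ge0.
exists (c + center s), [ffun i => Ordinal (mB i)].
have -> : wm n [ffun i => Ordinal (mB i)] = wd s.
  apply: funext => u; rewrite -LE hm /wm /mdot; congr (_ * _); apply: eq_bigr => i _.
  by rewrite ffunE.
split; [by rewrite PE' zset_body| |]; last first.
  by apply: PK; rewrite PE'; exists (center s) => //; exact: zset_center.
have e0 : (pt 1 0 : plane) != 0.
  by apply/eqP => /(congr1 (fun v : plane => v 0 0)); rewrite pt0 mxE => /eqP; rewrite oner_eq0.
have [u [_ [hu _ _]]] := top_diff e0 hs.
have hu' : all (fun v => dot (- u) v != 0) s.
  by apply: sub_all hu => v; rewrite dotNl oppr_eq0.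
(* For generic [u] the maximisers in [u] and [- u] are opposite vertices, so the centre is half a
   lattice point. *)
have -> : 2 *: (c + center s) = (c + top u s) + (c + top (- u) s).
  rewrite scalerDr; have <- : top u s + top (- u) s = 2 *: center s.
    rewrite /center scalerA mulfV ?pnatr_eq0 // scale1r.
    elim: (s) hu => [|v r IH]; first by rewrite /top !big_nil addr0.
    move=> /= /andP[v0 hr]; rewrite !top_cons addrACA IH // big_cons; congr (_ + _).
    rewrite -scalerDl dotNl oppr_gt0; move: v0; rewrite neq_lt.
    by case: (ltgtP (dot u v) 0) => //= h _; rewrite ?addr0 ?add0r scale1r.
  by apply: planeP; rewrite !mxE; ring.
by apply: latticeD; apply: vP; rewrite PE'; exact: top_vertex.
Qed.

(** An extreme point has coefficient 0 or 1 on each nonzero generator: with [0 < k < 1] it lies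
    between [y] and [v + y], and extremality makes [k v] vanish. *)
Lemma extreme_lattice n s z : (forall v, v \in s -> scaled_lattice n v) -> zset s z ->
  (forall x y (k : R), zset s x -> zset s y -> 0 < k < 1 ->
    z = (1 - k) *: x + k *: y -> x = z /\ y = z) -> scaled_lattice n z.
Proof.
elim: s z => [|v s IH] z hs.
  by rewrite zset_nil => -> _; exact: lattice0.
move=> /zset_cons[k [y [/andP[k0 k1] sy zE]]] ext.
have ly : scaled_lattice n y.
  apply: IH => //; first by move=> w ws; apply: hs; rewrite inE ws orbT.
  move=> a b l sa sb l01 e.
  have k01 : 0 <= k <= 1 by rewrite k0.
  have [] := ext (k *: v + a) (k *: v + b) l.
  - by apply/zset_cons; exists k, a.
  - by apply/zset_cons; exists k, b.
  - exact: l01.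
  - by rewrite zE e; apply: planeP; rewrite !mxE; ring.
  by rewrite zE => /addrI -> /addrI ->.
have lv : scaled_lattice n v by apply: hs; rewrite inE eqxx.
rewrite zE; apply: latticeD => //.
case: (eqVneq k 0) => [->|kn0]; first by rewrite scale0r; exact: lattice0.
case: (eqVneq k 1) => [->|kn1]; first by rewrite scale1r.
have [] := ext y (v + y) k.
- by apply/zset_cons; exists 0, y; rewrite scale0r add0r lexx ler01.
- by apply/zset_cons; exists 1, y; rewrite scale1r lexx ler01.
- by rewrite !lt_neqAle k0 k1 kn1 eq_sym kn0.
- by rewrite zE; apply: planeP; rewrite !mxE; ring.
move=> e _; have -> : k *: v = 0 by apply: (addIr y); rewrite -zE add0r.
exact: lattice0.
Qed.

Lemma glist_lattice_zonotope K n B N (m : {ffun idx B -> 'I_N}) c :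
  scaled_lattice n c -> body (c + center (glist n m)) (wm n m) `<=` K ->
  lattice_zonotopes K n (body (c + center (glist n m)) (wm n m)).
Proof.
move=> lc hK; rewrite -wd_glist -zset_body in hK *; split=> //.
  exact: zonotope_zset.
move=> _ [[z sz <-] ext]; apply: latticeD => //; apply: (@extreme_lattice _ (glist n m)) => //.
  move=> v /mapP[i _ ->]; apply/latticeP; rewrite -scalerA.
  rewrite /vec /vecn; case: (val i).1.1.
    exists ((m i)%:Z * ((val i).1.2)%:Z), ((m i)%:Z * ((val i).2)%:Z); congr (_ *: _).
    by apply: planeP; rewrite !mxE /= intrM.
  exists (- ((m i)%:Z * ((val i).2)%:Z)), ((m i)%:Z * ((val i).1.2)%:Z); congr (_ *: _).
  by apply: planeP; rewrite !mxE /= ?intrN intrM // mulrN.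
move=> x y k sx sy k01 e.
have [] := ext (c + x) (c + y) k.
- by exists x.
- by exists y.
- exact: k01.
- by rewrite e; apply: planeP; rewrite !mxE; ring.
by move=> /addrI -> /addrI ->.
Qed.

(** Parallel primitive vectors are equal up to sign, and the indexed vectors all lie in one
    half-plane containing no opposite pair. *)
Lemma cross_vec_neq0 B (i j : idx B) : i != j -> cross (vec R i) (vec R j) != 0.
Proof.
apply: contra => /eqP h; apply/eqP; apply: val_inj; move: h (idxP i) (idxP j).
rewrite /vec; case: (val i) (val j) => [[si a] b] [[sj a'] b'] /=.
rewrite /cross /vecn => h /andP[a0 c1] /andP[a'0 c2].
have a0R : 0 < ((a : nat)%:R : R) by rewrite ltr0n.
have a0R' : 0 < ((a' : nat)%:R : R) by rewrite ltr0n.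
have b0R : 0 <= ((b : nat)%:R : R) by [].
have b0R' : 0 <= ((b' : nat)%:R : R) by [].
have same : (a * b' = a' * b)%N -> a = a' /\ b = b'.
  move=> e.
  have d1 : (a %| a')%N by rewrite -(Gauss_dvdl a' c1) -e dvdn_mulr.
  have d2 : (a' %| a)%N by rewrite -(Gauss_dvdl a c2) e dvdn_mulr.
  have ea : (a : nat) = a' by apply/eqP; rewrite eqn_dvd d1 d2.
  split; first exact: val_inj.
  by apply: val_inj; apply/eqP; rewrite -(eqn_pmul2l a0) e ea.
have p1 := mulr_gt0 a0R a0R'; have p2 := mulr_ge0 b0R b0R'.
case: si sj h => [] []; rewrite !pt0 !pt1 => h.
- have [|-> ->] // := same; apply/eqP; rewrite -(eqr_nat R) !natrM; apply/eqP; lra.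
- by exfalso; lra.
- by exfalso; lra.
- have [|-> ->] // := same; apply/eqP; rewrite -(eqr_nat R) !natrM; apply/eqP; lra.
Qed.

(** The width has a kink at [perp d] caused only by the generator parallel to [d]. The second
    difference with a small step [tau] vanishes for every other generator and so reads off the
    multiplicity of [d]. *)
Lemma wm_inj n B N (m m' : {ffun idx B -> 'I_N}) : (0 < n)%N -> wm n m = wm n m' -> m = m'.
Proof.
move=> n0 e; have nR : 0 < (n%:R : R) by rewrite ltr0n.
have e' u : mdot (fun v => `|dot u v|) m = mdot (fun v => `|dot u v|) m'.
  by apply: (mulfI (lt0r_neq0 (etrans (invr_gt0 _) nR))); exact: (congr1 (@^~ u) e).
apply/ffunP => i; apply: val_inj => /=.
set d := vec R i.
have d0 : d != 0.
  by apply/eqP => h; have := n1_vec_gt0 R i; rewrite -/d h /n1 !mxE normr0 addr0 ltxx.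
have dd := dot_sqr_gt0 d0.
have [tau t0 ht] := small_tau d [seq vec R j | j <- index_enum (idx B)].
have val_ (k : {ffun idx B -> 'I_N}) :
    mdot (fun v => `|dot (perp d + tau *: d) v|) k +
    mdot (fun v => `|dot (perp d - tau *: d) v|) k -
    2 * mdot (fun v => `|dot (perp d) v|) k = (k i)%:R * (2 * tau * dot d d).
  rewrite /mdot mulr_sumr -big_split -sumrB (bigD1 i) //= big1 ?addr0; last first.
    move=> j ji; rewrite dotBl dotDl dotZl dot_perp.
    have c0 : cross d (vec R j) != 0 by apply: cross_vec_neq0; rewrite eq_sym.
    have := ht (vec R j); rewrite map_f ?mem_index_enum // => /(_ isT c0).
    have -> : tau * `|dot d (vec R j)| = `|tau * dot d (vec R j)| by rewrite normrM gtr0_norm.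
    move: (tau * _) (cross d _) => r x h.
    suff e2 : `|x + r| + `|x - r| = 2 * `|x|.
      have -> : `|x + r| = 2 * `|x| - `|x - r| by lra.
      by ring.
    case: (leP 0 x) => hx; move: h.
      rewrite (ger0_norm hx) ltr_norml => /andP[r1 r2].
      by rewrite !ger0_norm; lra.
    rewrite (ltr0_norm hx) ltr_norml => /andP[r1 r2].
    by rewrite !ltr0_norm; lra.
  rewrite dotBl dotDl dotZl dot_perp -/d.
  have -> : cross d d = 0 by rewrite /cross; ring.
  rewrite add0r sub0r normrN normr0 mulr0 gtr0_norm ?mulr_gt0 //; ring.
have := val_ m; rewrite !e' val_ => /mulIf; rewrite !mulf_neq0 ?gt_eqF // => /(_ isT).
by move/eqP; rewrite eqr_nat => /eqP.
Qed.

End Encoding.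

(** * Existence of a minimising norm and its first order condition *)

Section DualProblem.
Variable R : realType.
Local Notation plane := 'rV[R]_2.
Implicit Types (x y z u v c t : plane) (s : seq plane) (psi phi : plane -> R).

Lemma finite_net (d : R) : 0 < d -> exists F : seq plane,
  forall x, n1 x <= 1 -> exists2 y, y \in F & n1 (x - y) <= d.
Proof.
move=> d0; pose N := (Num.truncn (2 / d)).+1.
have N0 : 0 < (N%:R : R) by rewrite ltr0n.
have Nd : 2 / d <= N%:R by exact/ltW/truncnS_gt.
pose g (i : nat) : R := i%:R / N%:R - 1.
exists [seq pt (g i) (g j) | i <- iota 0 (2 * N).+1, j <- iota 0 (2 * N).+1].
have ap (r : R) : `|r| <= 1 -> exists2 i, i \in iota 0 (2 * N).+1 & `|r - g i| <= N%:R^-1.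
  rewrite ler_norml => /andP[r1 r2]; have p : 0 <= N%:R * (r + 1) by rewrite mulr_ge0 //; lra.
  exists (Num.truncn (N%:R * (r + 1))).
    rewrite mem_iota leq0n add0n ltnS /= truncn_le_nat.
    have le : N%:R * (r + 1) <= (2 * N)%:R by rewrite natrM mulrC ler_pM2r //; lra.
    by apply: le_lt_trans le _; rewrite ltr_nat.
  have /andP[t1 t2] := truncn_itv p; move: t1 t2; rewrite -natr1 /g.
  move: (Num.truncn _)%:R => T t1 t2.
  rewrite ler_norml; apply/andP; split; rewrite -(ler_pM2l N0) ?mulrN mulfV ?gt_eqF //.
    by rewrite !mulrBr mulrCA divff ?gt_eqF //; lra.
  by rewrite !mulrBr mulrCA divff ?gt_eqF //; lra.
move=> x; rewrite /n1 => hx.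
have := normr_ge0 (x 0 0); have := normr_ge0 (x 0 1) => a1 a0.
have [i hi di] : exists2 i, i \in iota 0 (2 * N).+1 & `|x 0 0 - g i| <= N%:R^-1 by apply: ap; lra.
have [j hj dj] : exists2 i, i \in iota 0 (2 * N).+1 & `|x 0 1 - g i| <= N%:R^-1 by apply: ap; lra.
exists (pt (g i) (g j)); first by apply/allpairsP; exists (i, j).
rewrite /n1 !mxE /=; apply: le_trans (lerD di dj) _.
have -> : N%:R^-1 + N%:R^-1 = 2 / N%:R :> R by rewrite mulrDl mul1r.
by rewrite ler_pdivrMr // mulrC -ler_pdivrMr.
Qed.

Lemma ultra_bounded_cvg (U : set_system nat) (f : nat -> R) (M : R) :
  UltraFilter U -> (forall k, 0 <= f k <= M) -> exists l : R, f k @[k --> U] --> l.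
Proof.
move=> UU hf.
have cp : compact (`[0, M] : set R) by exact: segment_compact.
have [] := cp (f k @[k --> U]) _ _.
  by rewrite /nbhs /=; apply: filterE => k /=; rewrite in_itv /= hf.
move=> l [_ cl]; exists l => A nA.
have [//|] := in_ultra_setVsetC (f @^-1` A) UU.
move=> hn; have [y [hy hA]] := cl (~` A) A hn nA.
by case: hy.
Qed.

Lemma small_coef (a c s1 : R) : 0 <= c -> 0 < s1 ->
  (forall s : R, 0 <= s <= s1 -> 0 <= s * a + c * s ^+ 2) -> 0 <= a.
Proof.
move=> c0 s0 h; rewrite leNgt; apply/negP => a0.
pose s := Num.min s1 (- a / (2 * (c + 1))).
have sp : 0 < s by rewrite lt_min s0 divr_gt0 //; lra.
have s2 : s * (2 * (c + 1)) <= - a by rewrite -ler_pdivlMr ?ge_min ?lexx ?orbT //; lra.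
have := h s; rewrite (ltW sp) ge_min lexx => /(_ isT).
have -> : s * a + c * s ^+ 2 = s * (a + c * s) by ring.
rewrite pmulr_rge0 // => h2; lra.
Qed.

Lemma gg1_gt0 : 0 < gg (1 : R).
Proof.
rewrite /gg oppr_gt0 ln_lt0 //; apply/andP; split; first exact: expRN1_gt0.
by rewrite ltrBlDr ltrDl expR_gt0.
Qed.

Variable K : set plane.
Variables (x0 : plane) (r0 Rad : R).
Hypothesis r0_gt0 : 0 < r0.
Hypothesis K_ball : forall x, n1 (x - x0) <= r0 -> K x.
Hypothesis K_rad : forall x, K x -> n1 x <= Rad.

Definition feas c s := [set c + z | z in zset s] `<=` K.

Definition Lam psi : R :=
  sup [set r | exists c s, feas c s /\ r = \sum_(v <- s) psi v].

Lemma Kx0 : K x0.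
Proof. by apply: K_ball; rewrite subrr /n1 !mxE normr0 addr0 ltW. Qed.

Lemma feas_n1 c s : feas c s -> \sum_(v <- s) n1 v <= 4 * Rad.
Proof.
move=> h; rewrite sum_n1_wd.
have hR x : (exists2 z, zset s z & c + z = x) -> n1 x <= Rad by move=> hx; apply/K_rad/h.
have w1 : wd s (pt 1 0) <= 2 * Rad.
  by apply: wd_le_radius hR _; rewrite /n1 pt0 pt1 normr1 normr0 addr0.
have w2 : wd s (pt 0 1) <= 2 * Rad.
  by apply: wd_le_radius hR _; rewrite /n1 pt0 pt1 normr1 normr0 add0r.
lra.
Qed.

Lemma feas_nil : feas x0 [::].
Proof. by move=> x [z]; rewrite zset_nil => -> <-; rewrite addr0; exact: Kx0. Qed.

Lemma Lam_has_sup psi : seminorm psi ->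
  has_sup [set r | exists c s, feas c s /\ r = \sum_(v <- s) psi v].
Proof.
move=> sn; split; first by exists 0, x0, [::]; rewrite big_nil; split=> //; exact: feas_nil.
exists (sbound psi * (4 * Rad)) => _ [c [s [h ->]]].
apply: le_trans (ler_wpM2l (sbound_ge0 sn) (feas_n1 h)).
by rewrite mulr_sumr; apply: ler_sum => v _; exact: seminorm_le.
Qed.

Lemma Lam_ub psi c s : seminorm psi -> feas c s -> \sum_(v <- s) psi v <= Lam psi.
Proof.
move=> sn h; apply: sup_upper_bound; first exact: Lam_has_sup.
by exists c, s.
Qed.

Lemma Lam_le psi (X : R) :
  (forall c s, feas c s -> \sum_(v <- s) psi v <= X) -> Lam psi <= X.
Proof.
move=> h; apply: ge_sup.
  by exists 0, x0, [::]; rewrite big_nil; split=> //; exact: feas_nil.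
by move=> _ [c [s [hs ->]]]; exact: h hs.
Qed.

Lemma Lam_ge0 psi : seminorm psi -> 0 <= Lam psi.
Proof. by move=> sn; have := Lam_ub sn feas_nil; rewrite big_nil. Qed.

Lemma Lam_addZ psi phi (k : R) : seminorm psi -> seminorm phi -> 0 <= k ->
  Lam (fun v => psi v + k * phi v) <= Lam psi + k * Lam phi.
Proof.
move=> s1 s2 k0; apply: Lam_le => c s h; rewrite big_split /= -mulr_sumr.
by apply: lerD; [exact: Lam_ub h|apply: ler_wpM2l => //; exact: Lam_ub h].
Qed.

Lemma Lam_Z psi (k : R) : seminorm psi -> 0 <= k ->
  Lam (fun v => k * psi v) <= k * Lam psi.
Proof.
move=> sn k0; apply: Lam_le => c s h; rewrite -mulr_sumr.
by apply: ler_wpM2l => //; exact: Lam_ub h.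
Qed.

(** [K] contains a segment of [n1]-length [r0] in the direction of [v]. Hence a bound on [Lam psi]
    bounds [psi] from above. *)
Lemma Lam_ge psi v : seminorm psi -> r0 * psi v <= n1 v * Lam psi.
Proof.
move=> sn; case: (eqVneq (n1 v) 0) => [h|nv].
  by rewrite (n1_eq0 h) seminorm0 // mulr0 /n1 !mxE normr0 addr0 mul0r.
have np : 0 < n1 v by rewrite lt_neqAle eq_sym nv n1_ge0.
have h : feas x0 [:: (r0 / n1 v) *: v].
  move=> x [z /zset_cons[k [y [/andP[k0 k1] + ->]]] <-].
  rewrite zset_nil => ->; apply: K_ball.
  rewrite addr0 addrC addKr scalerA (seminormZ _ _ (@seminorm_n1 R)).
  rewrite ger0_norm; last by rewrite mulr_ge0 // divr_ge0 // ltW.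
  by rewrite -mulrA divfK // ler_piMl // ltW.
have := Lam_ub sn h; rewrite big_seq1 (seminormZ _ _ sn).
rewrite ger0_norm; last by rewrite divr_ge0 // ltW.
by rewrite mulrAC ler_pdivrMr // [_ * n1 v]mulrC.
Qed.

Definition Jfun psi := Lam psi + Ent psi.

(* [Lam] bounds a minimising sequence from above and [Ent] bounds it away from
   degenerate seminorms; its pointwise limit along an ultrafilter is the minimiser. *)
Lemma Jfun_minimizer : exists2 psi, is_norm psi & forall phi, is_norm phi -> Jfun psi <= Jfun phi.
Proof.
pose A := [set Jfun psi | psi in [set psi | is_norm psi]].
have J_ge0 psi : is_norm psi -> 0 <= Jfun psi.
  by move=> h; rewrite addr_ge0 ?Ent_ge0 // Lam_ge0 //; case: h.
have n1n : is_norm (@n1 R).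
  by split; [exact: seminorm_n1|exists 1 => // x; rewrite mul1r].
have hA : has_inf A.
  split; first by exists (Jfun (@n1 R)), (@n1 R).
  by exists 0 => _ [psi h <-]; exact: J_ge0.
set j := inf A.
have jle psi : is_norm psi -> j <= Jfun psi.
  by move=> h; apply: ge_inf; [case: hA|exists psi].
have j0 : 0 <= j by apply: lb_le_inf; [case: hA|move=> _ [psi h <-]; exact: J_ge0].
have ex (k : nat) : exists psi, is_norm psi /\ Jfun psi < j + k.+1%:R^-1.
  have k0 : 0 < (k.+1%:R : R)^-1 by rewrite invr_gt0 ltr0n.
  by have [_ [psi h <-] hlt] := inf_adherent k0 hA; exists psi.
have [f hf] := choice ex.
have fn k : is_norm (f k) by case: (hf k).
have fs k : seminorm (f k) by case: (fn k).
have fJ k : Jfun (f k) <= j + 1.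
  case: (hf k) => _ /ltW h; apply: le_trans h _; rewrite lerD2l.
  by rewrite invf_le1 ?ler1n // ltr0n.
pose C := (j + 1) / r0.
have C0 : 0 < C by rewrite divr_gt0 //; lra.
have fC k v : f k v <= C * n1 v.
  have := @Lam_ge (f k) v (fs k); rewrite -ler_pdivlMl // => h.
  apply: le_trans h _; rewrite /C mulrAC mulrC ler_pM2r ?invr_gt0 // mulrC.
  rewrite ler_wpM2r ?n1_ge0 //; apply: le_trans (fJ k).
  by rewrite /Jfun lerDl Ent_ge0.
clearbody C.
have n1e1 : n1 (pt 1 0 : plane) = 1 by rewrite /n1 pt0 pt1 normr1 normr0 addr0.
have n1e2 : n1 (pt 0 1 : plane) = 1 by rewrite /n1 pt0 pt1 normr1 normr0 add0r.
have fsb k : sbound (f k) <= 2 * C.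
  by have := fC k (pt 1 0); have := fC k (pt 0 1); rewrite n1e1 n1e2 /sbound; lra.
(* From [Ent_lower] at the direction [v] with [eta' = f k v / n1 v], using [Ent (f k) <= j + 1] and
   [sbound (f k) <= 2 C]. *)
pose eta := gg 1 / (32 * C * (j + 1)).
have j1 : 0 < j + 1 by lra.
have eta0 : 0 < eta.
  by apply: divr_gt0; [exact: gg1_gt0|apply: mulr_gt0 => //; apply: mulr_gt0 => //; lra].
have flow k v : eta * n1 v <= f k v.
  case: (eqVneq (n1 v) 0) => [->|nv]; first by rewrite mulr0 seminorm_ge0.
  have np : 0 < n1 v by rewrite lt_neqAle eq_sym nv n1_ge0.
  have fp : 0 < f k v by case: (fn k) => _ [e e0 /psi_gt0 h]; exact: h.
  have sp : 0 < sbound (f k).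
    rewrite -(pmulr_lgt0 _ np); apply: lt_le_trans fp _.
    exact: seminorm_le.
  rewrite -ler_pdivlMr //.
  have := @Ent_lower R (f k) (f k v / n1 v) v (fn k) (divr_gt0 fp np) np.
  rewrite divfK ?gt_eqF // => /(_ (lexx _)) h.
  have h2 : gg 1 * (16 * (f k v / n1 v) * sbound (f k))^-1 <= j + 1.
    apply: le_trans h (le_trans _ (fJ k)).
    by rewrite /Jfun lerDr Lam_ge0.
  have q0 : 0 < f k v / n1 v by rewrite divr_gt0.
  have X0 : 0 < 16 * (f k v / n1 v) * sbound (f k).
    by apply: mulr_gt0 => //; apply: mulr_gt0.
  rewrite (ler_pdivrMr _ _ X0) in h2.
  rewrite /eta ler_pdivrMr ?mulr_gt0 ?ltr0n //; apply: le_trans h2 _.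
  have -> : f k v / n1 v * (32 * C * (j + 1)) =
     (j + 1) * (16 * (f k v / n1 v) * (2 * C)) by ring.
  by rewrite ler_pM2l // ler_pM2l //; exact: mulr_gt0.
clearbody eta.
have [U [UU oU]] := @ultraFilterLemma nat \oo _.
have flim w : exists l : R, f k w @[k --> U] --> l.
  by apply: (ultra_bounded_cvg (M := C * n1 w) UU) => j'; rewrite seminorm_ge0 ?fC.
have [psi hpsi] := choice flim.
have UP : ProperFilter U by exact: ultra_proper.
have le2 (g h : nat -> R) (a b : R) : g k @[k --> U] --> a -> h k @[k --> U] --> b ->
    (forall k, g k <= h k) -> a <= b.
  by move=> ga hb gh; apply: (ler_cvg_to ga hb); exact: filterE.
have low : coercive eta psi.
  by move=> v; apply: (le2 (fun=> eta * n1 v) _ _ _ _ (hpsi v)) => //; exact: cvg_cst.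
have sn : seminorm psi.
  split.
  - move=> x y; apply: (le2 _ _ _ _ (hpsi (x + y)) (cvgD (hpsi x) (hpsi y))) => k.
    by case: (fs k).
  - move=> k x k0; apply: (cvg_unique _ (hpsi (k *: x))); first exact: norm_hausdorff.
    have -> : (fun n => f n (k *: x)) = (fun n => k * f n x).
      by apply: funext => n; case: (fs n) => _ h _; rewrite h.
    by apply: cvgM; [exact: cvg_cst|exact: hpsi].
  - move=> x; apply: (cvg_unique _ (hpsi (- x))); first exact: norm_hausdorff.
    have -> : (fun n => f n (- x)) = (fun n => f n x).
      by apply: funext => n; case: (fs n).
    exact: hpsi.
have hn : is_norm psi by split=> //; exists eta.
exists psi => // phi hphi; apply: le_trans (jle _ hphi).
have psb : sbound psi <= 2 * C.
  apply: (le2 _ (fun=> 2 * C) _ _ (cvgD (hpsi (pt 1 0)) (hpsi (pt 0 1)))); first exact: cvg_cst.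
  by move=> k; exact: fsb.
(* Pointwise convergence becomes a bound in all directions at once: it is checked on a finite net,
   extended by the common Lipschitz constant [2 C], and made relative by [eta <= psi] on the unit
   sphere. *)
have clos (d : R) : 0 < d -> U [set k | forall v, f k v <= (1 + d) * psi v].
  move=> d0; pose e := d * eta / (8 * (C + 1)).
  have e0 : 0 < e by rewrite divr_gt0 ?mulr_gt0 //; lra.
  have [F hF] := finite_net e0.
  have near_F : U [set k | forall y, y \in F -> f k y <= psi y + d * eta / 4].
    elim: {hF} F => [|y F IH]; first by apply: filterE.
    have q0 : 0 < d * eta / 4 by rewrite divr_gt0 // mulr_gt0.
    have h : U [set k | `|psi y - f k y| <= d * eta / 4].
      exact: (cvgr_dist_le _ _ (hpsi y) _ q0).
    apply: filterS2 h IH => k /= h IH z; rewrite inE => /orP[/eqP ->|]; last exact: IH.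
    by move: h; rewrite ler_distl => /andP[]; lra.
  apply: filterS near_F => k /= hk v.
  case: (eqVneq (n1 v) 0) => [h|nv].
    by rewrite (n1_eq0 h) !seminorm0 // mulr0.
  have np : 0 < n1 v by rewrite lt_neqAle eq_sym nv n1_ge0.
  pose x := (n1 v)^-1 *: v.
  have xv : v = n1 v *: x by rewrite /x scalerA mulfV // scale1r.
  have nx : n1 x = 1.
    by rewrite /x (seminormZ _ _ (@seminorm_n1 R)) gtr0_norm ?invr_gt0 // mulVf.
  suff h : f k x <= (1 + d) * psi x.
    rewrite xv; case: (fs k) => _ -> //; last exact: ltW.
    case: sn => _ -> //; last exact: ltW.
    by rewrite mulrCA ler_pM2l.
  have [y yF hy] := hF x ltac:(by rewrite nx).
  have h1 := seminorm_lip x y (fs k); have h2 := hk y yF.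
  have h3 := seminorm_lip y x sn.
  have ny : n1 (y - x) = n1 (x - y).
    by case: (@seminorm_n1 R) => _ _ <-; rewrite opprB.
  rewrite ny in h3.
  have e1 : 2 * C * e <= d * eta / 4.
    rewrite /e mulrA ler_pdivrMr; last lra.
    by have := mulr_gt0 d0 eta0; move: (d * eta) => q q0; nra.
  have h4 : sbound (f k) * n1 (x - y) <= d * eta / 4.
    apply: le_trans e1; apply: ler_pM; rewrite ?n1_ge0 ?sbound_ge0 //.
  have h5 : sbound psi * n1 (x - y) <= d * eta / 4.
    apply: le_trans e1; apply: ler_pM; rewrite ?n1_ge0 ?sbound_ge0 //.
  have h6 : d * eta <= d * psi x by rewrite ler_pM2l //; have := low x; rewrite nx mulr1.
  have q0 := mulr_gt0 d0 eta0; lra.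
(* [Lam] is a supremum, so one zonotope at a time suffices, and its [psi]-length is a limit of
   [f k]-lengths. For the entropy, [f k <= (1 + d) psi] with monotonicity and homogeneity gives the
   needed lower bound on [Ent (f k)]. *)
have key (d : R) c s : 0 < d -> feas c s ->
    \sum_(v <- s) psi v + (1 + d) ^- 2 * Ent psi <= j + 2 * d.
  move=> d0 hs.
  have cs : \sum_(v <- s) f k v @[k --> U] --> \sum_(v <- s) psi v.
    elim: {hs} s => [|v s IH].
      by rewrite big_nil; under eq_fun do rewrite big_nil; exact: cvg_cst.
    rewrite big_cons; under eq_fun do rewrite big_cons.
    by apply: cvgD => //; exact: hpsi.
  have n1' : U [set k | `|\sum_(v <- s) psi v - \sum_(v <- s) f k v| <= d].
    exact: (cvgr_dist_le _ _ cs _ d0).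
  have n2 := clos d d0.
  have n3 : U [set k | k.+1%:R^-1 <= d].
    apply: oU; exists (Num.truncn d^-1) => // k /= hk.
    rewrite -[leRHS]invrK lef_pV2 ?posrE ?invr_gt0 ?ltr0n //.
    by apply: ltW; apply: lt_le_trans (truncnS_gt _) _; rewrite ler_nat ltnS.
  have [k [[h1 h2] h3]] := filter_ex (filterI (filterI n1' n2) n3).
  have h4 := Lam_ub (fs k) hs.
  have h5 : (1 + d) ^- 2 * Ent psi <= Ent (f k).
    rewrite -(@Ent_homo R psi (1 + d) hn ltac:(lra)).
    apply: Ent_anti => //; apply: is_normZ => //; lra.
  have h6 : Lam (f k) + Ent (f k) <= j + d.
    by case: (hf k) => _ /ltW h; apply: le_trans h _; rewrite lerD2l.
  by move: h1; rewrite /= ler_distl => /andP[_ h1]; lra.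
have E0 := Ent_ge0 hn.
rewrite /Jfun -lerBrDr; apply: Lam_le => c s hs; rewrite lerBrDr.
apply/ler_addgt0Pr => e e0.
pose d := Num.min 1 (e / (2 + 3 * Ent psi)).
have D0 : 0 < 2 + 3 * Ent psi by lra.
have d0 : 0 < d by rewrite lt_min ltr01 divr_gt0.
have d1 : d <= 1 by rewrite ge_min lexx.
have d2 : d * (2 + 3 * Ent psi) <= e.
  by rewrite -ler_pdivlMr // ge_min lexx orbT.
have := key d c s d0 hs.
have h : 1 - 3 * d <= (1 + d) ^- 2.
  rewrite -div1r ler_pdivlMr ?exprn_gt0 //; last lra.
  by rewrite expr2; nra.
have := ler_wpM2r E0 h; lra.
Qed.

(** Compare [psi] with [psi + s phi] and with [(1 - s) psi] for small [s > 0]; [Lam] is sublinear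
    and [Ent] has a quadratic error, so [small_coef] isolates the linear terms. *)
Lemma first_order psi : is_norm psi -> (forall phi, is_norm phi -> Jfun psi <= Jfun phi) ->
  (forall phi, seminorm phi -> Dlim psi phi <= Lam phi) /\ Dlim psi psi = Lam psi.
Proof.
move=> hn hmin; have sn : seminorm psi by case: hn.
have h1 phi : seminorm phi -> Dlim psi phi <= Lam phi.
  move=> sp; have [c [s0 [c0 s00 ht]]] := Ent_taylor hn sp.
  rewrite -subr_ge0; apply: (@small_coef _ c s0) => // s hs.
  have s0' : 0 <= s by case/andP: hs.
  have hn' : is_norm (fun v => psi v + s * phi v) by apply: is_normD => //; exact: seminormM.
  have := hmin _ hn'; rewrite /Jfun.
  have := ht s hs; have := Lam_addZ sn sp s0'; lra.
split=> //; apply/eqP; rewrite eq_le h1 //=.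
have [c c0 ht] := Ent_taylor_self hn.
rewrite -subr_ge0; apply: (@small_coef _ c (1 / 8)) => [//||s hs]; first lra.
have /andP[s0 s1] := hs.
have hn' : is_norm (fun v => (1 - s) * psi v) by apply: is_normZ => //; lra.
have := hmin _ hn'; rewrite /Jfun.
have := ht s hs; have := @Lam_Z psi (1 - s) sn ltac:(lra); lra.
Qed.

End DualProblem.

(** * A translate of the zonoid of mean widths inside [K] *)

Section Minimax.
Variable R : realType.
Local Notation plane := 'rV[R]_2.
Implicit Types (x y z u v c t : plane) (s : seq plane) (phi : plane -> R).

Lemma zset_cat s s' z : zset (s ++ s') z ->
  exists z1 z2, [/\ zset s z1, zset s' z2 & z = z1 + z2].
Proof.
elim: s z => [|v s IH] z /=.
  by move=> h; exists 0, z; rewrite zset_nil add0r.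
move=> /zset_cons[k [y [k01 /IH[z1 [z2 [h1 h2 ->]]] ->]]].
by exists (k *: v + z1), z2; rewrite addrA; split=> //; apply/zset_cons; exists k, z1.
Qed.

Lemma zset_scale (k : R) s z : zset [seq k *: v | v <- s] z ->
  exists2 z1, zset s z1 & z = k *: z1.
Proof.
elim: s z => [|v s IH] z /=.
  by rewrite zset_nil => ->; exists 0; rewrite ?zset_nil // scaler0.
move=> /zset_cons[l [y [l01 /IH[z1 h1 ->] ->]]].
exists (l *: v + z1); first by apply/zset_cons; exists l, z1.
by rewrite scalerDr !scalerA mulrC.
Qed.

(** Second-order upper bound for the penalty, the square of the positive part; the linear
    coefficient is its derivative. *)
Lemma sqr_pos_le (a b k : R) :
  Num.max (a - k * b) 0 ^+ 2 <= Num.max a 0 ^+ 2 - 2 * (k * (Num.max a 0 * b)) + k ^+ 2 * b ^+ 2.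
Proof.
have e : k ^+ 2 * b ^+ 2 = (k * b) ^+ 2 by ring.
have -> : k * (Num.max a 0 * b) = Num.max a 0 * (k * b) by ring.
rewrite e; move: (k * b) => c.
have c2 := sqr_ge0 c.
case: (leP a 0) => ha; case: (leP (a - c) 0) => hc.
- by rewrite expr0n /=; lra.
- by nra.
- by have := sqr_ge0 (a - c); lra.
- by lra.
Qed.

Variable psi : plane -> R.
Hypothesis psi_norm : is_norm psi.

Definition Du u : R := Dlim psi (fun v => `|dot u v|).

Lemma Du_lip u u' : Du u <= Du u' + Dlim psi (@n1 R) * n1 (u - u').
Proof.
have s1 := seminorm_dot u'; have s2 := @seminorm_n1 R.
have s3 := seminormM (n1_ge0 (u - u')) s2.
rewrite [_ * n1 _]mulrC -(DlimZ _ psi_norm s2) -(DlimD psi_norm s1 s3).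
apply: Dlim_le => //; [exact: seminorm_dot|exact: seminormD|].
move=> v; have -> : dot u v = dot u' v + dot (u - u') v by rewrite dotBl; ring.
by apply: le_trans (ler_normD _ _) _; rewrite lerD2l dot_le.
Qed.

Lemma Du_ge0 u : 0 <= Du u.
Proof. by apply: Dlim_ge0 => //; exact: seminorm_dot. Qed.

Lemma DuZ (k : R) u : 0 <= k -> Du (k *: u) = k * Du u.
Proof.
move=> k0; rewrite /Du -DlimZ //; last exact: seminorm_dot.
by congr Dlim; apply: funext => v; rewrite dotZl normrM ger0_norm.
Qed.

Lemma seminorm_sum (r : seq plane) (al : plane -> R) : (forall u, 0 <= al u) ->
  seminorm (fun v => \sum_(u <- r) al u * `|dot u v|).
Proof.
move=> a0; elim: r => [|u r IH].
  by split=> [x y|k x k0|x]; rewrite !big_nil ?addr0 ?mulr0.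
have -> : (fun v => \sum_(u <- u :: r) al u * `|dot u v|) =
    (fun v => al u * `|dot u v| + \sum_(u <- r) al u * `|dot u v|).
  by apply: funext => v; rewrite big_cons.
by apply: seminormD => //; apply: seminormM => //; exact: seminorm_dot.
Qed.

Lemma Dlim_sum (r : seq plane) (al : plane -> R) : (forall u, 0 <= al u) ->
  Dlim psi (fun v => \sum_(u <- r) al u * `|dot u v|) = \sum_(u <- r) al u * Du u.
Proof.
move=> a0; elim: r => [|u r IH].
  rewrite big_nil; have -> : (fun v => \sum_(u <- [::]) al u * `|dot u v|) =
      (fun v => 0 * n1 v) by apply: funext => v; rewrite big_nil mul0r.
  by rewrite DlimZ ?mul0r //; exact: seminorm_n1.
have -> : (fun v => \sum_(u <- u :: r) al u * `|dot u v|) =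
    (fun v => al u * `|dot u v| + \sum_(u <- r) al u * `|dot u v|).
  by apply: funext => v; rewrite big_cons.
have sd := seminorm_dot u.
rewrite DlimD //; [|exact: seminormM|exact: seminorm_sum].
by rewrite DlimZ // IH big_cons.
Qed.

Variable K : set plane.
Variables (x0 : plane) (r0 Rad : R).
Hypothesis r0_gt0 : 0 < r0.
Hypothesis K_ball : forall x, n1 (x - x0) <= r0 -> K x.
Hypothesis K_rad : forall x, K x -> n1 x <= Rad.
Hypothesis K_conv : conv_closed K.
Hypothesis K_compact : compact K.
Hypothesis foc : forall phi, seminorm phi -> Dlim psi phi <= Lam K phi.

Lemma feas_mix (k : R) c s c' s' : 0 <= k <= 1 -> feas K c s -> feas K c' s' ->
  feas K ((1 - k) *: c + k *: c') ([seq (1 - k) *: v | v <- s] ++ [seq k *: v | v <- s']).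
Proof.
move=> k01 h h' x [z /zset_cat[z1 [z2 [/zset_scale[y1 s1 ->] /zset_scale[y2 s2 ->] ->]]] <-].
have -> : (1 - k) *: c + k *: c' + ((1 - k) *: y1 + k *: y2) =
  (1 - k) *: (c + y1) + k *: (c' + y2) by apply: planeP; rewrite !mxE; ring.
by apply: K_conv => //; [apply: h; exists y1|apply: h'; exists y2].
Qed.

Lemma wd_le_n1 c s u : feas K c s -> wd s u <= n1 u * (4 * Rad).
Proof.
move=> h; apply: le_trans (ler_wpM2l (n1_ge0 u) (feas_n1 K_rad h)).
by rewrite mulr_sumr; apply: ler_sum => v _; exact: dot_le.
Qed.

(* Minimise [\sum_u max (Du u - wd s u) 0 ^ 2] over the zonotopes in [K]: its
   gradient at a minimiser is a seminorm to which [foc] applies. *)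
Lemma width_approx (r : seq plane) (d : R) : 0 < d ->
  exists c s, feas K c s /\ forall u, u \in r -> Du u <= wd s u + d.
Proof.
move=> d0.
pose f s := \sum_(u <- r) Num.max (Du u - wd s u) 0 ^+ 2.
have f0 s : 0 <= f s by apply: sumr_ge0 => u _; exact: sqr_ge0.
pose A := [set r | exists c s, feas K c s /\ r = f s].
have hA : has_inf A.
  split; last by exists 0 => _ [c [s [_ ->]]]; exact: f0.
  by exists (f [::]), x0, [::]; split=> //; exact: (feas_nil r0_gt0 K_ball).
set q := inf A.
have qle c s : feas K c s -> q <= f s.
  by move=> h; apply: ge_inf; [case: hA|exists c, s].
have q0 : 0 <= q by apply: lb_le_inf; [case: hA|move=> _ [c [s [_ ->]]]; exact: f0].
suff q1 : q <= 0.
  have d2 : 0 < d ^+ 2 by rewrite exprn_gt0.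
  have [_ [c [s [h ->]]] hlt] := inf_adherent d2 hA.
  exists c, s; split=> // u ur.
  have h1 : Num.max (Du u - wd s u) 0 ^+ 2 <= f s.
    rewrite /f (big_rem u) //= lerDl; apply: sumr_ge0 => w _; exact: sqr_ge0.
  have h2 : Num.max (Du u - wd s u) 0 ^+ 2 < d ^+ 2.
    by apply: le_lt_trans h1 _; apply: lt_le_trans hlt _; rewrite -/q; lra.
  have m0 : 0 <= Num.max (Du u - wd s u) 0 by rewrite le_max lexx orbT.
  rewrite ltr_sqr ?nnegrE ?(ltW d0) // in h2.
  have hm : Du u - wd s u <= Num.max (Du u - wd s u) 0 by rewrite le_max lexx.
  lra.
rewrite leNgt; apply/negP => qp.
(* Bounds the second-order coefficient of the penalty along a segment joining two feasible
   zonotopes. *)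
pose H := 1 + \sum_(u <- r) (n1 u * (4 * Rad)) ^+ 2.
have H0 : 1 <= H by rewrite lerDl; apply: sumr_ge0 => u _; exact: sqr_ge0.
pose k := Num.min 1 (q / (2 * H)).
have H2 : 0 < 2 * H by lra.
have k0 : 0 < k by rewrite lt_min ltr01 divr_gt0.
have k1 : k <= 1 by rewrite ge_min lexx.
have kH : k * (2 * H) <= q by rewrite -ler_pdivlMr // ge_min lexx orbT.
clearbody k.
have t0 : 0 < k * q / 4 by rewrite divr_gt0 // mulr_gt0.
have [_ [c [s [hs ->]]] hlt] := inf_adherent t0 hA; rewrite -/q in hlt.
pose al u := Num.max (Du u - wd s u) 0.
have al0 u : 0 <= al u by rewrite le_max lexx orbT.
have sn := seminorm_sum r al0.
have q4 : 0 < q / 4 by lra.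
(* A zonotope nearly of maximal length for the gradient seminorm. By [foc] its weighted widths are
   at least those of [Du] up to [q / 4], so moving towards it must lower the penalty. *)
have [_ [c' [s' [hs' ->]]] hlt'] := sup_adherent q4 (Lam_has_sup r0_gt0 K_ball K_rad sn).
have := lt_le_trans hlt' (lexx _); rewrite exchange_big /= => hal.
have {hal} : \sum_(u <- r) al u * Du u - q / 4 < \sum_(u <- r) al u * wd s' u.
  rewrite -Dlim_sum //.
  apply: le_lt_trans (_ : _ <= Lam K (fun v => \sum_(u <- r) al u * `|dot u v|) - q / 4) _.
    by rewrite lerB // foc.
  apply: lt_le_trans hal _; apply: ler_sum => u _.
  by rewrite /wd mulr_sumr.
move=> hal.
have k01 : 0 <= k <= 1 by rewrite (ltW k0).
have hmix := qle _ _ (feas_mix k01 hs hs').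
have : f ([seq (1 - k) *: v | v <- s] ++ [seq k *: v | v <- s']) <=
    f s - 2 * (k * \sum_(u <- r) al u * (wd s' u - wd s u)) + k ^+ 2 * H.
  apply: (@le_trans _ _ (\sum_(u <- r) (al u ^+ 2 - 2 * (k * (al u * (wd s' u - wd s u))) +
      k ^+ 2 * (n1 u * (4 * Rad)) ^+ 2))).
    apply: ler_sum => u _; rewrite wd_cat !wd_scale ?(ltW k0) //; last lra.
    have -> : Du u - ((1 - k) * wd s u + k * wd s' u) =
      (Du u - wd s u) - k * (wd s' u - wd s u) by ring.
    apply: le_trans (sqr_pos_le _ _ _) _; rewrite -/(al u) lerD2l ler_wpM2l ?sqr_ge0 //.
    rewrite -[leLHS]real_normK ?num_real // ler_sqr ?nnegrE //; last first.
      by apply: le_trans (wd_ge0 s u) (wd_le_n1 u hs).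
    have a1 := wd_le_n1 u hs; have a2 := wd_le_n1 u hs'.
    have a3 := wd_ge0 s u; have a4 := wd_ge0 s' u.
    by rewrite ler_norml; apply/andP; split; lra.
  rewrite big_split sumrB /= -!mulr_sumr /f -/al /H.
  have := sqr_ge0 k; lra.
have e : \sum_(u <- r) al u * (wd s' u - wd s u) =
    \sum_(u <- r) al u * wd s' u - \sum_(u <- r) al u * wd s u.
  by rewrite -sumrB; apply: eq_bigr => u _; ring.
have e2 : \sum_(u <- r) al u * Du u - \sum_(u <- r) al u * wd s u = f s.
  rewrite -sumrB; apply: eq_bigr => u _; rewrite -mulrBr /al expr2.
  by case: (leP (Du u - wd s u) 0) => h; rewrite ?mul0r.
have qf := qle _ _ hs.
rewrite e => hf.
(* The start is at most [q + k q / 4], the linear gain at least [3/2 k q] and the quadratic loss at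
   most [k q / 2], so the mixture falls below the infimum [q]. *)
have h1 : k * (\sum_(u <- r) al u * wd s' u - \sum_(u <- r) al u * wd s u) >= k * (q - q / 4).
  by apply: ler_wpM2l; [exact: ltW|lra].
have h2 : k ^+ 2 * H <= k * (q / 2) by rewrite expr2 -mulrA ler_pM2l //; lra.
have kq := mulr_gt0 k0 qp.
lra.
Qed.

(** One centre [t] serves all directions simultaneously. The net of [width_approx] suffices because
    [Du] and the widths of zonotopes in [K] have common Lipschitz constants. *)
Lemma support_approx (d : R) : 0 < d -> exists2 t, K t & forall u, n1 u <= 1 ->
  exists2 y, K y & dot u t + Du u / 2 <= dot u y + d.
Proof.
move=> d0; have n1s := @seminorm_n1 R.
have D0 := Dlim_ge0 psi_norm n1s.
have R0 : 0 <= Rad by apply: le_trans (n1_ge0 _) (K_rad (Kx0 r0_gt0 K_ball)).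
pose e := d / (1 + Dlim psi (@n1 R) + 4 * Rad).
have E0 : 0 < 1 + Dlim psi (@n1 R) + 4 * Rad by lra.
have e0 : 0 < e by rewrite divr_gt0.
have eE : e * (1 + Dlim psi (@n1 R) + 4 * Rad) = d by rewrite divfK // gt_eqF.
have [F hF] := finite_net e0.
have [c [s [hs hu]]] := width_approx F e0.
exists (c + center s); first by apply: hs; exists (center s) => //; exact: zset_center.
move=> u nu; have [u' uF du] := hF u nu.
have [z sz hz] := zset_dot_attained s u.
exists (c + z); first by apply: hs; exists z.
have h1 := Du_lip u u'; have h2 := hu _ uF.
have h3 : wd s u' <= wd s u + e * (4 * Rad).
  apply: (@le_trans _ _ (wd s u + wd s (u' - u))).
    rewrite /wd -big_split /=; apply: ler_sum => v _.
    have -> : dot u' v = dot u v + dot (u' - u) v by rewrite dotBl; ring.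
    exact: ler_normD.
  rewrite lerD2l; apply: le_trans (wd_le_n1 _ hs) _; apply: ler_wpM2r; first lra.
  by case: n1s => _ _ <-; rewrite opprB.
have h4 : Dlim psi (@n1 R) * n1 (u - u') <= Dlim psi (@n1 R) * e by rewrite ler_wpM2l.
by move: hz; rewrite !dotBr !dotDr; lra.
Qed.

(** The point [t0] is a cluster point of the approximate centres. A point of the body outside [K]
    would be separated from [K] by a fixed gap in some direction, where [support_approx] with a
    small error gives a contradiction. *)
Lemma limit_body : exists2 t, K t & body t Du `<=` K.
Proof.
have ex (k : nat) : exists t, K t /\ forall u, n1 u <= 1 ->
    exists2 y, K y & dot u t + Du u / 2 <= dot u y + k.+1%:R^-1.
  by have [|t Kt h] := @support_approx (k.+1%:R^-1); [rewrite invr_gt0 ltr0n|exists t].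
have [t ht] := choice ex.
have [t0 [Kt0 cl]] : exists t0 : plane, K t0 /\ cluster (t k @[k --> \oo]) t0.
  have [|t0 [Kt0 cl]] := K_compact (F := t k @[k --> \oo]) _; last by exists t0.
  by rewrite /nbhs /=; apply: filterE => k /=; case: (ht k).
exists t0 => // x hx; apply: contrapT => nK.
have [u0 [d0 [d0p hsep]]] := compact_sep K_compact K_conv (ex_intro _ _ Kt0) nK.
have M0 : 0 < n1 u0 + 1 by have := n1_ge0 u0; lra.
pose u := (n1 u0 + 1)^-1 *: u0; pose d := (n1 u0 + 1)^-1 * d0.
have dp : 0 < d by rewrite mulr_gt0 // invr_gt0.
have nu : n1 u <= 1.
  rewrite /u (seminormZ _ _ (@seminorm_n1 R)) gtr0_norm ?invr_gt0 //.
  by rewrite mulrC ler_pdivrMr // mul1r; lra.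
have sep a : K a -> dot u a + d <= dot u x.
  by move=> Ka; rewrite !dotZl -mulrDr ler_pM2l ?invr_gt0 // hsep.
have d4 : 0 < d / 4 by lra.
pose k0 := Num.truncn (4 / d).
have [] := cl [set y | exists2 k, (k0 <= k)%N & y = t k] [set y | `|dot u t0 - dot u y| <= d / 4].
- by exists k0 => // k hk; exists k.
- have c : dot u y @[y --> t0] --> dot u t0 by exact: dot_continuous.
  exact: (cvgr_dist_le _ _ c _ d4).
move=> _ [[k hk ->] /=]; rewrite ler_distl => /andP[h1 h2].
have [_ /(_ u nu)[y Ky hy]] := ht k.
have hk' : k.+1%:R^-1 <= d / 4.
  rewrite -[leRHS]invrK lef_pV2 ?posrE ?invr_gt0 ?ltr0n // invf_div.
  by apply: ltW; apply: lt_le_trans (truncnS_gt _) _; rewrite ler_nat ltnS.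
have := hx u; have := sep _ Ky; rewrite dotBr.
move: hy hk' h1 h2 dp; clear.
move: (dot u x) (dot u y) (dot u t0) (dot u (t k)) (Du u) (k.+1%:R^-1 : R) d.
move=> a1 a2 a3 a4 a5 a6 a7; lra.
Qed.

End Minimax.

(** * Hausdorff closeness from closeness of widths *)

Section LimitShape.
Variable R : realType.
Local Notation plane := 'rV[R]_2.
Implicit Types (x y z u v c t : plane) (s : seq plane) (phi w : plane -> R).

Lemma enorm_le_n1 x : enorm x <= n1 x.
Proof.
rewrite /enorm -[leRHS]ger0_norm ?n1_ge0 // -sqrtr_sqr ler_wsqrtr //.
rewrite big_ord_recl big_ord1 /n1.
have -> : lift ord0 ord0 = 1 :> 'I_2 by exact: val_inj.
have h0 := real_normK (num_real (x 0 0)); have h1 := real_normK (num_real (x 0 1)).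
have := mulr_ge0 (normr_ge0 (x 0 0)) (normr_ge0 (x 0 1)).
by rewrite -h0 -h1; move: `|x 0 0| `|x 0 1| => a b; lra.
Qed.

Lemma hausdorff_le (P Q : set plane) (r : R) :
  (forall a, P a -> exists2 b, Q b & n1 (a - b) <= r) ->
  (forall b, Q b -> exists2 a, P a & n1 (a - b) <= r) ->
  (hausdorff_dist P Q <= r%:E)%E.
Proof.
move=> h1 h2; rewrite /hausdorff_dist ge_max; apply/andP; split.
- apply: ub_ereal_sup => _ [a Pa <-]; have [b Qb hab] := h1 a Pa.
  apply: le_trans (_ : _ <= (enorm (a - b))%:E)%E _.
    by apply: ereal_inf_lbound; exists b.
  by rewrite lee_fin; exact: le_trans (enorm_le_n1 _) hab.
- apply: ub_ereal_sup => _ [b Qb <-]; have [a Pa hab] := h2 b Qb.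
  apply: le_trans (_ : _ <= (enorm (a - b))%:E)%E _.
    by apply: ereal_inf_lbound; exists a.
  by rewrite lee_fin; exact: le_trans (enorm_le_n1 _) hab.
Qed.

(** Points are matched by homotheties, of ratio [(1 + th)^-1] into the target and [1 - th] out of
    it; each displaces a point by at most [th] times the radius, besides the shift of the centre. *)
Lemma hausdorff_body (D w : plane -> R) t t0 (th M : R) : 0 <= th <= 1 / 2 ->
  (forall u, w u <= (1 + th) * D u) -> (forall u, (1 - th) * D u <= w u) ->
  (forall b, body t0 D b -> n1 (b - t0) <= M) ->
  (hausdorff_dist (body t w) (body t0 D) <= (n1 (t - t0) + th * M)%:E)%E.
Proof.
move=> /andP[th0 th1] up dn hM; case: (@seminorm_n1 R) => sub hom ev.
apply: hausdorff_le => [a Pa|b Kb].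
  pose b := t0 + (1 + th)^-1 *: (a - t).
  have Kb : body t0 D b.
    move=> u; have -> : b - t0 = (1 + th)^-1 *: (a - t) by rewrite /b addrC addKr.
    rewrite dotZr ler_pdivrMl; last lra.
    by apply: le_trans (Pa u) _; rewrite mulrA ler_pM2r ?invr_gt0.
  exists b => //; have -> : a - b = (t - t0) + th *: (b - t0).
    have e : (1 + th)^-1 * (1 + th) = 1 by rewrite mulVf // gt_eqF //; lra.
    rewrite /b; apply: planeP; rewrite !mxE; move: e; move: (1 + th)^-1 => q e.
      apply/eqP; rewrite -subr_eq0; apply/eqP.
      transitivity ((a 0 0 - t 0 0) * (1 - q * (1 + th))); first by ring.
      by rewrite e subrr mulr0.
    apply/eqP; rewrite -subr_eq0; apply/eqP.
    transitivity ((a 0 1 - t 0 1) * (1 - q * (1 + th))); first by ring.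
    by rewrite e subrr mulr0.
  apply: le_trans (sub _ _) _; rewrite lerD2l hom // ler_wpM2l // hM //.
exists (t + (1 - th) *: (b - t0)).
  move=> u; rewrite [t + _]addrC addrK dotZr.
  have h := Kb u; have th1' : 0 <= 1 - th by lra.
  apply: le_trans (ler_wpM2l th1' h) _.
  by rewrite mulrA ler_pM2r ?invr_gt0.
have -> : t + (1 - th) *: (b - t0) - b = (t - t0) + th *: (t0 - b).
  by apply: planeP; rewrite !mxE; ring.
apply: le_trans (sub _ _) _; rewrite lerD2l hom // ler_wpM2l //.
by rewrite -ev opprB hM.
Qed.

Lemma net_to_all (F : seq plane) (d h A : R) (w D : plane -> R) : 0 <= d -> 0 <= h ->
  (forall x, n1 x <= 1 -> exists2 y, y \in F & n1 (x - y) <= d) ->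
  (forall (k : R) u, 0 <= k -> w (k *: u) = k * w u) ->
  (forall (k : R) u, 0 <= k -> D (k *: u) = k * D u) ->
  (forall u u', w u - D u <= w u' - D u' + A * n1 (u - u')) -> 0 <= A ->
  (forall u, u \in F -> w u - D u <= h) ->
  forall u, w u - D u <= (h + A * d) * n1 u.
Proof.
move=> d0 h0 net wZ DZ lip A0 hF u.
case: (eqVneq (n1 u) 0) => [e|nu].
  have -> : u = 0 *: u by rewrite (n1_eq0 e) scaler0.
  by rewrite wZ // DZ // !mul0r subr0 scale0r /n1 !mxE normr0 addr0 mulr0.
have np : 0 < n1 u by rewrite lt_neqAle eq_sym nu n1_ge0.
pose x := (n1 u)^-1 *: u.
have xv : u = n1 u *: x by rewrite /x scalerA mulfV // scale1r.
have nx : n1 x = 1.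
  by rewrite /x (seminormZ _ _ (@seminorm_n1 R)) gtr0_norm ?invr_gt0 // mulVf.
have [y yF hy] := net x ltac:(by rewrite nx).
have h1 := lip x y; have h2 := hF y yF.
have h3 := ler_wpM2l A0 hy.
rewrite {1 2}xv wZ ?(ltW np) // DZ ?(ltW np) // -mulrBr mulrC ler_pM2r //.
lra.
Qed.

Variables (psi : plane -> R) (K : set plane).
Variables (x0 t0 : plane) (r0 Rad : R).
Hypothesis psi_norm : is_norm psi.
Hypothesis r0_gt0 : 0 < r0.
Hypothesis K_ball : forall x, n1 (x - x0) <= r0 -> K x.
Hypothesis K_rad : forall x, K x -> n1 x <= Rad.
Hypothesis K_conv : conv_closed K.
Hypothesis K_t0 : K t0.
Hypothesis K0_sub : body t0 (Du psi) `<=` K.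
Hypothesis Lam_psi : Dlim psi psi = Lam K psi.

Local Notation K0 := (body t0 (Du psi)).
Local Notation D := (Du psi).

Lemma Rad_ge0 : 0 <= Rad.
Proof. by apply: le_trans (n1_ge0 _) (K_rad K_t0). Qed.

Lemma K0_radius b : K0 b -> n1 (b - t0) <= 2 * Rad.
Proof.
move=> /K0_sub/K_rad h1; have h2 := K_rad K_t0.
case: (@seminorm_n1 R) => sub _ ev.
by apply: le_trans (sub _ _) _; rewrite ev; lra.
Qed.

Lemma wdZ (k : R) s u : 0 <= k -> wd s (k *: u) = k * wd s u.
Proof.
move=> k0; rewrite /wd mulr_sumr; apply: eq_bigr => v _.
by rewrite dotZl normrM ger0_norm.
Qed.

Lemma wd_lip s (A : R) u u' : \sum_(v <- s) n1 v <= A ->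
  wd s u <= wd s u' + A * n1 (u - u').
Proof.
move=> hA; apply: (@le_trans _ _ (wd s u' + wd s (u - u'))).
  rewrite /wd -big_split /=; apply: ler_sum => v _.
  have -> : dot u v = dot u' v + dot (u - u') v by rewrite dotBl; ring.
  exact: ler_normD.
rewrite lerD2l; apply: le_trans (ler_wpM2r (n1_ge0 _) hA).
rewrite mulr_suml; apply: ler_sum => v _; rewrite mulrC; exact: dot_le.
Qed.

(** The factor [k] is 1 for closeness to the limit shape and [l^-3] when counting shrunken
    zonotopes. *)
Lemma wd_upper (F : seq plane) (d h A : R) s (k : R) : 0 <= d -> 0 <= h -> 0 <= A -> 0 <= k <= 1 ->
  (forall x, n1 x <= 1 -> exists2 y, y \in F & n1 (x - y) <= d) ->
  \sum_(v <- s) n1 v <= A -> (forall u, u \in F -> wd s u - k * D u <= h) ->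
  forall u, wd s u <= k * D u + (h + (A + Dlim psi (@n1 R)) * d) * n1 u.
Proof.
move=> d0 h0 A0 /andP[k0 k1] net hA hF u.
have D0 : 0 <= Dlim psi (@n1 R) by apply: Dlim_ge0 => //; exact: seminorm_n1.
rewrite -lerBlDl; apply: (@net_to_all F d h (A + Dlim psi (@n1 R)) (wd s) (fun u => k * D u)) => //.
- by move=> l v l0; rewrite wdZ.
- by move=> l v l0; rewrite DuZ // mulrCA.
- move=> a b; have h1 := wd_lip a b hA; have h2 := Du_lip psi_norm b a.
  have nab : n1 (b - a) = n1 (a - b) by case: (@seminorm_n1 R) => _ _ <-; rewrite opprB.
  rewrite nab in h2.
  have h3 : k * D b <= k * D a + Dlim psi (@n1 R) * n1 (a - b).
    apply: le_trans (ler_wpM2l k0 h2) _; rewrite mulrDr lerD2l.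
    by rewrite ler_piMl // mulr_ge0 // n1_ge0.
  lra.
- exact: addr_ge0.
Qed.

Lemma wd_lower (F : seq plane) (d h A : R) s : 0 <= d -> 0 <= h -> 0 <= A ->
  (forall x, n1 x <= 1 -> exists2 y, y \in F & n1 (x - y) <= d) ->
  \sum_(v <- s) n1 v <= A -> (forall u, u \in F -> D u - wd s u <= h) ->
  forall u, D u <= wd s u + (h + (A + Dlim psi (@n1 R)) * d) * n1 u.
Proof.
move=> d0 h0 A0 net hA hF u.
have D0 : 0 <= Dlim psi (@n1 R) by apply: Dlim_ge0 => //; exact: seminorm_n1.
rewrite -lerBlDl; apply: (@net_to_all F d h (A + Dlim psi (@n1 R)) D (wd s)) => //.
- by move=> l v l0; rewrite DuZ.
- by move=> l v l0; rewrite wdZ.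
- move=> a b; have h1 := wd_lip b a hA; have h2 := Du_lip psi_norm a b.
  have nab : n1 (b - a) = n1 (a - b) by case: (@seminorm_n1 R) => _ _ <-; rewrite opprB.
  rewrite nab in h1; lra.
- exact: addr_ge0.
Qed.

Lemma body_zset t s : body t (wd s) = [set (t - center s) + z | z in zset s].
Proof. by rewrite zset_body subrK. Qed.

(** Controls the centre. If a near-copy of [K0] in [K] is centred at [t], convexity puts into [K] a
    zonotope with the slightly shrunken generators and the additional generator [t - t0]. Its
    [psi]-length may not exceed [Lam K psi], so [t - t0] must be short. *)
Lemma translation_bound t s (th h : R) : 0 <= th -> 0 <= h ->
  body t (wd s) `<=` K -> (forall u, wd s u <= (1 + th) * D u) ->
  Dlim psi psi - h <= \sum_(v <- s) psi v ->
  psi (t - t0) <= th * Dlim psi psi + h.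
Proof.
move=> th0 h0 PK up hs; case: (psi_norm) => sn _.
pose k := (1 + th)^-1.
have kp : 0 < k by rewrite invr_gt0; lra.
have k1 : k <= 1 by rewrite invf_le1 //; lra.
have kth : k * (1 + th) = 1 by rewrite mulVf // gt_eqF //; lra.
clearbody k.
(* Every point is a convex combination of two copies of the shrunken zonotope: the one at [t0] lies
   in [K0], the one at [t] is contracted towards [t] inside the given zonotope. *)
have fe : feas K (t0 - k *: center s) ((t - t0) :: [seq k *: v | v <- s]).
  move=> x [z /zset_cons[l [y [l01 /zset_scale[y1 sy ->] ->]]] <-].
  have -> : t0 - k *: center s + (l *: (t - t0) + k *: y1) =
    (1 - l) *: (t0 + k *: (y1 - center s)) + l *: (t + k *: (y1 - center s)).
    by apply: planeP; rewrite !mxE; ring.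
  apply: K_conv => //.
    apply: K0_sub => u; rewrite [t0 + _]addrC addrK dotZr.
    have h1 := zset_dot_le u sy; have h2 := up u.
    apply: le_trans (ler_wpM2l (ltW kp) h1) _.
    have := ler_wpM2l (ltW kp) h2; rewrite mulrA kth mul1r; lra.
  have -> : t + k *: (y1 - center s) = (1 - k) *: t + k *: (t + (y1 - center s)).
    by apply: planeP; rewrite !mxE; ring.
  apply: K_conv; [| |by rewrite (ltW kp)].
    apply: PK; rewrite body_zset; exists (center s); first exact: zset_center.
    by rewrite subrK.
  apply: PK; rewrite body_zset; exists y1 => //.
  by apply: planeP; rewrite !mxE; ring.
have := Lam_ub r0_gt0 K_ball K_rad sn fe; rewrite -Lam_psi big_cons big_map.
have -> : \sum_(v <- s) psi (k *: v) = k * \sum_(v <- s) psi v.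
  by rewrite mulr_sumr; apply: eq_bigr => v _; case: sn => _ -> //; exact: ltW.
have := ler_wpM2l (ltW kp) hs.
have D0 : 0 <= Dlim psi psi by exact: Dlim_ge0.
have : (1 - k) * Dlim psi psi <= th * Dlim psi psi by apply: ler_wpM2r => //; nra.
have : k * h <= h by rewrite ler_piMl.
lra.
Qed.

(* The same net and tolerance serve the zonotopes in [K] and, centred at [t0],
   the approximating zonotopes that show that [K0] is a zonoid. *)
Lemma good_close (eps : R) : 0 < eps -> exists (h : R) (F : seq plane), 0 < h /\
  forall s, (forall u, u \in F -> `|wd s u - D u| <= h) ->
    (\sum_(v <- s) n1 v <= D (pt 1 0) + D (pt 0 1) + 2 ->
     (hausdorff_dist (body t0 (wd s)) K0 <= eps%:E)%E) /\
    (forall t, body t (wd s) `<=` K -> Dlim psi psi - h <= \sum_(v <- s) psi v ->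
     (hausdorff_dist (body t (wd s)) K0 <= eps%:E)%E).
Proof.
move=> eps0; have R0 := Rad_ge0.
have [rho rho0 hrho] := Dlim_dot_ge psi_norm.
case: (psi_norm) => sn [eta eta0 low].
have Dp : 0 <= Dlim psi psi by exact: Dlim_ge0.
have D0 : 0 <= Dlim psi (@n1 R) by apply: Dlim_ge0 => //; exact: seminorm_n1.
pose A := 4 * Rad + (D (pt 1 0) + D (pt 0 1) + 2).
have W0 : 0 <= D (pt 1 0) + D (pt 0 1) + 2 by rewrite !addr_ge0 // Du_ge0.
have A4 : 4 * Rad <= A by rewrite lerDl.
have R4 : 0 <= A by apply: addr_ge0 => //; lra.
have AW : D (pt 1 0) + D (pt 0 1) + 2 <= A by rewrite lerDr; lra.
clearbody A.
pose E := 1 + (A + Dlim psi (@n1 R)).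
have E1 : 1 <= E by rewrite /E; lra.
pose G := (E / rho * Dlim psi psi + 1) / eta + E / rho * (2 * Rad).
have Er : 0 < E / rho by rewrite divr_gt0 //; lra.
have G0 : 0 <= G.
  apply: addr_ge0; last by rewrite mulr_ge0 ?(ltW Er) //; lra.
  by rewrite divr_ge0 ?(ltW eta0) // addr_ge0 // mulr_ge0 // ltW.
(* The first bound gives [th <= 1 / 2], the second makes the final distance at most [h * G <= eps].
   The net also has mesh [h], so the width error is [h * E * n1 u = th * rho * n1 u <= th * D u]. *)
pose h := Num.min (rho / (2 * E)) (eps / (G + 1)).
have h0 : 0 < h by rewrite lt_min !divr_gt0 //; lra.
have hE : h * E / rho <= 1 / 2.
  have : h <= rho / (2 * E) by rewrite ge_min lexx.
  by rewrite ler_pdivlMr ?ler_pdivrMr //; lra.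
have hG : h * G <= eps.
  have : h <= eps / (G + 1) by rewrite ge_min lexx orbT.
  by rewrite ler_pdivlMr; lra.
have [F hF] := finite_net h0.
exists h, F; split=> // s hs.
have hs1 u : u \in F -> wd s u - 1 * D u <= h.
  by move=> /hs; rewrite mul1r ler_norml => /andP[].
have hs2 u : u \in F -> D u - wd s u <= h.
  by move=> /hs; rewrite ler_norml => /andP[]; lra.
pose th := h * E / rho.
have th0 : 0 <= th by rewrite divr_ge0 ?(ltW rho0) // mulr_ge0 ?(ltW h0) //; lra.
have eqh : h + (A + Dlim psi (@n1 R)) * h = th * rho.
  by rewrite /th divfK ?gt_eqF // /E; ring.
have both : \sum_(v <- s) n1 v <= A ->
    (forall u, wd s u <= (1 + th) * D u) /\ (forall u, (1 - th) * D u <= wd s u).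
  move=> hn.
  have k01 : 0 <= (1 : R) <= 1 by rewrite ler01 lexx.
  split=> u.
    have := wd_upper (ltW h0) (ltW h0) R4 k01 hF hn hs1 u.
    by rewrite eqh; have := ler_wpM2l th0 (hrho u); rewrite -/(D u); lra.
  have := wd_lower (ltW h0) (ltW h0) R4 hF hn hs2 u.
  by rewrite eqh; have := ler_wpM2l th0 (hrho u); rewrite -/(D u); lra.
have th12 : 0 <= th <= 1 / 2 by rewrite th0.
have fin (X : R) : eta * X <= th * Dlim psi psi + h -> X + th * (2 * Rad) <= eps.
  move=> hX; apply: le_trans hG.
  have -> : h * G = (th * Dlim psi psi + h) / eta + th * (2 * Rad).
    by rewrite /G /th; field; rewrite !gt_eqF.
  by rewrite lerD2r ler_pdivlMr // mulrC.
split=> [hn|t PK hsum].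
  have [up dn] := both (le_trans hn AW).
  apply: le_trans (hausdorff_body t0 th12 up dn K0_radius) _.
  rewrite lee_fin; apply: fin; rewrite subrr /n1 !mxE normr0 addr0 mulr0.
  by rewrite addr_ge0 ?(ltW h0) // mulr_ge0.
have hn : \sum_(v <- s) n1 v <= 4 * Rad.
  by apply: (feas_n1 K_rad (c := t - center s)); rewrite /feas -body_zset.
have [up dn] := both (le_trans hn A4).
apply: le_trans (hausdorff_body t th12 up dn K0_radius) _.
rewrite lee_fin; apply: fin; apply: le_trans (low _) _.
exact: (translation_bound th0 (ltW h0) PK up hsum).
Qed.

Lemma K0_closed : closed K0.
Proof.
have -> : K0 = \bigcap_(u in [set: plane]) (dot u @^-1` [set r | r <= dot u t0 + D u / 2]).
  apply/seteqP; split=> x.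
    by move=> h u _ /=; have := h u; rewrite dotBr; lra.
  by move=> h u; have /= := h u I; rewrite dotBr; lra.
apply: closed_bigI => u _; apply: preimage_closed; last exact: closed_le.
by move=> x _; exact: dot_continuous.
Qed.

End LimitShape.

(** * Cardinal bounds from parametrisations *)

Section Cardinals.
Variable T : choiceType.

Lemma ncard_le_surj (A : set T) (I : finType) (S : {pred I}) (g : I -> T) :
  (forall x, A x -> exists2 i, i \in S & g i = x) ->
  finite_set A /\ (ncard A <= #|S|)%N.
Proof.
move=> h; have fA : finite_set A.
  apply: (@sub_finite_set _ _ (g @` [set: I])); last exact: finite_image.
  by move=> x /h[i _ <-]; exists i.
split=> //; rewrite /ncard cardE -(size_map g).
apply: uniq_leq_size; first exact: fset_uniq.
move=> x; rewrite in_fset_set // inE => /h[i iS <-].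
by apply: map_f; rewrite mem_enum.
Qed.

Lemma ncard_ge_inj (A : set T) (I : finType) (S : {pred I}) (g : I -> T) :
  finite_set A -> (forall i, i \in S -> A (g i)) -> {in S &, injective g} ->
  (#|S| <= ncard A)%N.
Proof.
move=> fA hA inj; rewrite /ncard cardE -(size_map g).
apply: uniq_leq_size.
  rewrite map_inj_in_uniq ?enum_uniq // => i j; rewrite !mem_enum; exact: inj.
move=> x /mapP[i]; rewrite mem_enum => iS ->.
by rewrite in_fset_set // inE; exact: hA.
Qed.

End Cardinals.

(** * The scale belonging to the lattice parameter *)

Section Scale.
Variable R : realType.

Definition scale_of (n : nat) : R := (n%:R `^ (3^-1))^-1.

Lemma scale_of_gt0 n : (0 < n)%N -> 0 < scale_of n.
Proof. by move=> n0; rewrite invr_gt0 powR_gt0 // ltr0n. Qed.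

Lemma scale_of3 n : (0 < n)%N -> scale_of n ^+ 3 = n%:R^-1.
Proof.
move=> n0; rewrite exprVn -powR_mulrn ?powR_ge0 // -powRrM mulVf ?pnatr_eq0 //.
by rewrite powRr1 // ler0n.
Qed.

(** A box of side at least [n] is large enough, since [e^-2 <= e^-3 = n] for [e <= 1]. *)
Lemma scale_of_cvg (B : nat -> nat) : (forall n, (n <= B n)%N) ->
  (scale_of n, B n) @[n --> \oo] --> @scaleF R.
Proof.
move=> hB A [e0 e00 h]; exists (Num.truncn (Num.max 1 (e0 ^- 3))).+1 => // n /= hn.
have n0 : (0 < n)%N by apply: leq_trans hn.
have nR : Num.max 1 (e0 ^- 3) < n%:R.
  by apply: lt_le_trans (truncnS_gt _) _; rewrite ler_nat.
move: nR; rewrite gt_max => /andP[n1 n2].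
have ep := scale_of_gt0 n0; have e3 := scale_of3 n0.
have nR0 : 0 < (n%:R : R) by rewrite ltr0n.
apply: h.
  rewrite ep /= ltNge; apply/negP => le.
  have : e0 ^+ 3 <= scale_of n ^+ 3.
    by apply: lerXn2r; rewrite ?nnegrE ?(ltW ep) ?(ltW e00).
  rewrite e3 -[leLHS]invrK lef_pV2 ?posrE ?invr_gt0 ?exprn_gt0 //.
  by rewrite leNgt n2.
apply: (@le_trans _ _ n%:R); last by rewrite ler_nat.
have e1 : scale_of n <= 1.
  rewrite leNgt; apply/negP => lt1.
  have : 1 < scale_of n ^+ 3 by rewrite exprn_egt1.
  by rewrite e3 ltNge invf_le1 // (ltW n1).
rewrite -[leRHS]invrK -e3 lef_pV2 ?posrE ?exprn_gt0 // [leLHS]exprS.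
by rewrite ler_piMl // exprn_ge0 // ltW.
Qed.

End Scale.

(** * A finite parametrisation of the lattice zonotopes in [K] *)

Section Counting.
Variable R : realType.
Local Notation plane := 'rV[R]_2.
Implicit Types (x y z u v c t : plane) (s : seq plane).

(** Centres are half lattice points, hence the denominator [2 n]; subtracting [B] makes the indices
    reach the negative coordinates. *)
Definition decode (n B : nat) (i : 'I_(2 * B) * 'I_(2 * B) * {ffun idx B -> 'I_B}) : set plane :=
  body (pt ((i.1.1%:R - B%:R) / (2 * n%:R)) ((i.1.2%:R - B%:R) / (2 * n%:R))) (wm n i.2).

Lemma int_index (p : int) (B : nat) : `|p|%:~R < (B%:R : R) ->
  exists i : 'I_(2 * B), p%:~R = i%:R - B%:R :> R.
Proof.
move=> h; have hp : (`|p| < B%:Z)%R by rewrite -(ltr_int R).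
have lt : (absz (p + B%:Z)%R < 2 * B)%N by move: hp; clear; lia.
exists (Ordinal lt) => /=.
have -> : (absz (p + B%:Z)%R)%:R = (p + B%:Z)%:~R :> R.
  by rewrite pmulrn; congr (_%:~R); move: hp; clear; lia.
by rewrite intrD -pmulrn addrK.
Qed.

Lemma decode_surj K n P B (Rad : R) : lattice_zonotopes K n P ->
  (0 < n)%N -> (forall x, K x -> n1 x <= Rad) -> 4 * Rad * n%:R < B%:R ->
  exists i : 'I_(2 * B) * 'I_(2 * B) * {ffun idx B -> 'I_B}, decode n i = P.
Proof.
move=> hP n0 hR hB; have nR : 0 < (n%:R : R) by rewrite ltr0n.
have [t [m [PE /latticeP[p [q tE]] Kt]]] := lattice_zonotope_encoding hP n0 hR hB.
have R0 : 0 <= Rad by apply: le_trans (n1_ge0 _) (hR _ Kt).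
have e0 : p%:~R = 2 * n%:R * t 0 0.
  have := congr1 (fun v : plane => v 0 0) tE; rewrite !mxE /= => h.
  by rewrite mulrAC h mulrAC mulVf ?mul1r // gt_eqF.
have e1 : q%:~R = 2 * n%:R * t 0 1.
  have := congr1 (fun v : plane => v 0 1) tE; rewrite !mxE /= => h.
  by rewrite mulrAC h mulrAC mulVf ?mul1r // gt_eqF.
have b (x : R) (r : int) : `|x| <= Rad -> r%:~R = 2 * n%:R * x -> `|r|%:~R < (B%:R : R).
  move=> hx e; rewrite intr_norm e; apply: le_lt_trans hB.
  rewrite normrM ger0_norm; last by rewrite mulr_ge0.
  apply: le_trans (_ : 2 * n%:R * Rad <= _); first by rewrite ler_wpM2l // mulr_ge0.
  have := mulr_ge0 (ltW nR) R0; lra.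
have := hR _ Kt; rewrite /n1 => ht.
have n00 := normr_ge0 (t 0 0); have n01 := normr_ge0 (t 0 1).
have [i hi] := int_index (b (t 0 0) p ltac:(lra) e0).
have [j hj] := int_index (b (t 0 1) q ltac:(lra) e1).
exists (i, j, m); rewrite /decode /= -hi -hj PE; congr body.
by apply: planeP; rewrite ?pt0 ?pt1 ?e0 ?e1 mulrAC mulfV ?mul1r // mulf_neq0 ?gt_eqF.
Qed.

End Counting.

(** * Upper bound for the atypical and lower bound for all lattice zonotopes *)

Section Asymptotics.
Variable R : realType.
Local Notation plane := 'rV[R]_2.
Implicit Types (x y z u v c t : plane) (s : seq plane).

Definition dirs (F : seq plane) : seq (plane -> R) := [seq (fun v => `|dot u v|) | u <- F].

Lemma dirs_seminorm F i : seminorm (nth (@n1 R) (dirs F) i).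
Proof.
elim: F i => [|u F IH] [|i] /=; [exact: seminorm_n1|exact: seminorm_n1| |exact: IH].
exact: seminorm_dot.
Qed.

Lemma not_deviates (psi : plane -> R) F (h e : R) B N (m : {ffun idx B -> 'I_N}) :
  ~~ deviates psi (psi :: dirs F) h e m ->
  `|e ^+ 3 * mdot psi m - Dlim psi psi| <= h /\
  forall u, u \in F -> `|e ^+ 3 * mdot (fun v => `|dot u v|) m - Du psi u| <= h.
Proof.
rewrite /deviates /= negb_or -leNgt => /andP[h1]; rewrite has_map => /hasPn h2.
by split=> // u /h2 /=; rewrite -leNgt.
Qed.

Lemma grid_point n x : (0 < n)%N ->
  exists2 c, scaled_lattice n c & n1 (c - x) <= 2 / n%:R.
Proof.
move=> n0; have nR : 0 < (n%:R : R) by rewrite ltr0n.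
exists (n%:R^-1 *: pt (Num.floor (n%:R * x 0 0))%:~R (Num.floor (n%:R * x 0 1))%:~R).
  by apply/latticeP; exists (Num.floor (n%:R * x 0 0)), (Num.floor (n%:R * x 0 1)).
have h (r : R) : `|n%:R^-1 * (Num.floor (n%:R * r))%:~R - r| <= n%:R^-1.
  have /andP[f1 f2] := floor_itv (n%:R * r); rewrite intrD in f2.
  have -> : n%:R^-1 * (Num.floor (n%:R * r))%:~R - r =
    n%:R^-1 * ((Num.floor (n%:R * r))%:~R - n%:R * r) by field; rewrite gt_eqF.
  rewrite normrM gtr0_norm ?invr_gt0 // ler_piMr ?invr_ge0 ?(ltW nR) //.
  by rewrite ler_norml; apply/andP; split; lra.
rewrite /n1 !mxE /=; apply: le_trans (lerD (h _) (h _)) _.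
by rewrite [leRHS]mulrDl mul1r.
Qed.

Variables (psi : plane -> R) (K : set plane).
Variables (x0 t0 : plane) (r0 Rad : R).
Hypothesis psi_norm : is_norm psi.
Hypothesis r0_gt0 : 0 < r0.
Hypothesis K_ball : forall x, n1 (x - x0) <= r0 -> K x.
Hypothesis K_rad : forall x, K x -> n1 x <= Rad.
Hypothesis K_conv : conv_closed K.
Hypothesis K_t0 : K t0.
Hypothesis K0_sub : body t0 (Du psi) `<=` K.
Hypothesis Lam_psi : Dlim psi psi = Lam K psi.

Local Notation K0 := (body t0 (Du psi)).
Local Notation D := (Du psi).

(** The first summand meets the size condition of [decode_surj], the second the box condition of
    [scale_of_cvg]. *)
Definition Bn (n : nat) : nat := ((Num.truncn (4 * Rad * n%:R)).+1 + n)%N.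

Lemma Bn_ge n : (n <= Bn n)%N. Proof. exact: leq_addl. Qed.

Lemma Bn_gt n : 4 * Rad * n%:R < (Bn n)%:R.
Proof. by apply: lt_le_trans (truncnS_gt _) _; rewrite ler_nat leq_addr. Qed.

Lemma lattice_zonotopes_finite n : (0 < n)%N -> finite_set (lattice_zonotopes K n).
Proof.
move=> n0; pose g := @decode R n (Bn n).
have [] // := @ncard_le_surj _ (lattice_zonotopes K n) _ predT g _.
by move=> P hP; have [i <-] := decode_surj hP n0 K_rad (Bn_gt n); exists i.
Qed.

(** A zonotope in [K] far from [K0] comes from a deviating family, by [good_close]. Its [psi]-length
    is at most [Lam K psi = Dlim psi psi], so its weight is at least [expR (- e^-2 Dlim psi psi)],
    and the total deviating weight bounds the number of such families. *)
Lemma bad_count (eps : R) : 0 < eps -> exists2 c : R, 0 < c &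
  \forall n \near \oo,
    (ncard [set P | lattice_zonotopes K n P /\ (eps%:E < hausdorff_dist P K0)%E])%:R <=
    (2 * Bn n)%:R ^+ 2 * expR (scale_of R n ^- 2 * (Ent psi + Dlim psi psi - c)).
Proof.
move=> eps0; case: (psi_norm) => sn _.
have [h [F [h0 close]]] := good_close psi_norm r0_gt0 K_ball K_rad K_conv K_t0 K0_sub Lam_psi eps0.
have hP i : seminorm (nth (@n1 R) (psi :: dirs F) i).
  by case: i => //= i; exact: dirs_seminorm.
have [c c0 H] := concentration psi_norm h0 hP.
have c2 : 0 < c / 2 by lra.
have nS : \forall p \near @scaleF R, `|Ent psi - Sfun psi p| <= c / 2.
  exact: (cvgr_dist_le _ _ (Ent_cvg psi_norm) _ c2).
have nH := scale_of_cvg Bn_ge H.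
have nS' := scale_of_cvg Bn_ge nS.
exists (c / 2) => //; near=> n.
have n0 : (0 < n)%N by near: n; exists 1%N.
have nR : 0 < (n%:R : R) by rewrite ltr0n.
set e := scale_of R n; set B := Bn n.
have e0 : 0 < e by exact: scale_of_gt0.
have e3 : e ^+ 3 = n%:R^-1 by exact: scale_of3.
have hc : forall N, \sum_(m : {ffun idx B -> 'I_N} | deviates psi (psi :: dirs F) h e m)
      expR (- (e * mdot psi m)) <= expR (e ^- 2 * (Sfun psi (e, B) - c)).
  by rewrite /e /B; near: n; exact: nH.
have hS : `|Ent psi - Sfun psi (e, B)| <= c / 2.
  by rewrite /e /B; near: n; exact: nS'.
pose Q : pred {ffun idx B -> 'I_B} := fun m =>
  deviates psi (psi :: dirs F) h e m && (n%:R^-1 * mdot psi m <= Dlim psi psi).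
pose S := [predX (predT : {pred 'I_(2 * B) * 'I_(2 * B)}) & Q].
have surj P : lattice_zonotopes K n P /\ (eps%:E < hausdorff_dist P K0)%E ->
    exists2 i, i \in S & decode n i = P.
  move=> [hP' hd].
  have [[[i j] m] iE] := decode_surj hP' n0 K_rad (Bn_gt n).
  exists (i, j, m) => //; rewrite inE /=; case: hP' => _ PK _.
  move: iE; rewrite /decode /=; set t := pt _ _; rewrite -wd_glist => iE.
  have PK' : body t (wd (glist R n m)) `<=` K by rewrite iE.
  have fe : feas K (t - center (glist R n m)) (glist R n m) by rewrite /feas -body_zset.
  have hsum : n%:R^-1 * mdot psi m <= Dlim psi psi.
    by rewrite -sum_glist // Lam_psi; exact: (Lam_ub r0_gt0 K_ball K_rad sn fe).
  rewrite /Q unfold_in hsum andbT; apply/negPn/negP => nd.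
  have [h1 h2] := not_deviates nd; rewrite e3 in h1 h2.
  have hF u : u \in F -> `|wd (glist R n m) u - D u| <= h.
    by move=> /h2; rewrite wd_glist.
  have [_ /(_ t PK') far] := close _ hF.
  move: hd; rewrite ltNge -iE => /negP; apply; apply: far.
  by rewrite sum_glist //; move: h1; rewrite ler_norml => /andP[]; lra.
have [_ hcard] := ncard_le_surj surj.
rewrite -(ler_nat R) in hcard; apply: le_trans hcard _.
rewrite cardX natrM card_prod !card_ord natrM -expr2 ler_wpM2l ?sqr_ge0 //.
have ei : 0 < e ^- 2 by rewrite invr_gt0 exprn_gt0.
(* Each counted family has weight at least 1 after multiplication by [expR (e^-2 Dlim psi psi)]. *)
apply: (@le_trans _ _ (expR (e ^- 2 * Dlim psi psi) * expR (e ^- 2 * (Sfun psi (e, B) - c)))).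
  apply: le_trans (ler_wpM2l (expR_ge0 _) (hc B)).
  rewrite mulr_sumr -sum1_card natr_sum.
  rewrite big_mkcond [leRHS]big_mkcond; apply: ler_sum => m _.
  rewrite unfold_in /Q; case: (deviates _ _ _ _ _) => //; rewrite andTb.
  case: ifP => [hm|_]; last by rewrite mulr_ge0 ?expR_ge0.
  rewrite -expRD -[leLHS]expR0 ler_expR subr_ge0.
  have -> : e * mdot psi m = e ^- 2 * (n%:R^-1 * mdot psi m).
    by rewrite -e3; field; rewrite gt_eqF.
  by rewrite ler_pM2l.
rewrite -expRD ler_expR -mulrDr ler_pM2l //.
by move: hS; rewrite ler_norml => /andP[]; lra.
Unshelve. all: by end_near.
Qed.

(** Typical families for [l psi] have widths near [l^-3 D], strictly inside those of [K0]; the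
    remaining room takes up the deviations and the rounding of the centre. Distinct families give
    distinct zonotopes whatever centres are chosen. *)
Lemma total_count (d : R) : 0 < d -> \forall n \near \oo,
  4^-1 * expR (scale_of R n ^- 2 * (Ent psi + Dlim psi psi - d)) <=
  (ncard (lattice_zonotopes K n))%:R.
Proof.
move=> d0; case: (psi_norm) => sn [eta eta0 low].
set J := Ent psi + Dlim psi psi.
have J0 : 0 <= J by rewrite addr_ge0 ?Ent_ge0 // Dlim_ge0.
(* With [l = 1 + y] the exponent loses at most [3 y J <= d / 2]; the other half of [d] pays for
   [2 h]. *)
pose y := Num.min 1 (d / (6 * (J + 1))).
have y0 : 0 < y by rewrite lt_min ltr01 divr_gt0 //; lra.
have y1 : y <= 1 by rewrite ge_min lexx.
have yJ : y * (6 * (J + 1)) <= d by rewrite -ler_pdivlMr ?ge_min ?lexx ?orbT //; lra.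
clearbody y.
pose l := 1 + y; have l1 : 1 < l by rewrite /l; lra.
have l0 : 0 < l by lra.
have lle : 1 <= l by exact: ltW.
have l2 : 1 - 3 * y <= l ^- 2.
  by rewrite -div1r ler_pdivlMr ?exprn_gt0 // /l expr2; nra.
pose k := l ^- 3.
have k0 : 0 < k by rewrite invr_gt0 exprn_gt0.
have k1 : k < 1 by rewrite invf_lt1 ?exprn_gt0 // exprn_egt1.
have [rho rho0 hrho] := Dlim_dot_ge psi_norm.
have D0 : 0 <= Dlim psi (@n1 R) by apply: Dlim_ge0 => //; exact: seminorm_n1.
pose W := D (pt 1 0) + D (pt 0 1) + 2.
have W0 : 0 <= W by rewrite !addr_ge0 // Du_ge0.
pose E := 1 + (W + Dlim psi (@n1 R)).
have E0 : 0 < E by rewrite /E; lra.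
(* The bounds serve, in order, the total length [W], the exponent, and the widths: the last gives
   [h E n1 u <= (k' - k) D u]. *)
pose h := Num.min 1 (Num.min (d / 4) (rho * (1 - k) / (2 * E))).
have h0 : 0 < h by rewrite !lt_min ltr01 !divr_gt0 ?mulr_gt0 //; lra.
have h1 : h <= 1 by rewrite ge_min lexx.
have h4 : h <= d / 4 by rewrite !ge_min lexx !orbT.
have hE : h * E <= rho * ((1 - k) / 2).
  have : h <= rho * (1 - k) / (2 * E) by rewrite !ge_min lexx !orbT.
  by rewrite ler_pdivlMr; lra.
clearbody h.
have [F hF] := finite_net h0.
(* The widths in the two coordinate directions add up to the total [n1]-length of the generators. *)
pose F' := [:: pt 1 0, pt 0 1 & F].
have ln : is_norm (fun v => l * psi v) by exact: is_normZ.
have nT := scale_of_cvg Bn_ge (typical_card ln h0 (dirs_seminorm F')).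
(* Halfway between [k] and 1: the widths end up below [k' D], and the share [1 - k'] is kept for the
   ball around [x0]. *)
pose k' := (1 + k) / 2.
have k'0 : 0 < k' by rewrite /k'; lra.
have k'1 : k' < 1 by rewrite /k'; lra.
near=> n.
have n0 : (0 < n)%N by near: n; exists 1%N.
have nR : 0 < (n%:R : R) by rewrite ltr0n.
have nbig : 2 / n%:R <= r0 * (1 - k').
  have r1 : 0 < r0 * (1 - k') by rewrite mulr_gt0 //; lra.
  rewrite ler_pdivrMr // mulrC -ler_pdivrMr //.
  near: n; exists (Num.truncn (2 / (r0 * (1 - k')))).+1 => // m /= hm.
  by apply: ltW; apply: lt_le_trans (truncnS_gt _) _; rewrite ler_nat.
have e0 : 0 < scale_of R n by exact: scale_of_gt0.
have e3 : scale_of R n ^+ 3 = n%:R^-1 by exact: scale_of3.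
have [N hN] : exists N, 4^-1 * expR (scale_of R n ^- 2 *
      (Ent (fun v => l * psi v) + Dlim (fun v => l * psi v) (fun v => l * psi v) - 2 * h)) <=
    #|[pred m : {ffun idx (Bn n) -> 'I_N} |
       ~~ deviates (fun v => l * psi v) ((fun v => l * psi v) :: dirs F') h (scale_of R n) m]|%:R.
  by near: n; exact: nT.
have ei : 0 < scale_of R n ^- 2 by rewrite invr_gt0 exprn_gt0.
apply: (@le_trans _ _ (4^-1 * expR (scale_of R n ^- 2 *
      (Ent (fun v => l * psi v) + Dlim (fun v => l * psi v) (fun v => l * psi v) - 2 * h)))).
  rewrite ler_pM2l // ler_expR ler_pM2l // Ent_homo // Dlim_homo //; last exact: seminormM (ltW l0) sn.
  rewrite DlimZ //.
  have -> : l ^- 3 * (l * Dlim psi psi) = l ^- 2 * Dlim psi psi by field; rewrite gt_eqF.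
  rewrite -mulrDr -/J; have := ler_wpM2r J0 l2; have := mulr_ge0 (ltW y0) J0; lra.
apply: le_trans hN _; rewrite ler_nat.
(* Rounds so that the centre of the zonotope comes within [2 / n] of [k' t0 + (1 - k') x0]. *)
pose cs m := projT1 (cid2 (grid_point (k' *: t0 + (1 - k') *: x0 -
  center (@glist R n (Bn n) N m)) n0)).
apply: (ncard_ge_inj (g := fun m => body (cs m + center (glist R n m)) (wm n m))) => //.
- exact: lattice_zonotopes_finite.
- move=> m; rewrite inE => /not_deviates[_ hm]; rewrite e3 in hm.
  rewrite /cs; case: cid2 => c lc hc /=.
  apply: glist_lattice_zonotope => // x.
  have Dk u : Du (fun v => l * psi v) u = k * D u.
    by rewrite /Du Dlim_homo //; exact: seminorm_dot.
  have hw u : u \in F' -> `|wd (glist R n m) u - k * D u| <= h.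
    by move=> /hm; rewrite wd_glist Dk.
  have hn1 : \sum_(v <- glist R n m) n1 v <= W.
    rewrite sum_n1_wd.
    have /hw := mem_head (pt 1 0) (pt 0 1 :: F); have /hw : pt 0 1 \in F' by rewrite !inE eqxx orbT.
    rewrite !ler_norml => /andP[_ a1] /andP[_ a2].
    have b (u : plane) : k * D u <= D u by rewrite ler_piMl ?Du_ge0 // ltW.
    have := b (pt 1 0); have := b (pt 0 1); rewrite /W; lra.
  have hF' u : u \in F -> wd (glist R n m) u - k * D u <= h.
    move=> uF; have /hw : u \in F' by rewrite !inE uF !orbT.
    by rewrite ler_norml => /andP[].
  have k01 : 0 <= k <= 1 by rewrite !ltW.
  have up u : wd (glist R n m) u <= k' * D u.
    have := wd_upper psi_norm (ltW h0) (ltW h0) W0 k01 hF hn1 hF' u.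
    have -> : h + (W + Dlim psi (@n1 R)) * h = h * E by rewrite /E; ring.
    have := ler_wpM2r (n1_ge0 u) hE.
    have k2 : 0 <= (1 - k) / 2 by lra.
    have := ler_wpM2l k2 (hrho u); rewrite -/(D u) /k'; lra.
  rewrite -wd_glist => hx.
  set t := c + center (glist R n m) in hx.
  (* A point of the zonotope splits as [k' b + (1 - k') z], where [b] in [K0] absorbs the shape and
     [z] in the ball absorbs the rounding error. *)
  pose b := t0 + k'^-1 *: (x - t).
  have Kb : K b.
    apply: K0_sub => u; have -> : b - t0 = k'^-1 *: (x - t) by rewrite /b addrC addKr.
    rewrite dotZr ler_pdivrMl //; apply: le_trans (hx u) _.
    by rewrite mulrA ler_pM2r ?invr_gt0.
  pose z := x0 + (1 - k')^-1 *: (t - (k' *: t0 + (1 - k') *: x0)).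
  have Kz : K z.
    apply: K_ball; have -> : z - x0 = (1 - k')^-1 *: (t - (k' *: t0 + (1 - k') *: x0)).
      by rewrite /z addrC addKr.
    have p0 : 0 < 1 - k' by lra.
    rewrite (seminormZ _ _ (@seminorm_n1 R)) gtr0_norm ?invr_gt0 //.
    rewrite ler_pdivrMl // [leRHS]mulrC.
    apply: le_trans nbig; apply: le_trans hc.
    by rewrite /t opprB addrA.
  have -> : x = (1 - (1 - k')) *: b + (1 - k') *: z.
    have p0 : 1 - k' != 0 by rewrite gt_eqF //; lra.
    by rewrite /b /z; apply: planeP; rewrite !mxE; field; rewrite p0 gt_eqF.
  by apply: K_conv => //; apply/andP; split; lra.
- move=> m m' _ _ /=; rewrite -!wd_glist => /body_inj[_].
  by rewrite !wd_glist => /wm_inj; exact.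
Unshelve. all: by end_near.
Qed.

End Asymptotics.

(** * The limit shape is a zonoid and the proportion of far zonotopes vanishes *)

Section Conclusion.
Variable R : realType.
Local Notation plane := 'rV[R]_2.
Implicit Types (x y z u v c t : plane) (s : seq plane).

Lemma n1_continuous : continuous (@n1 R).
Proof.
move=> x.
have c i : `|(y : plane) 0 i| @[y --> x] --> `|x 0 i|.
  have h : {for x, continuous (fun v : plane => v 0 i)} by exact: coord_continuous.
  exact: cvg_norm h.
exact: cvgD (c 0) (c 1).
Qed.

(** A point of [A] keeps the first supremum from ranging over the empty set, where it would be
    [-oo]. *)
Lemma hausdorff_ge0 (A B : set plane) : A !=set0 -> (0 <= hausdorff_dist A B)%E.
Proof.
move=> [a Aa]; rewrite /hausdorff_dist le_max; apply/orP; left.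
apply: (@le_trans _ _ (ereal_inf [set (enorm (a - b))%:E | b in B])).
  by apply: le_ereal_inf_tmp => _ [b _ <-]; rewrite lee_fin sqrtr_ge0.
by apply: ereal_sup_ubound; exists a.
Qed.

Lemma scale_decay (M c : R) : 0 < c ->
  (M * n%:R) ^+ 2 * expR (- (scale_of R n ^- 2 * c)) @[n --> \oo] --> (0 : R).
Proof.
move=> c0; apply/cvgr0Pnorm_le => eps eps0.
pose C := M ^+ 2 * (4 / c) ^+ 4.
have C0 : 0 <= C by rewrite mulr_ge0 ?sqr_ge0 // exprn_ge0 // divr_ge0 // ltW.
pose d := Num.min 1 (eps / (C + 1)).
have d0 : 0 < d by rewrite lt_min ltr01 divr_gt0 //; lra.
have d1 : d <= 1 by rewrite ge_min lexx.
have dC : C * d <= eps.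
  have : d <= eps / (C + 1) by rewrite ge_min lexx orbT.
  by rewrite ler_pdivlMr; lra.
have nd := @scale_of_cvg R id (fun=> leqnn _) _ (near_scale_lt d0).
near=> n.
have n0 : (0 < n)%N by near: n; exists 1%N.
have e0 := @scale_of_gt0 R n n0; have e3 := @scale_of3 R n n0.
have ed : scale_of R n < d by near: n; exact: nd.
move: e0 e3 ed; move: (scale_of R n) => e e0 e3 ed.
have nE : n%:R = e ^- 3 :> R by rewrite e3 invrK.
rewrite ger0_norm; last by rewrite mulr_ge0 ?sqr_ge0 ?expR_ge0.
apply: le_trans dC; apply: (@le_trans _ _ (C * e ^+ 2)); last first.
  rewrite ler_wpM2l // expr2; apply: le_trans (_ : e * 1 <= d); last by rewrite mulr1 ltW.
  by rewrite ler_pM2l // (le_trans (ltW ed)).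
set y := e ^- 2 * c.
have y0 : 0 < y by rewrite mulr_gt0 // invr_gt0 exprn_gt0.
(* The fourth power suffices: it is of order [e^-8] against [n^2 = e^-6], which leaves [e^2]. *)
have hy : (y / 4) ^+ 4 <= expR y.
  have -> : expR y = expR (y / 4) ^+ 4.
    by rewrite -expRM_natl; congr expR; field.
  apply: lerXn2r; rewrite ?nnegrE ?expR_ge0 // ?divr_ge0 ?(ltW y0) //.
  by apply: le_trans (expR_ge1Dx _); rewrite lerDr.
rewrite expRN ler_pdivrMr ?expR_gt0 //.
apply: le_trans (ler_wpM2l _ hy); last by rewrite mulr_ge0 ?sqr_ge0.
rewrite nE /C /y le_eqVlt; apply/orP; left; apply/eqP.
by field; rewrite !gt_eqF.
Unshelve. all: by end_near.
Qed.

Variables (psi : plane -> R) (K : set plane).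
Variables (x0 t0 : plane) (r0 Rad : R).
Hypothesis psi_norm : is_norm psi.
Hypothesis r0_gt0 : 0 < r0.
Hypothesis K_ball : forall x, n1 (x - x0) <= r0 -> K x.
Hypothesis K_rad : forall x, K x -> n1 x <= Rad.
Hypothesis K_conv : conv_closed K.
Hypothesis K_compact : compact K.
Hypothesis K_t0 : K t0.
Hypothesis K0_sub : body t0 (Du psi) `<=` K.
Hypothesis Lam_psi : Dlim psi psi = Lam K psi.

Local Notation K0 := (body t0 (Du psi)).

(** A typical family exists because their number is bounded below by a positive quantity. Its
    zonotope is placed at [t0], with no demand on lattice position or containment in [K]. *)
Lemma zonotope_near_limit (eps : R) : 0 < eps ->
  exists2 s, zonotope (body t0 (wd s)) & (hausdorff_dist (body t0 (wd s)) K0 <= eps%:E)%E.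
Proof.
move=> eps0.
have [h [F [h0 close]]] := good_close psi_norm r0_gt0 K_ball K_rad K_conv K_t0 K0_sub Lam_psi eps0.
pose h' := Num.min 1 h.
have h'0 : 0 < h' by rewrite lt_min ltr01.
have h'1 : h' <= 1 by rewrite ge_min lexx.
have h'h : h' <= h by rewrite ge_min lexx orbT.
clearbody h'.
pose F' := [:: pt 1 0, pt 0 1 & F].
have nT := scale_of_cvg (fun n => leqnn n) (typical_card psi_norm h'0 (dirs_seminorm F')).
have npos : \forall n \near \oo, (0 < n)%N by exists 1%N.
have [n [n0 [N hN]]] := filter_ex (filterI npos nT).
have e3 := @scale_of3 R n n0; set S := [pred m | _] in hN.
have /card_gt0P[m] : (0 < #|S|)%N.
  by rewrite -(ltr_nat R); apply: lt_le_trans hN; rewrite mulr_gt0 ?expR_gt0.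
rewrite inE => /not_deviates[_ hm]; rewrite /= e3 in hm.
have hF u : u \in F' -> `|wd (glist R n m) u - Du psi u| <= h'.
  by move=> /hm; rewrite wd_glist.
exists (glist R n m); first by rewrite body_zset; exact: zonotope_zset.
have hFh u : u \in F -> `|wd (glist R n m) u - Du psi u| <= h.
  by move=> uF; apply: le_trans h'h; apply: hF; rewrite !inE uF !orbT.
have [H _] := close _ hFh; apply: H; rewrite sum_n1_wd.
have /hF := mem_head (pt 1 0) (pt 0 1 :: F); have /hF : pt 0 1 \in F' by rewrite !inE eqxx orbT.
by rewrite !ler_norml => /andP[_ a1] /andP[_ a2]; lra.
Qed.

Lemma limit_zonoid : zonoid K0.
Proof.
split; first by apply: subclosed_compact K_compact K0_sub; exact: K0_closed.
have hk (k : nat) : {s | zonotope (body t0 (wd s)) &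
    (hausdorff_dist (body t0 (wd s)) K0 <= (k.+1%:R^-1)%:E)%E}.
  by apply: cid2; apply: zonotope_near_limit; rewrite invr_gt0.
exists (fun k => body t0 (wd (s2val (hk k)))) => [k|]; first by case: (hk k).
apply: (@squeeze_cvge _ _ _ _ (fun=> 0%E) _ (fun k : nat => (k.+1%:R^-1)%:E)).
- apply: nearW => k; case: (hk k) => s zs hs /=; rewrite hs andbT.
  apply: hausdorff_ge0; exists t0 => u.
  by rewrite subrr dot0r divr_ge0 // wd_ge0.
- exact: cvg_cst.
- by apply: cvg_EFin; [exact: nearW|exact: cvg_harmonic].
Qed.

Lemma bad_ratio_cvg (eps : R) : 0 < eps ->
  (ncard [set P | lattice_zonotopes K n P /\ (eps%:E < hausdorff_dist P K0)%E])%:R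
    / (ncard (lattice_zonotopes K n))%:R @[n --> \oo] --> (0 : R).
Proof.
move=> eps0.
have [c c0 bad] := bad_count psi_norm r0_gt0 K_ball K_rad K_conv K_t0 K0_sub Lam_psi eps0.
have c2 : 0 < c / 2 by lra.
have tot := total_count psi_norm r0_gt0 K_ball K_rad K_conv K0_sub c2.
have R0 := Rad_ge0 K_rad K_t0.
(* Since [Bn Rad n <= (4 * Rad + 2) * n], the factor [(2 Bn)^2] together with the 4 from the lower
   count is at most [(M n)^2]. *)
pose M := 4 * (4 * Rad + 2).
apply: (@squeeze_cvgr _ _ _ _ (fun=> 0) (fun n =>
    (M * n%:R) ^+ 2 * expR (- (scale_of R n ^- 2 * (c / 2))))); last 2 first.
- exact: cvg_cst.
- exact: scale_decay.
near=> n.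
have n0 : (0 < n)%N by near: n; exists 1%N.
have n1' : 1 <= (n%:R : R) by rewrite ler1n.
have hb : (ncard [set P | lattice_zonotopes K n P /\ (eps%:E < hausdorff_dist P K0)%E])%:R <=
    (2 * Bn Rad n)%:R ^+ 2 * expR (scale_of R n ^- 2 * (Ent psi + Dlim psi psi - c)).
  by near: n; exact: bad.
have ht : 4^-1 * expR (scale_of R n ^- 2 * (Ent psi + Dlim psi psi - c / 2)) <=
    (ncard (lattice_zonotopes K n))%:R by near: n; exact: tot.
have Bh : (Bn Rad n)%:R <= (4 * Rad + 2) * n%:R.
  have X0 : 0 <= 4 * Rad * n%:R by rewrite !mulr_ge0.
  have /andP[h _] := Num.Theory.truncn_itv X0.
  rewrite /Bn natrD -natr1; move: h; move: (Num.truncn _)%:R => k h; lra.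
apply/andP; split; first by rewrite divr_ge0.
have T0 : 0 < (ncard (lattice_zonotopes K n))%:R :> R.
  by apply: lt_le_trans ht; rewrite mulr_gt0 ?expR_gt0.
rewrite ler_pdivrMr //; apply: le_trans hb _.
apply: le_trans (ler_wpM2l _ ht); last by rewrite mulr_ge0 ?sqr_ge0 ?expR_ge0.
have -> : scale_of R n ^- 2 * (Ent psi + Dlim psi psi - c) =
  - (scale_of R n ^- 2 * (c / 2)) + scale_of R n ^- 2 * (Ent psi + Dlim psi psi - c / 2).
  by rewrite -mulrN -mulrDr; congr (_ * _); lra.
set a := - _; set b := scale_of R n ^- 2 * (_ - _).
rewrite expRD [leRHS](_ : _ = (M * n%:R) ^+ 2 / 4 * (expR a * expR b)); last by field.
rewrite ler_pM2r ?mulr_gt0 ?expR_gt0 //.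
rewrite ler_pdivlMr // natrM.
have B0 : 0 <= (Bn Rad n)%:R :> R by [].
move: B0 Bh; move: (Bn Rad n)%:R => k k0 hk.
have -> : (2%:R * k) ^+ 2 * 4 = (4 * k) ^+ 2 by ring.
have Mn : 4 * k <= M * n%:R by rewrite /M -mulrA ler_pM2l.
have k4 : 0 <= 4 * k by exact: mulr_ge0.
by rewrite lerXn2r // nnegrE (le_trans k4).
Unshelve. all: by end_near.
Qed.

End Conclusion.

Theorem mainTheorem5 (R : realType) (K : set 'rV[R]_2) (hK : convex_body K) :
  exists K0 : set 'rV[R]_2, [/\ zonoid K0, K0 `<=` K &
    forall eps : R, 0 < eps ->
      (ncard [set P | lattice_zonotopes K n P /\
                      (eps%:E < hausdorff_dist P K0)%E])%:R
        / (ncard (lattice_zonotopes K n))%:R @[n --> \oo] --> (0 : R)].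
Proof.
have [K_compact /convex_setP K_conv [x0 /nbhs_ballP[r /= r0 hr]]] := hK.
(* Half the radius passes from the open ball of the topology to a closed [n1]-ball. *)
have r2 : 0 < r / 2 by lra.
have K_ball x : n1 (x - x0) <= r / 2 -> K x.
  move=> hx; apply: hr; split=> // i j; rewrite ord1 -ball_normE /= distrC.
  have -> : x 0 j - x0 0 j = (x - x0) 0 j by rewrite !mxE.
  apply: le_lt_trans (_ : _ <= n1 (x - x0)) _; last lra.
  have := normr_ge0 ((x - x0) 0 0); have := normr_ge0 ((x - x0) 0 1); rewrite /n1.
  have [->|->] : j = 0 \/ j = 1 by case: j => [[|[|//]] ?]; [left|right]; exact: val_inj.
    by lra.
  by lra.
have K0' : K !=set0 by exists x0; apply: K_ball; rewrite subrr /n1 !mxE normr0; lra.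
have [y Ky ymax] := EVT_max_rV K0' K_compact (continuous_subspaceT (@n1_continuous R)).
have K_rad x : K x -> n1 x <= n1 y by move=> Kx; apply: ymax; rewrite inE.
have [psi psi_norm psi_min] := Jfun_minimizer r2 K_ball K_rad.
have [foc Lam_psi] := first_order r2 K_ball K_rad psi_norm psi_min.
have [t0 K_t0 K0_sub] := limit_body psi_norm r2 K_ball K_rad K_conv K_compact foc.
exists (body t0 (Du psi)); split=> //.
- exact: (limit_zonoid psi_norm r2 K_ball K_rad K_conv K_compact K_t0 K0_sub Lam_psi).
- exact: (bad_ratio_cvg psi_norm r2 K_ball K_rad K_conv K_t0 K0_sub Lam_psi).
Qed.
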